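(* Let $\alpha\in Q_+$ have height $d$ with $\Gamma:=\Lambda-\alpha\in P(m,n;I)$. For $\mathbf i\in I^\alpha$, $j\in\mathbb Z$ and $\lambda\in\Gamma^\circ$, the dimension of the homogeneous component of $e(\mathbf i)D(\lambda)$ of degree $j$ is equal to the number of oriented stretched cap diagrams of the form $\mathbf t[\boldsymbol\gamma]$ with the following properties: (i) the admissible sequence underlying $\mathbf t$ is equal to $\mathbf i$; (ii) the degree of $\mathbf t[\boldsymbol\gamma]$, that is, $\#(\text{clockwise caps})-\#(\text{anti-clockwise cups})$, is equal to $j$; (iii) $\gamma_d=\lambda$; (iv) all boundary caps of $\mathbf t[\boldsymbol\gamma]$ are anti-clockwise.
   Context: **Setup.** $I\subset\mathbb Z$ is a non-empty bounded-below set of consecutive integers, $I^+=I\cup(I+1)$, $o=\min(I)-1$, and $0\le m,n\le|I|+1$ are integers. $P=\bigoplus_{i\in I^+}\mathbb Z\delta_i$ with $(\delta_i,\delta_j)=\delta_{i,j}$; $\alpha_i=\delta_i-\delta_{i+1}$ ($i\in I$); $Q_+=\bigoplus_{i\in I}\mathbb Z_{\ge0}\alpha_i$; the height of $\alpha$ is the sum of its coefficients; $\Lambda=\sum_{i=1}^m\delta_{o+i}+\sum_{i=1}^n\delta_{o+i}$. $I^\alpha=\{\mathbf i=(i_1,\dots,i_d)\in I^d:\alpha_{i_1}+\cdots+\alpha_{i_d}=\alpha\}$. **Weights and blocks.** $\Lambda(m,n;I)$ is the set of labellings of the vertices $I^+$ of a number line by $\circ,\vee,\wedge,\times$ with exactly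 $m$ vertices labelled $\vee$ or $\times$ and exactly $n$ labelled $\wedge$ or $\times$. $\lambda\sim\mu$ if they differ by permuting $\vee$'s and $\wedge$'s; blocks are $\sim$-classes. A block $\Gamma$ is identified with the element of $P$ with $(\Gamma,\delta_i)=0,1,2$ according to whether vertex $i$ is $\circ$, is $\vee$ or $\wedge$ (a ''$\bullet$-vertex''), or is $\times$; $P(m,n;I)\subset P$ is the set of blocks; $\operatorname{def}(\Gamma)=\min(m,n)-\#\{\times\text{'s}\}$. The block $\Lambda$ consists of a single weight $\iota$. **Diagrams.** Taken up to isotopy, words read from bottom to top. A cup diagram of type $\Gamma$ consists of disjoint cups (arcs below the number line joining two $\bullet$-vertices) and rays (vertical, from $\bullet$-vertices down to infinity), each $\bullet$-vertex on exactly one. Cap diagrams are mirror images $a^*$. A cup or cap with ends labelled by one $\vee$ and one $\wedge$ is anti-clockwise if its left end is $\vee$, else clockwise. $a\lambda$ ($\lambda\in\Gamma$) is oriented if each cup has one end $\vee$ and one $\wedge$ and no two rays are labelled $\vee,\wedge$ in this order from left to right; similarly $\lambda b$. $\underline\lambda$ is the unique cup diagram with $\underline\lambda\lambda$ oriented and all cups anti-clockwise; $\overline\lambda=(\underline\lambda)^*$. $\Gamma^\circ$ is the set of $\lambda\in\Gamma$ such that $\underline\lambda$ has $\operatorname{def}(\Gamma)$ cups. Components of diagrams are circles and lines; an oriented circle is anti-clockwise if its leftmost vertices are labelled $\vee$, else clockwise. **Surgery.** Given, between two consecutive number lines, a cap diagram $b$ under its mirror image $b^*$ (corresponding rays joined),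 repeatedly replace an outermost remaining cap of $b$ and its mirror image cup by two vertical segments, leaving labels off the components involved unchanged and reorienting those components by the rules ($1,x,y$ = anti-clockwise circle, clockwise circle, line). Merge: $1\otimes1\mapsto1$, $1\otimes x,x\otimes1\mapsto x$, $x\otimes x\mapsto0$, $1\otimes y\mapsto y$, $x\otimes y\mapsto0$. Split: $1\mapsto1\otimes x+x\otimes1$, $x\mapsto x\otimes x$, $y\mapsto x\otimes y$. Two lines rejoined as two lines: $y\otimes y\mapsto y\otimes y$ if both rays of one line are labelled $\wedge$ and both rays of the other $\vee$, else $0$. Lines keep the labels on their rays. When only vertical segments remain, identify the two number lines. $K_\Gamma$ is the $\mathbb C$-algebra with basis $(a\lambda b)$, $\lambda\in\Gamma$, $a\lambda$ and $\lambda b$ oriented, graded by the number of clockwise cups and caps; $(a\lambda b)(c\mu d)=0$ unless $c=b^*$, in which case draw $a\lambda b$ under $c\mu d$ and perform surgery. $L(\lambda)$ is the one-dimensional graded $K_\Gamma$-module in degree $0$ on which $e_\lambda=(\underline\lambda\lambda\overline\lambda)$ acts as $1$ and other basis vectors as $0$. **Stretched cap diagrams.** A $\Delta\Gamma$-matching is a diagram between a bottom line of type $\Delta$ and a top line of type $\Gamma$ made of disjoint caps on the bottom line, cups on the top line and segments from the bottom to the top line, each $\bullet$-vertex on exactly one. If $i\in I$ and $\Gamma,\Gamma-\alpha_i\in P(m,n;I)$, then $t_i(\Gamma)$ is the $(\Gamma-\alpha_i)\Gamma$-matching with vertical segments except at vertices $i,i+1$, where it has: a cup if these vertices of $\Gamma$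 are $\bullet\bullet$; a cap if they are $\times\circ$; a segment from $i$ on top to $i+1$ on the bottom if $\bullet\circ$; a segment from $i+1$ on top to $i$ on the bottom if $\times\bullet$. $\mathbf i\in I^\alpha$ is $\Lambda$-admissible if all $\Gamma_r=\Lambda-\alpha_{i_1}-\cdots-\alpha_{i_r}$ ($0\le r\le d$) are in $P(m,n;I)$; the associated diagram $\mathbf t=t_d\cdots t_1$, $t_r=t_{i_r}(\Gamma_{r-1})$ ($t_1$ on top, $t_d$ at the bottom), is a stretched cap diagram of type $\alpha$ with underlying admissible sequence $\mathbf i$. An oriented stretched cap diagram is $\mathbf t[\boldsymbol\gamma]=\gamma_dt_d\gamma_{d-1}\cdots\gamma_1t_1\gamma_0$ with $\gamma_r\in\Gamma_r$, every cup and cap having one end $\vee$ and one $\wedge$ and every segment equal labels at its ends. A boundary cap (generalised cap) of $\mathbf t$ is a connected component with both ends on the bottom number line; it is anti-clockwise if its left end on the bottom number line is labelled $\vee$. In (ii), ''caps'' and ''cups'' are the individual caps and cups in the levels $t_1,\dots,t_d$. **The module $D(\lambda)$.** $T^\Lambda_\alpha$ is the graded left $K_{\Lambda-\alpha}$-module with basis $(a\,\mathbf t[\boldsymbol\gamma]|$ for all oriented stretched cap diagrams $\mathbf t[\boldsymbol\gamma]$ of type $\alpha$ and cup diagrams $a$ with $a\gamma_d$ oriented, of degree (number of clockwise cups and caps) $-$ (number of cups in $\mathbf t$); $(a'\lambda b')(a\,\mathbf t[\boldsymbol\gamma]|=0$ unless $a=(b')^*$, in which case draw $a'\lambda b'$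 under $a\,\mathbf t[\boldsymbol\gamma]$ and perform surgery (segments reaching the top line continue to rays). $E^\Lambda_\alpha=\operatorname{End}_{K_{\Lambda-\alpha}}(T^\Lambda_\alpha)^{\mathrm{op}}$, acting on $T^\Lambda_\alpha$ on the right. The paper identifies $E^\Lambda_\alpha$ with the cyclotomic Khovanov-Lauda-Rouquier algebra $R^\Lambda_\alpha$ by an isomorphism under which the generator $e(\mathbf i)$ is the projection of $T^\Lambda_\alpha$ onto the span of the $(a\,\mathbf t[\boldsymbol\gamma]|$ with $\mathbf t$ having underlying sequence $\mathbf i$ (zero if $\mathbf i$ is not $\Lambda$-admissible). For $\lambda\in\Gamma$, $D(\lambda)=\operatorname{Hom}_{K_{\Lambda-\alpha}}(T^\Lambda_\alpha,L(\lambda))$, the graded left module over $E^\Lambda_\alpha\equiv R^\Lambda_\alpha$ with $(xf)(v)=f(vx)$, whose degree $j$ part consists of the maps raising degrees by $j$. *)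

(* Defs.v *)
From HB Require Import structures.
From mathcomp Require Import all_boot all_order all_algebra.
From mathcomp Require Import freeg.
From mathcomp Require Import reals complex.

Set Implicit Arguments.
Unset Strict Implicit.
Unset Printing Implicit Defensive.

Import Order.TTheory GRing.Theory Num.Theory.
Local Open Scope ring_scope.

(* A non-empty bounded-below set of consecutive integers, with
   o = min(I) - 1. *)
Record index_set (I : pred int) (o : int) : Prop := IndexSet {
  index_min : I (o + 1);
  index_lb : forall i, I i -> o + 1 <= i;
  index_consecutive : forall i j k, I i -> I k -> i <= j -> j <= k -> I j }.

(* m <= |I| + 1, also when I is infinite. *)
Definition le_card_succ (m : nat) (I : pred int) : Prop :=
  exists s : seq int, [/\ uniq s, all I s & (m <= (size s).+1)%N].

Definition index_plus (I : pred int) : pred int :=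
  fun i => I i || I (i - 1).

(* Free abelian group on the delta_i, i in Z; the pairing (x, delta_i) is
   [coeff i x].  The lattice P of I is the subgroup spanned by I^+, which
   contains every element considered below. *)
Notation lattice := {freeg int}.

Definition delta (i : int) : lattice := [freeg [:: (1, i)]].
Definition sroot (i : int) : lattice := delta i - delta (i + 1).

Definition LambdaW (o : int) (m n : nat) : lattice :=
  \sum_(1 <= i < m.+1) delta (o + i%:Z) + \sum_(1 <= i < n.+1) delta (o + i%:Z).

Definition in_Qplus (I : pred int) (alpha : lattice) (d : nat) : Prop :=
  exists (s : seq int) (c : int -> nat),
    [/\ uniq s, all I s, alpha = \sum_(i <- s) sroot i *+ c i
      & (d = \sum_(i <- s) c i)%N].

Definition in_I_alpha (I : pred int) (alpha : lattice) (ii : seq int) : bool :=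
  all I ii && (\sum_(i <- ii) sroot i == alpha).

Variant label := LCirc | LVee | LWedge | LCross.

(* (the label contributes a "vee", the label contributes a "wedge") *)
Definition label_code (l : label) : bool * bool :=
  match l with
  | LCirc => (false, false) | LVee => (true, false)
  | LWedge => (false, true) | LCross => (true, true)
  end.
Definition label_decode (c : bool * bool) : label :=
  match c with
  | (false, false) => LCirc | (true, false) => LVee
  | (false, true) => LWedge | (true, true) => LCross
  end.
Lemma label_codeK : cancel label_code label_decode. Proof. by case. Qed.
HB.instance Definition _ := Finite.copy label (can_type label_codeK).

Definition has_vee (l : label) : bool := (label_code l).1.
Definition has_wedge (l : label) : bool := (label_code l).2.

Definition opposite (x y : label) : bool :=
  ((x == LVee) && (y == LWedge)) || ((x == LWedge) && (y == LVee)).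

(* A labelling of the number line all of whose vertices outside
   {o + 1, ..., o + N} are "circ"; p : 'I_N stands for the vertex o + 1 + p.
   Every weight has finitely many vertices not labelled "circ" and I^+ is
   bounded below by o + 1, so every weight is of this form for N large. *)
Definition weight (N : nat) : Type := {ffun 'I_N -> label}.
HB.instance Definition _ N := Finite.on (weight N).

Section NumberLine.
Variable o : int.

Definition vtx N (p : 'I_N) : int := o + 1 + p%:Z.

Definition label_at N (la : weight N) (i : int) : label :=
  if [pick p | vtx (p : 'I_N) == i] is Some p then la p else LCirc.

Definition block_of N (la : weight N) : lattice :=
  \sum_(p < N) delta (vtx p) *+ (has_vee (la p) + has_wedge (la p)).

Definition is_weight (I : pred int) (m n N : nat) (la : weight N) : bool :=
  [&& [forall p : 'I_N, (la p != LCirc) ==> index_plus I (vtx p)],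
      #|[set p | has_vee (la p)]| == m & #|[set p | has_wedge (la p)]| == n].

(* Gamma is in P(m,n;I) *)
Definition is_block (I : pred int) (m n : nat) (Gamma : lattice) : Prop :=
  exists (N : nat) (la : weight N),
    is_weight I m n la /\ block_of la = Gamma.

Definition in_block (I : pred int) (m n : nat) (Gamma : lattice) N
    (la : weight N) : bool :=
  is_weight I m n la && (block_of la == Gamma).

Definition defect (m n : nat) (Gamma : lattice) : nat :=
  (minn m n - count (fun i => coeff i Gamma == 2) (dom Gamma))%N.

Definition bullet (Gamma : lattice) N (p : 'I_N) : bool :=
  coeff (vtx p) Gamma == 1.

(* A cup diagram is encoded by the involution exchanging the two ends of
   each cup; its rays are the fixed bullet-vertices.  The same function
   encodes the mirror image cap diagram. *)
Definition cups (N : nat) : Type := {ffun 'I_N -> 'I_N}.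
HB.instance Definition _ N := Finite.on (cups N).

(* The last condition says that cups do not cross each other and that no ray
   starts below a cup. *)
Definition is_cup_diagram (Gamma : lattice) N (a : cups N) : bool :=
  [&& [forall p, a (a p) == p], [forall p, (a p != p) ==> bullet Gamma p]
    & [forall p : 'I_N, forall q : 'I_N,
        [&& (p < q)%N, (q < a p)%N & bullet Gamma q] ==>
        [&& a q != q, (p < a q)%N & (a q < a p)%N]]].

Definition oriented_cup N (a : cups N) (la : weight N) : bool :=
  [&& is_cup_diagram (block_of la) a,
      [forall p, (a p != p) ==> opposite (la p) (la (a p))]
    & [forall p : 'I_N, forall q : 'I_N,
        [&& (p < q)%N, a p == p & a q == q] ==>
        ~~ ((la p == LVee) && (la q == LWedge))]].

Definition n_cups N (a : cups N) : nat := #|[set p : 'I_N | (p < a p)%N]|.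

Definition n_cw N (a : cups N) (la : weight N) : nat :=
  #|[set p : 'I_N | (p < a p)%N && (la p == LWedge)]|.

(* [pick] selects the unique diagram with the stated property. *)
Definition underline N (la : weight N) : cups N :=
  odflt [ffun p => p]
    [pick a : cups N | oriented_cup a la && (n_cw a la == 0)].

Definition in_block_circ (I : pred int) (m n : nat) (Gamma : lattice) N
    (la : weight N) : bool :=
  in_block I m n Gamma la && (n_cups (underline la) == defect m n Gamma).

(* Vertices of a matching: (true, j) is the vertex j of the top number line
   (of type Gamma), (false, j) that of the bottom one (Gamma - alpha_i). *)
Definition has_cup (i : int) (Gamma : lattice) : bool :=
  (coeff i Gamma == 1) && (coeff (i + 1) Gamma == 1).
Definition has_cap (i : int) (Gamma : lattice) : bool :=
  (coeff i Gamma == 2) && (coeff (i + 1) Gamma == 0).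

Definition half_matching (i : int) (Gamma : lattice) : rel (bool * int) :=
  fun u v =>
  let g j := coeff j Gamma in
  [|| [&& u.1, ~~ v.1, u.2 == v.2, u.2 != i, u.2 != i + 1 & g u.2 == 1],
      [&& has_cup i Gamma, u.1, v.1, u.2 == i & v.2 == i + 1],
      [&& has_cap i Gamma, ~~ u.1, ~~ v.1, u.2 == i & v.2 == i + 1],
      [&& g i == 1, g (i + 1) == 0, u.1, ~~ v.1, u.2 == i & v.2 == i + 1]
    | [&& g i == 2, g (i + 1) == 1, u.1, ~~ v.1, u.2 == i + 1 & v.2 == i]].

Definition matching (i : int) (Gamma : lattice) : rel (bool * int) :=
  fun u v => half_matching i Gamma u v || half_matching i Gamma v u.

End NumberLine.

(* A diagram is drawn on d + 2 number lines, numbered 0, ..., d + 1 from top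
   to bottom.  It is given by the symmetric relation E joining the two ends
   of each of its arcs (cups, caps, segments) and the predicate [ray] of the
   vertices on rays going to infinity. *)
Section Diagrams.
Variables N d : nat.

Definition vertex : Type := ('I_d.+2 * 'I_N)%type.
HB.instance Definition _ := Finite.on vertex.
Definition labelling : Type := {ffun vertex -> label}.
HB.instance Definition _ := Finite.on labelling.

Implicit Types (E : rel vertex) (ray : pred vertex) (L : labelling).

(* Arcs joining two vertices of the same number line are cups and caps. *)
Definition oriented E L : bool :=
  [forall u : vertex, forall v : vertex, E u v ==>
    if u.1 == v.1 then opposite (L u) (L v) else L u == L v].

(* The symbols 1, x, y of the surgery rules. *)
Variant ctype := AntiCircle | CwCircle | Line.

Definition leftmost E (v : vertex) : bool :=
  [forall w : vertex, connect E v w ==> (v.2 <= w.2)%N].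

Definition component_type E ray L (v : vertex) : ctype :=
  if [exists w : vertex, connect E v w && ray w] then Line
  else if [forall w : vertex, connect E v w && leftmost E w ==> (L w == LVee)]
  then AntiCircle else CwCircle.

Definition merge_rule (s t u : ctype) : bool :=
  match s, t, u with
  | AntiCircle, AntiCircle, AntiCircle
  | AntiCircle, CwCircle, CwCircle | CwCircle, AntiCircle, CwCircle
  | AntiCircle, Line, Line | Line, AntiCircle, Line => true
  | _, _, _ => false
  end.

Definition split_rule (s t u : ctype) : bool :=
  match s, t, u with
  | AntiCircle, AntiCircle, CwCircle | AntiCircle, CwCircle, AntiCircle
  | CwCircle, CwCircle, CwCircle
  | Line, CwCircle, Line | Line, Line, CwCircle => true
  | _, _, _ => false
  end.

Definition rays_labelled E ray L (v : vertex) (l : label) : bool :=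
  [forall w : vertex, connect E v w && ray w ==> (L w == l)].

(* One surgery, turning E into E'.  Here x is the left end of the cap, y the
   left end of the mirror image cup and z its right end (so that y and z lie
   on the two vertical segments of E').  The result of the surgery on the
   orientation L of E is the sum of all L' with [surgery_rule ... L L']. *)
Definition surgery_rule E E' ray (x y z : vertex) L L' : bool :=
  [&& oriented E' L',
      [forall v, ~~ connect E x v && ~~ connect E y v ==> (L' v == L v)],
      [forall v, ray v ==> (L' v == L v)]
    & if connect E x y then
        split_rule (component_type E ray L x)
          (component_type E' ray L' y) (component_type E' ray L' z)
      else if connect E' y z then
        merge_rule (component_type E ray L x) (component_type E ray L y)
          (component_type E' ray L' y)
      else
        (rays_labelled E ray L x LWedge && rays_labelled E ray L y LVee) ||
        (rays_labelled E ray L x LVee && rays_labelled E ray L y LWedge)].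

End Diagrams.

Section Module.
Variables (I : pred int) (o : int) (m n : nat) (alpha : lattice) (d : nat).

(* The window {o + 1, ..., o + max(m,n) + d} contains the support of every
   weight in Lambda - alpha and in Gamma_0, ..., Gamma_d below.  Lambda is supported in
   {o + 1, ..., o + max(m,n)}.  Write Lambda - alpha = Gamma in P(m,n;I) with
   alpha = sum_i c_i alpha_i of height d; then
   c_j - c_(j-1) = - (Gamma, delta_j) <= 0 for j > o + max(m,n), so a vertex
   k > o + max(m,n) + d with (Gamma, delta_k) > 0 would make the d + 1
   coefficients c_(k-d-1), ..., c_(k-1) positive.  The same applies to the
   partial sums Gamma_0, ..., Gamma_d of an admissible sequence, hence to its
   entries. *)
Definition width : nat := (maxn m n + d)%N.

Local Notation N := width.
Local Notation vert := (vertex N d).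
Local Notation labs := (labelling N d).

Definition Gamma : lattice := LambdaW o m n - alpha.

(* The block Gamma_r = Lambda - alpha_(i_1) - ... - alpha_(i_r). *)
Definition Gamma_ (ii : seq int) (r : nat) : lattice :=
  LambdaW o m n - \sum_(i <- take r ii) sroot i.

(* The arcs of t = t_d ... t_1, drawn on the number lines 0, ..., d: the
   matching t_(k + 1) has top line k and bottom line k + 1.  The number line
   d + 1 is not met by t. *)
Definition line_of (k : nat) (top : bool) : nat := if top then k else k.+1.

Definition t_arcs (ii : seq int) : rel vert := fun u v =>
  [exists k : 'I_d, exists s : bool, exists s' : bool,
    [&& u.1 == line_of k s :> nat, v.1 == line_of k s' :> nat
      & matching (nth 0 ii k) (Gamma_ ii k) (s, vtx o u.2) (s', vtx o v.2)]].

(* gamma_0, ..., gamma_d on the number lines 0, ..., d, and la on the number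
   line d + 1. *)
Definition stack (gam : {ffun 'I_d.+1 -> weight N}) (la : weight N) : labs :=
  [ffun v : vert => if (v.1 <= d)%N then gam (inord v.1) v.2 else la v.2].

Definition double (gam : {ffun 'I_d.+1 -> weight N}) : labs :=
  stack gam (gam ord_max).

(* Oriented stretched cap diagrams t[gamma] of type alpha.  The admissibility
   of the sequence is part of the second condition, since is_block Gamma_r
   follows from gamma_r being a weight in Gamma_r. *)
Definition is_stretched
    (t : d.-tuple 'I_N * {ffun 'I_d.+1 -> weight N}) : bool :=
  let ii := map (@vtx o N) t.1 in
  [&& in_I_alpha I alpha ii,
      [forall r : 'I_d.+1, in_block o I m n (Gamma_ ii r) (t.2 r)]
    & oriented (t_arcs ii) (double t.2)].

Definition stretched : Type :=
  {t : d.-tuple 'I_N * {ffun 'I_d.+1 -> weight N} | is_stretched t}.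
HB.instance Definition _ := Finite.on stretched.

Definition seq_of (t : stretched) : seq int := map (@vtx o N) (val t).1.
Definition wt_of (t : stretched) (r : nat) : weight N := (val t).2 (inord r).
Definition bottom_wt (t : stretched) : weight N := (val t).2 ord_max.

(* The matching t_(k + 1) has a cup (on line k) or a cap (on line k + 1)
   whose left end is labelled l. *)
Definition cup_with (t : stretched) (l : label) (k : nat) : bool :=
  let i := nth 0 (seq_of t) k in
  has_cup i (Gamma_ (seq_of t) k) && (label_at o (wt_of t k) i == l).
Definition cap_with (t : stretched) (l : label) (k : nat) : bool :=
  let i := nth 0 (seq_of t) k in
  has_cap i (Gamma_ (seq_of t) k) && (label_at o (wt_of t k.+1) i == l).

Definition cw_cups (t : stretched) : nat := #|[set k : 'I_d | cup_with t LWedge k]|.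
Definition acw_cups (t : stretched) : nat := #|[set k : 'I_d | cup_with t LVee k]|.
Definition cw_caps (t : stretched) : nat := #|[set k : 'I_d | cap_with t LWedge k]|.
Definition t_cups (t : stretched) : nat :=
  #|[set k : 'I_d | has_cup (nth 0 (seq_of t) k) (Gamma_ (seq_of t) k)]|.

Definition stretched_degree (t : stretched) : int :=
  (cw_caps t)%:Z - (acw_cups t)%:Z.

(* A component of t meets the bottom number line d only at its ends, so the
   boundary caps are given by the pairs of distinct connected vertices of
   that line. *)
Definition boundary_caps_anticlockwise (t : stretched) : bool :=
  [forall u : vert, forall v : vert,
    [&& u.1 == d :> nat, v.1 == d :> nat, (u.2 < v.2)%N
      & connect (t_arcs (seq_of t)) u v] ==> (bottom_wt t u.2 == LVee)].

(* (a, la, b) stands for the basis vector (a la b^* ). *)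
Definition K_basis : Type :=
  {k : cups N * weight N * cups N |
    [&& in_block o I m n Gamma k.1.2, oriented_cup o k.1.1 k.1.2
      & oriented_cup o k.2 k.1.2]}.
HB.instance Definition _ := Finite.on K_basis.

Definition T_basis : Type :=
  {x : cups N * stretched | oriented_cup o x.1 (bottom_wt x.2)}.
HB.instance Definition _ := Finite.on T_basis.

Definition T_degree (x : T_basis) : int :=
  let: (a, t) := val x in
  (n_cw a (bottom_wt t) + cw_cups t + cw_caps t)%:Z - (t_cups t)%:Z.

(* The diagram a c c^* t, where c is what remains of the middle cap diagram:
   a hangs below the line d + 1, the caps of c are on the line d + 1 and the
   mirror image cups on the line d, and the remaining bullet-vertices of
   these two lines are joined by vertical segments. *)
Definition product_arcs (ii : seq int) (a c : cups N) : rel vert := fun u v =>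
  let middle (w : vert) := (w.1 == d :> nat) || (w.1 == d.+1 :> nat) in
  [|| t_arcs ii u v,
      [&& u.1 == d.+1 :> nat, v.1 == d.+1 :> nat, u.2 != v.2 & a u.2 == v.2],
      [&& middle u, u.1 == v.1, u.2 != v.2 & c u.2 == v.2]
    | [&& middle u, middle v, u.1 != v.1, u.2 == v.2, c u.2 == u.2
        & bullet o Gamma u.2]].

Definition product_rays (a : cups N) : pred vert := fun v =>
  ((v.1 == 0 :> nat) && bullet o (LambdaW o m n) v.2) ||
  [&& v.1 == d.+1 :> nat, a v.2 == v.2 & bullet o Gamma v.2].

Definition cut_cap (c : cups N) (p : 'I_N) : cups N :=
  [ffun q => if (q == p) || (q == c p) then q else c q].

(* Surgery on the caps of c with left ends ps, in this order, starting from
   the formal sum f of orientations ([f L] is the multiplicity of L). *)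
Fixpoint surgeries (ii : seq int) (a : cups N) (ps : seq 'I_N) (c : cups N)
    (f : labs -> nat) : labs -> nat :=
  if ps is p :: ps' then
    let c' := cut_cap c p in
    surgeries ii a ps' c' (fun L' => \sum_(L : labs | surgery_rule
      (product_arcs ii a c) (product_arcs ii a c') (product_rays a)
      (inord d.+1, p) (inord d, p) (inord d, c p) L L') f L)%N
  else f.

(* Multiplicity of the basis vector y in the product k x.  The caps are
   processed by increasing left end, so each is outermost when its turn
   comes. *)
Definition structure_coef (k : K_basis) (x y : T_basis) : nat :=
  let: (a', la, b') := val k in
  let: (a, t) := val x in
  let: (a2, t2) := val y in
  if [&& b' == a, a2 == a' & seq_of t2 == seq_of t] then
    surgeries (seq_of t) a' [seq p : 'I_N <- enum 'I_N | (p < a p)%N] a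
      (fun L => (L == stack (val t).2 la) : nat) (double (val t2).2)
  else 0%N.

Section Scalars.
Variable F : fieldType.

Definition T_module : Type := {ffun T_basis -> F^o}.
HB.instance Definition _ := Vector.on T_module.

Definition T_vec (x : T_basis) : T_module := [ffun y => (y == x)%:R].

Definition K_act (k : K_basis) (v : T_module) : T_module :=
  [ffun y => \sum_(x : T_basis) v x * (structure_coef k x y)%:R].

Lemma K_act_linear k : linear (K_act k).
Proof.
move=> c u v; apply/ffunP=> y; rewrite !ffunE scaler_sumr -big_split /=.
by apply: eq_bigr => x _; rewrite !ffunE mulrDl scalerAl.
Qed.
HB.instance Definition _ k :=
  GRing.isLinear.Build F T_module T_module _ (K_act k) (K_act_linear k).

(* L(la) is the field F, on which the basis vector k acts as L_char la k. *)
Definition L_char (la : weight N) (k : K_basis) : F :=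
  (val k == (underline o la, la, underline o la))%:R.

Definition L_deg (j : int) : {vspace F^o} := if j == 0 then fullv else 0%VS.

Local Notation HomT := 'Hom(T_module, F^o).

Definition K_comm (la : weight N) (k : K_basis) (f : HomT) : HomT :=
  (f \o linfun (K_act k))%VF - L_char la k *: f.

Lemma K_comm_linear la k : linear (K_comm la k).
Proof.
move=> c f g; rewrite /K_comm comp_lfunDl -comp_lfunZl scalerBr scalerDr opprD.
by rewrite !scalerA (mulrC c) addrACA.
Qed.
HB.instance Definition _ la k :=
  GRing.isLinear.Build F HomT HomT _ (K_comm la k) (K_comm_linear la k).

(* D(la) = Hom_K(T, L(la)); see mem_D_module. *)
Definition D_module (la : weight N) : {vspace HomT} :=
  (\bigcap_(k : K_basis) lker (linfun (K_comm la k)))%VS.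

Lemma mem_D_module la (f : HomT) :
  reflect (forall k v, f (K_act k v) = L_char la k * f v) (f \in D_module la).
Proof.
rewrite /D_module memvE; apply: (iffP subv_bigcapP) => [Df k v | Df k _].
  have:= Df k isT; rewrite -memvE memv_ker lfunE /= subr_eq0 => /eqP/lfunP/(_ v).
  by rewrite comp_lfunE lfunE scale_lfunE.
rewrite -memvE memv_ker lfunE /= subr_eq0; apply/eqP/lfunP=> v.
by rewrite comp_lfunE lfunE scale_lfunE /= Df.
Qed.

(* The maps T -> L(la) raising degrees by j; see mem_Hom_deg. *)
Definition ev_basis (x : T_basis) (f : HomT) : F^o := f (T_vec x).

Lemma ev_basis_linear x : linear (ev_basis x).
Proof. by move=> c f g; rewrite /ev_basis add_lfunE scale_lfunE. Qed.
HB.instance Definition _ x :=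
  GRing.isLinear.Build F HomT F^o _ (ev_basis x) (ev_basis_linear x).

Definition Hom_deg (j : int) : {vspace HomT} :=
  (\bigcap_(x : T_basis) (linfun (ev_basis x) @^-1: L_deg (T_degree x + j)))%VS.

Lemma mem_Hom_deg j (f : HomT) :
  reflect (forall x, f (T_vec x) \in L_deg (T_degree x + j)) (f \in Hom_deg j).
Proof.
rewrite /Hom_deg memvE; apply: (iffP subv_bigcapP) => Hf x => [|_].
  by have:= Hf x isT; rewrite -memvE -memv_preim lfunE.
by rewrite -memvE -memv_preim lfunE Hf.
Qed.

(* An endomorphism x of T, acting on the right of T, acts on D(la) by
   (x f)(v) = f(v x). *)
Definition End_act (x : 'End(T_module)) (f : HomT) : HomT := (f \o x)%VF.

Lemma End_act_linear x : linear (End_act x).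
Proof. by move=> c f g; rewrite /End_act comp_lfunDl -comp_lfunZl. Qed.
HB.instance Definition _ x :=
  GRing.isLinear.Build F HomT HomT _ (End_act x) (End_act_linear x).

Definition idem_fun (ii : seq int) (v : T_module) : T_module :=
  [ffun x => if seq_of (val x).2 == ii then v x else 0].

Lemma idem_fun_linear ii : linear (idem_fun ii).
Proof.
move=> c u v; apply/ffunP=> x; rewrite !ffunE.
by case: ifP => // _; rewrite scaler0 addr0.
Qed.
HB.instance Definition _ ii :=
  GRing.isLinear.Build F T_module T_module _ (idem_fun ii) (idem_fun_linear ii).

(* The projection e(i) is an endomorphism of the K-module T. *)
Lemma idem_fun_K_act ii k v : idem_fun ii (K_act k v) = K_act k (idem_fun ii v).
Proof.
apply/ffunP=> y; rewrite !ffunE.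
have coef0 x : seq_of (val x).2 != seq_of (val y).2 -> structure_coef k x y = 0%N.
  rewrite /structure_coef; case: (val k) => [[a' la] b'].
  case: (val x) => a t; case: (val y) => a2 t2 /= nt.
  by case: ifP => // /and3P[_ _]; rewrite eq_sym (negPf nt).
case: eqP => [<-|/eqP ny].
  apply: eq_bigr => x _; rewrite ffunE; case: eqP => // /eqP nx.
  by rewrite coef0 // mulr0 mul0r.
rewrite big1 // => x _; rewrite ffunE; case: eqP => [xi|]; last by rewrite mul0r.
by rewrite coef0 ?mulr0 // xi eq_sym.
Qed.

Definition idem (ii : seq int) : 'End(T_module) := linfun (idem_fun ii).

Definition eD (ii : seq int) (la : weight N) : {vspace HomT} :=
  (linfun (End_act (idem ii)) @: D_module la)%VS.

Definition eD_deg (ii : seq int) (la : weight N) (j : int) : {vspace HomT} :=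
  (eD ii la :&: Hom_deg j)%VS.

End Scalars.
End Module.

(* Main.v *)
(** The caps of [t = t_d ... t_1] left on the bottom line after removing closed
    circles form a cap diagram [b], its lower reduction, and all lines of [t]
    carry the unique ray label of Lambda.  A basis vector [(a, t[gamma])] is
    the product of the basis vector [(a, gamma_d, b)] of K with
    [(b, t[gamma'])], where [gamma'] is [gamma] with all boundary caps made
    anti-clockwise: every surgery merges an anti-clockwise circle into another
    component.  Hence an element of [D(la)] vanishes on all basis vectors
    except those with [a = underline la], [gamma_d = la] and all boundary caps
    anti-clockwise.  Conversely such a basis vector [y] occurs in a product
    [k x] only for [k = e_la] and [x = y]: going back from [y] through the
    surgeries, every component touched is an anti-clockwise circle or a line,
    a split always creates a clockwise circle, and two lines carrying the same
    ray label are never rejoined; so every surgery is a merge, and the merges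
    determine [k] and [x].

    That the orientation of a circle can be read off at its leftmost vertex on
    any number line follows from the invariance of the winding number on the
    right-hand side of the circle.  The degree of such a [y] is the sum of +1
    or -1 over the closed circles of [t], so that reversing these circles
    exchanges the degrees j and -j, as the dualization requires. *)

From HB Require Import structures.
Require Import Defs.
From mathcomp Require Import all_boot all_order all_algebra.
From mathcomp Require Import freeg reals complex.
From mathcomp Require Import zify.

Set Implicit Arguments.
Unset Strict Implicit.
Unset Printing Implicit Defensive.

Import Order.TTheory GRing.Theory Num.Theory.
Local Open Scope ring_scope.

(** * Labels and cup diagrams *)


(** Planarity enters only through invariants of finite graphs. The caps formed by the first levels
    are computed level by level as an involution on positions, [pairing]. That it describes
    connectedness rests on a count of ends: a component has at most two, and every vertex of the top
    or bottom line is one. Arguments with closed curves become sums of charges, +1 for a vee and -1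
    for a wedge, to the left of a vertex.

    All lines of t carry the same label because in the only weight of Lambda the crosses use up
    every vee or every wedge, whichever are fewer.

    A surgery sums over all labellings, so both existence and uniqueness of the resulting
    orientation are at stake. Forwards, the orientation after each step is known in closed form
    ([intermediate]). Backwards, only the final orientation is known, and the caps that were cut
    have to be recovered from it.

    The sign in the degree arises because a map of degree j to a module concentrated in degree 0
    lives on vectors of degree -j. *)

Definition flip (l : label) : label :=
  match l with LVee => LWedge | LWedge => LVee | l => l end.

Definition charge (l : label) : int :=
  match l with LVee => 1 | LWedge => -1 | _ => 0 end.

Definition strands (l : label) : int := (has_vee l + has_wedge l)%N%:Z.

Lemma flipK : involutive flip. Proof. by case. Qed.

Lemma opposite_flip x y : opposite x y -> y = flip x.
Proof. by case: x; case: y. Qed.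

Lemma opposite_sym x y : opposite x y = opposite y x.
Proof. by case: x; case: y. Qed.

Lemma flip_opposite x y : opposite (flip x) (flip y) = opposite x y.
Proof. by case: x; case: y. Qed.

Lemma strands_flip x : strands (flip x) = strands x.
Proof. by case: x. Qed.

Lemma strands1P x : (strands x == 1) = (x == LVee) || (x == LWedge).
Proof. by case: x. Qed.

Lemma strands1_charge x : strands x != 1 -> charge x = 0.
Proof. by case: x. Qed.

(** * Graphs of maximal degree 2 *)

Section ThreeEnds.
Variables (T : finType) (e : rel T).
Hypothesis deg2 : forall x y1 y2 y3,
  e x y1 -> e x y2 -> e x y3 -> [|| y1 == y2, y1 == y3 | y2 == y3].
Hypothesis esym : symmetric e.

(** An isolated vertex counts as an end. *)
Definition is_end x := forall y1 y2, e x y1 -> e x y2 -> y1 = y2.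

(* A connected graph of maximal degree 2 is a path or a cycle. *)
Lemma three_ends u v w : is_end u -> is_end v -> is_end w ->
  connect e u v -> connect e u w -> [|| u == v, u == w | v == w].
Proof.
move=> eu ev ew /connectP[p0 pp0 Dv] cuw.
case: eqP => //= neq; have {neq}: u != v by apply/eqP.
rewrite {}Dv in ev *; case: (shortenP pp0) ev => {pp0} p pp Up _ ev neq.
have neigh x y z p1 p2 : p = p1 ++ x :: z :: p2 -> e x y ->
    (y == last u p1) || (y == z).
  move=> Dp exy; move: pp; rewrite Dp cat_path /= => /and4P[_ e1 e2 _].
  rewrite esym in e1; have := deg2 exy e1 e2.
  case: (y == _) => //=; case: (y == z) => //= /eqP E.
  move: Up; rewrite Dp -cat_cons cat_uniq => /and3P[_ /hasPn/(_ z) nh _].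
  have mz : z \in x :: z :: p2 by rewrite !inE eqxx orbT.
  by case/negP: (nh mz); rewrite -E; apply: mem_last.
(* The simple path from [u] to [v] is closed under [e], hence is the whole component. Its interior
   vertices have two distinct neighbours and are no ends. *)
have cl x y : x \in u :: p -> e x y -> y \in u :: p.
  rewrite inE => /orP[/eqP-> | /splitPr Dp] exy.
    case: p pp neq {Up ev neigh} => [|b p] /=; first by rewrite eqxx.
    by move=> /andP[eub _] _; rewrite (eu _ _ exy eub) !inE eqxx orbT.
  case: Dp pp ev neigh {Up neq} => p1 [|b p2] pp ev neigh.
    move: pp; rewrite cat_path /= andbT => /andP[_ e1].
    have ex : is_end x by rewrite last_cat in ev.
    rewrite esym in e1; rewrite (ex _ _ exy e1) -cat_cons mem_cat.
    by rewrite mem_last.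
  have /orP[/eqP->|/eqP->] := neigh _ _ _ _ _ erefl exy.
    by rewrite -cat_cons mem_cat mem_last.
  by rewrite -cat_cons mem_cat !inE eqxx !orbT.
have clp q x : x \in u :: p -> path e x q -> last x q \in u :: p.
  by elim: q x => //= b q IH x xP /andP[exb pq]; apply: IH pq; apply: cl exb.
have : w \in u :: p.
  by case/connectP: cuw => q pq ->; apply: clp pq; apply: mem_head.
rewrite inE eq_sym => /orP[-> //|/splitPr Dp].
case: Dp pp Up {ev neq neigh cl} => p1 [|b p2] pp Up.
  by rewrite last_cat /= eqxx orbT.
move: pp; rewrite cat_path /= => /and4P[_ e1 e2 _].
rewrite esym in e1; have E := ew _ _ e1 e2.
move: Up; rewrite -cat_cons cat_uniq => /and3P[_ /hasPn/(_ b) nh _].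
have mb : b \in w :: b :: p2 by rewrite !inE eqxx orbT.
by case/negP: (nh mb); rewrite -E; apply: mem_last.
Qed.

End ThreeEnds.

Section CupDiagrams.
Variables (o : int) (N : nat).
Implicit Types (la : weight N) (a b : cups N) (G : lattice).

Lemma coeff_delta (i j : int) : coeff i (delta j) = (i == j)%:Z.
Proof. by rewrite /delta coeffU mul1r eq_sym natz. Qed.

Lemma coeff_sroot (i j : int) : coeff i (sroot j) = (i == j)%:Z - (i == j + 1)%:Z.
Proof. by rewrite coeffB !coeff_delta. Qed.

Lemma coeff_sum (J : Type) (r : seq J) (P : pred J) (f : J -> lattice) (i : int) :
  coeff i (\sum_(x <- r | P x) f x) = \sum_(x <- r | P x) coeff i (f x).
Proof. by elim/big_rec2: _ => [|x y1 y2 _ <-]; rewrite ?coeff0 ?coeffD. Qed.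

Lemma vtx_inj : injective (@vtx o N).
Proof. by by move=> p q /addrI [] /val_inj. Qed.

Lemma coeff_block la p : coeff (vtx o p) (block_of o la) = strands (la p).
Proof.
rewrite coeff_sum (bigD1 p) //= big1 => [|q qp].
  by rewrite coeffMn coeff_delta eqxx addr0 /strands natz.
rewrite coeffMn coeff_delta; case: eqP => [/vtx_inj E|_]; last by rewrite mul0rn.
by rewrite E eqxx in qp.
Qed.

Lemma coeff_block_out la i : (forall p : 'I_N, vtx o p != i) ->
  coeff i (block_of o la) = 0.
Proof.
move=> H; rewrite coeff_sum big1 // => q _; rewrite coeffMn coeff_delta.
by rewrite eq_sym (negPf (H q)) mul0rn.
Qed.

Lemma cup_diagramP G a : reflect
  [/\ (forall p : 'I_N, a (a p) = p), (forall p : 'I_N, a p != p -> bullet o G p)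
    & forall p q : 'I_N, (p < q)%N -> (q < a p)%N -> bullet o G q ->
        [/\ a q != q, (p < a q)%N & (a q < a p)%N]]
  (is_cup_diagram o G a).
Proof.
apply: (iffP and3P) => [[/forallP h1 /forallP h2 /forallP h3]|[h1 h2 h3]].
  split=> [p|p|p q pq qp bq]; first exact/eqP.
    by move=> ?; apply: (implyP (h2 p)).
  have /forallP/(_ q) := h3 p; rewrite pq qp bq /=.
  by case/and3P.
split; apply/forallP=> p; first by rewrite h1.
  by apply/implyP/h2.
by apply/forallP=> q; apply/implyP=> /and3P[pq qp bq]; apply/and3P/h3.
Qed.

Lemma oriented_cupP a la : reflect
  [/\ is_cup_diagram o (block_of o la) a,
      (forall p : 'I_N, a p != p -> opposite (la p) (la (a p)))
    & forall p q : 'I_N, (p < q)%N -> a p = p -> a q = q ->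
        la p = LVee -> la q = LWedge -> False]
  (oriented_cup o a la).
Proof.
apply: (iffP and3P) => [[h1 /forallP h2 /forallP h3]|[h1 h2 h3]].
  split=> // [p ap|p q pq ap aq lp lq]; first exact: (implyP (h2 p)).
  by have /forallP/(_ q) := h3 p; rewrite pq ap aq lp lq !eqxx.
split=> //; apply/forallP=> p; first exact/implyP/h2.
apply/forallP=> q; apply/implyP=> /and3P[pq /eqP ap /eqP aq].
by apply/negP=> /andP[/eqP lp /eqP lq]; exact: h3 pq ap aq lp lq.
Qed.

Lemma n_cw0P a la : reflect (forall p : 'I_N, (p < a p)%N -> la p != LWedge)
  (n_cw a la == 0%N).
Proof.
rewrite /n_cw cards_eq0; apply: (iffP eqP) => [/setP H p pa|H].
  by have := H p; rewrite !inE pa /= => ->.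
apply/setP=> p; rewrite !inE; apply/negbTE/negP=> /andP[/H/negPf->] //.
Qed.

Lemma bullet_block la p : bullet o (block_of o la) p = (strands (la p) == 1).
Proof. by rewrite /bullet coeff_block. Qed.

(* Induction on the width of a cup: the vertices below it are matched among
   themselves by both diagrams. *)
Lemma acw_cup_shared a b la : oriented_cup o a la -> oriented_cup o b la ->
  n_cw a la == 0%N -> n_cw b la == 0%N ->
  forall p : 'I_N, (p < a p)%N -> b p = a p.
Proof.
move=> /oriented_cupP[/cup_diagramP[aK abul anc] aor _].
move=> /oriented_cupP[/cup_diagramP[bK bbul bnc] bor bray] /n_cw0P acw /n_cw0P bcw.
move=> p; move: {2}(a p - p)%N (leqnn (a p - p)) => w.
elim: w p => [|w IH] p lew pap; first by lia.
have nap : a p != p by apply: contraTneq pap => ->; rewrite ltnn.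
have lp : la p = LVee.
  by have := aor p nap; have := acw p pap; case: (la p); case: (la _).
have lq : la (a p) = LWedge by have := aor p nap; rewrite lp; case: (la _).
have inner (x : 'I_N) : (p < x)%N -> (x < a p)%N -> bullet o (block_of o la) x ->
    [/\ (p < b x)%N, (b x < a p)%N & b x = a x].
  move=> px xq bx; have [nx pax axq] := anc p x px xq bx.
  suff E : b x = a x by rewrite E.
  case: (ltnP x (a x)) => [xax|axx]; first by apply: IH => //; lia.
  have nv : (a x : nat) <> x by move=> /val_inj E; rewrite E eqxx in nx.
  have := IH (a x); rewrite aK => /(_ ltac:(lia) ltac:(lia)) E.
  by rewrite -[LHS](f_equal b E) bK.
have outer (y : 'I_N) : (p < b y)%N && (b y < a p)%N -> (p < y)%N && (y < a p)%N.
  move=> /andP[h1 h2]; case: (eqVneq (b y) y) => [E|ny]; first by rewrite -E h1.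
  have [] := inner (b y) h1 h2; first by apply: bbul; rewrite bK eq_sym.
  by rewrite bK => -> ->.
have bul (x : 'I_N) : la x = LVee \/ la x = LWedge -> bullet o (block_of o la) x.
  by rewrite bullet_block strands1P; case=> ->.
have wedge_b (x : 'I_N) : la x = LWedge -> (b x <= x)%N.
  by move=> lx; rewrite leqNgt; apply/negP=> /bcw; rewrite lx.
have vee_b (x : 'I_N) : la x = LVee -> (x <= b x)%N.
  move=> lx; rewrite leqNgt; apply/negP=> bxx.
  have nx : b x != x by apply: contraTneq bxx => ->; rewrite ltnn.
  have := bor x nx; have := bcw (b x); rewrite bK lx => /(_ bxx).
  by case: (la (b x)).
(* In [b] the vee at [p] can only go right or be a ray, and the wedge at [a p] can only go left or
   be a ray; neither may land strictly between the two. Unless [b p = a p], this yields a crossing,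
   a ray under a cup, or a vee ray to the left of a wedge ray. *)
case: (eqVneq (b p) p) => [bp|nbp].
  case: (eqVneq (b (a p)) (a p)) => [bq|nbq].
    by case: (bray _ _ pap bp bq lp lq).
  have bq := wedge_b _ lq; have nv : (b (a p) : nat) <> a p.
    by move=> /val_inj E; rewrite E eqxx in nbq.
  case: (ltngtP (b (a p)) p) => [lt|gt|/val_inj E].
  - have [] := bnc (b (a p)) p lt; rewrite ?bK ?bp ?eqxx //.
    by apply: bul; left.
  - by have := outer (a p); rewrite gt ltnn andbF => /(_ ltac:(lia)).
  - by move: bp; rewrite -{1}E bK => E'; rewrite E' ltnn in pap.
have bp := vee_b _ lp; have nv : (b p : nat) <> p.
  by move=> /val_inj E; rewrite E eqxx in nbp.
apply/eqP; apply/negPn/negP=> /eqP ne.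
have nv' : (b p : nat) <> a p by move=> /val_inj.
case: (ltngtP (b p) (a p)) => [lt|gt|/val_inj //].
  by have := outer p; rewrite lt ltnn => /(_ ltac:(lia)).
have [nb pb bb] := bnc p (a p) pap gt (bul _ (or_intror lq)).
have lb := wedge_b _ lq; have nv'' : (b (a p) : nat) <> a p.
  by move=> /val_inj E; rewrite E eqxx in nb.
by have := outer (a p); rewrite pb ltnn andbF => /(_ ltac:(lia)).
Qed.

Lemma acw_cup_unique a b la : oriented_cup o a la -> oriented_cup o b la ->
  n_cw a la == 0%N -> n_cw b la == 0%N -> a = b.
Proof.
move=> oa ob ca cb; apply/ffunP=> p.
have hab := acw_cup_shared oa ob ca cb; have hba := acw_cup_shared ob oa cb ca.
have /oriented_cupP[/cup_diagramP[aK _ _] _ _] := oa.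
have /oriented_cupP[/cup_diagramP[bK _ _] _ _] := ob.
case: (ltngtP p (a p)) => [/hab //|lt|/val_inj E].
  have := hab (a p); rewrite aK => /(_ lt) E.
  by rewrite -[in RHS]E bK.
case: (ltngtP p (b p)) => [/hba //|lt|/val_inj E']; last by rewrite -E -E'.
have := hba (b p); rewrite bK => /(_ lt) E'.
by rewrite -[in LHS]E' aK.
Qed.

Lemma underline_unique a la : oriented_cup o a la -> n_cw a la == 0%N ->
  underline o la = a.
Proof.
move=> oa ca; rewrite /underline; case: pickP => [b /andP[ob cb]|/(_ a)] /=.
  exact: acw_cup_unique ob oa cb ca.
by rewrite oa ca.
Qed.

(** True as well for the default value of [underline], which has no cups. *)
Lemma underline_acw la : n_cw (underline o la) la == 0%N.
Proof.
rewrite /underline; case: pickP => [b /andP[]//|_] /=.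
by apply/n_cw0P => p; rewrite ffunE ltnn.
Qed.

End CupDiagrams.

(** * Noncrossing pairings *)


(** The conditions of [is_cup_diagram] for functions on all of [nat], so that the local moves below
    can be defined without bounds on positions. *)
Definition noncrossing (bul : pred nat) (f : nat -> nat) : Prop :=
  [/\ forall p, f (f p) = p, forall p, f p <> p -> bul p
    & forall p q, (p < q)%N -> (q < f p)%N -> bul q ->
        [/\ f q <> q, (p < f q)%N & (f q < f p)%N]].

(** Effect on the caps collected so far of a level with a cup at [s], [s.+1]: the partners of these
    two vertices get joined. If one of the two is free, that is, runs to the top line, the partner
    of the other becomes free. *)
Definition join_ends (s : nat) (f : nat -> nat) (p : nat) : nat :=
  if (p == s) || (p == s.+1) then p
  else if f p == s then (if f s.+1 == s.+1 then p else f s.+1)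
  else if f p == s.+1 then (if f s == s then p else f s) else f p.

(** Effect of a level with a cap at [s], [s.+1]. *)
Definition insert_pair (s : nat) (f : nat -> nat) (p : nat) : nat :=
  if p == s then s.+1 else if p == s.+1 then s else f p.

Definition swap_next (s p : nat) : nat :=
  if p == s then s.+1 else if p == s.+1 then s else p.

(** Effect of a level with a slanted segment between [s] and [s.+1]. Conjugation by the
    transposition covers both directions of the slant. *)
Definition shift_end (s : nat) (f : nat -> nat) (p : nat) : nat :=
  swap_next s (f (swap_next s p)).

Lemma swap_nextK s : involutive (swap_next s).
Proof. by move=> p; rewrite /swap_next; repeat case: eqP => //; lia. Qed.

Lemma swap_next_mono s p q : (p < q)%N -> ~ (p = s /\ q = s.+1) ->
  (swap_next s p < swap_next s q)%N.
Proof. by rewrite /swap_next; do !case: eqP; lia. Qed.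

Section Pairings.
Variables (s : nat) (bul bul' : pred nat) (f : nat -> nat).
Hypothesis bulE : forall p, p <> s -> p <> s.+1 -> bul' p = bul p.
Hypothesis fnc : noncrossing bul f.

(** Since [s] and [s.+1] are adjacent, their arcs lie side by side or one inside the other. A bullet
    under the new arc is therefore under exactly one of the two old arcs, and so is its partner. An
    unaffected arc passing over one of [s], [s.+1] passes over both and over their partners. *)
Lemma join_ends_noncrossing : bul s -> bul s.+1 ->
  bul' s = false -> bul' s.+1 = false -> noncrossing bul' (join_ends s f).
Proof.
case: fnc => fK fbul nc bs bs1 b's b's1.
have fI p q : f p = q -> f q = p by move=> <-; rewrite fK.
have JE p : [\/ [/\ join_ends s f p = p & p = s \/ p = s.+1],
     [/\ p <> s, p <> s.+1, f p = s, f s = p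
       & join_ends s f p = if f s.+1 == s.+1 then p else f s.+1],
     [/\ p <> s, p <> s.+1, f p = s.+1, f s.+1 = p
       & join_ends s f p = if f s == s then p else f s]
   | [/\ p <> s, p <> s.+1, f p <> s, f p <> s.+1 & join_ends s f p = f p]].
  rewrite /join_ends; case: (p =P s) => [->|ns]; first by constructor 1; auto.
  case: (p =P s.+1) => [->|ns1]; first by constructor 1; auto.
  rewrite /=; case: (f p =P s) => [E|nE]; first by constructor 2; rewrite (fI _ _ E).
  case: (f p =P s.+1) => [E|nE']; first by constructor 3; rewrite (fI _ _ E).
  by constructor 4.
have fss := fK s; have fss1 := fK s.+1.
split=> [p|p|p q].
- case: (JE p) => [[e _]|[ns ns1 E E' ->]|[ns ns1 E E' ->]|[ns ns1 nE nE1 ->]].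
  + by rewrite !e.
  + case: (f s.+1 =P s.+1) => e; first by rewrite /join_ends; case: eqP => //; case: eqP => //; rewrite E eqxx e eqxx.
    case: (JE (f s.+1)); rewrite ?fK => -[]; first by move=> _ [] e2; rewrite e2 in fss1; lia.
    * by lia.
    * by move=> _ _ _ _ ->; rewrite E' ifF //; lia.
    * by lia.
  + case: (f s =P s) => e; first by rewrite /join_ends E e !eqxx; do 3!case: eqP => //=; lia.
    case: (JE (f s)); rewrite ?fK => -[]; first by move=> _ [] e2; rewrite e2 in fss; lia.
    * by move=> _ _ _ _ ->; rewrite E' ifF //; lia.
    * by lia.
    * by lia.
  + by case: (JE (f p)); rewrite ?fK => -[]; try lia; move=> _ [].
- case: (JE p) => [[-> _]|[ns ns1 E E' _ ]|[ns ns1 E E' _]|[ns ns1 nE nE1 ->]] //.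
  + by move=> _; rewrite bulE // fbul // E => /esym.
  + by move=> _; rewrite bulE // fbul // E => /esym.
  + by rewrite bulE //; apply: fbul.
- move=> pq qp bq'.
  have nqs : q <> s by move=> E; rewrite E b's in bq'.
  have nqs1 : q <> s.+1 by move=> E; rewrite E b's1 in bq'.
  have bq : bul q by rewrite -bulE.
  have fqq := fK q; have fpp := fK p.
  have nc' x y : bul y -> (x < y)%N -> (y < f x)%N ->
      f y <> y /\ (x < f y)%N /\ (f y < f x)%N by move=> b1 b2 b3; case: (nc x y).
  have bf x : f x <> x -> bul (f x) by move=> ?; apply: fbul; rewrite fK => /esym.
  have inj x y : f x = f y -> x = y by move/(congr1 f); rewrite !fK.
  have ssne : f s <> f s.+1 by move=> /inj; lia.
  suff: join_ends s f q <> q /\ (p < join_ends s f q)%N /\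
       (join_ends s f q < join_ends s f p)%N by case=> h1 [h2 h3].
  case: (JE p) qp => [[-> _]|[ns ns1 E E' ->]|[ns ns1 E E' ->]|[ns ns1 nE nE1 ->]] //; first by lia.
  - case: eqP => [_|n1] qr; first by lia.
    have b1 := bf _ n1; have nr : f s.+1 <> p by rewrite -E'; apply/nesym.
    have n2 : f s.+1 <> s by move=> /fI; lia.
    case: (ltngtP p s) => // [ps|sp].
      have H1 := nc' p s.+1; have H2 := nc' p (f s.+1) b1; rewrite E fss1 in H1 H2.
      have H3 : (s.+1 < f s.+1)%N by lia.
      have {H1 H2} : f q <> q /\ (p < f q)%N /\ (f q < f s.+1)%N /\ f q <> s /\ f q <> s.+1.
        have nq1 : f q <> s by move=> /fI; lia.
        have nq2 : f q <> s.+1 by move=> /fI; lia.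
        case: (ltnP q s) => qs; first by have := nc' p q bq pq; rewrite E => /(_ qs); lia.
        by have := nc' s.+1 q bq; lia.
      case: (JE q) => [[_ m]|[ms ms1 F F' _]|[ms ms1 F F' _]|[ms ms1 nF nF1 ->]]; lia.
    have := nc' s s.+1 bs1; rewrite E'; lia.
  - case: eqP => [_|n1] qr; first by lia.
    have b1 := bf _ n1; have nr : f s <> p by rewrite -E'.
    have n2 : f s <> s.+1 by move=> /fI; lia.
    case: (ltnP p s) => [ps|sp].
      have := nc' p s bs; rewrite E => /(_ ps (leqnn _)) [_ [h1 h2]].
      have [h3 [h4 h5]] : f q <> q /\ (p < f q)%N /\ (f q < s.+1)%N.
        by have := nc' p q bq; rewrite E; apply=> //; lia.
      have nq1 : f q <> s by move=> /fI; lia.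
      have K : ~ (f s < f q)%N.
        by move=> h; have := nc' q (f s) b1 qr h; rewrite fss; lia.
      have nq3 : f q <> f s by move=> /inj; lia.
      case: (JE q) => [[_ m]|[ms ms1 F F' _]|[ms ms1 F F' _]|[ms ms1 nF nF1 ->]]; lia.
    have ps : (s.+1 < p)%N by lia.
    have H1 := nc' s q bq; have [h3 [h4 h5]] : f q <> q /\ (s < f q)%N /\ (f q < f s)%N by lia.
    have nq2 : f q <> s.+1 by move=> /fI; lia.
    have nq4 : f q <> p by move=> /fI; lia.
    have K : ~ (f q < p)%N.
      move=> h; have b2 : bul (f q) by apply: bf.
      by have := nc' s.+1 (f q) b2; rewrite E' fqq; lia.
    case: (JE q) => [[_ m]|[ms ms1 F F' _]|[ms ms1 F F' _]|[ms ms1 nF nF1 ->]]; lia.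
  - move=> qr; have [h3 [h4 h5]] := nc' p q bq pq qr.
    case: (JE q) => [[_ m]|[ms ms1 F F' ->]|[ms ms1 F F' ->]|[ms ms1 nF nF1 ->]]; try lia.
    + have := nc' p s.+1 bs1; case: eqP => [e|n1] H1; lia.
    + have := nc' p s bs; case: eqP => [e|n1] H1; lia.
Qed.

Lemma insert_pair_noncrossing : bul s = false -> bul s.+1 = false ->
  bul' s -> bul' s.+1 -> noncrossing bul' (insert_pair s f).
Proof.
case: fnc => fK fbul nc bs bs1 b's b's1.
have fs : f s = s.
  by apply/eqP/negPn/negP=> /eqP/fbul; rewrite bs.
have fs1 : f s.+1 = s.+1.
  by apply/eqP/negPn/negP=> /eqP/fbul; rewrite bs1.
have AE p : [\/ p = s /\ insert_pair s f p = s.+1, p = s.+1 /\ insert_pair s f p = s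
   | [/\ p <> s, p <> s.+1, f p <> s, f p <> s.+1 & insert_pair s f p = f p]].
  rewrite /insert_pair; have fp := fK p.
  case: eqP => [->|ns]; first by constructor 1.
  case: eqP => [->|ns1]; first by constructor 2.
  by constructor 3; split=> // E; move: fp; rewrite E ?fs ?fs1 => /esym.
split=> [p|p|p q].
- case: (AE p) => [[-> ->]|[-> ->]|[ns ns1 nE nE1 ->]].
  + by rewrite /insert_pair eqxx; case: eqP => //; lia.
  + by rewrite /insert_pair eqxx.
  + by case: (AE (f p)) => [[]|[]|[]] //; rewrite fK.
- case: (AE p) => [[-> ->]|[-> ->]|[ns ns1 nE nE1 ->]] //.
  by rewrite bulE //; apply: fbul.
- move=> pq qp bq.
  case: (AE p) qp => [[E ->]|[E ->]|[ns ns1 nE nE1 ->]]; [lia|lia|].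
  move=> qp; case: (AE q) => [[E ->]|[E ->]|[ms ms1 nF nF1 ->]]; [split; lia|split; lia|].
  by apply: nc => //; rewrite -bulE.
Qed.

(** Exactly one of [s], [s.+1] is a bullet, so the transposition preserves the order of bullets. *)
Lemma shift_end_noncrossing : bul s.+1 = ~~ bul s -> bul' s = bul s.+1 ->
  bul' s.+1 = bul s -> noncrossing bul' (shift_end s f).
Proof.
case: fnc => fK fbul nc bs b's b's1.
have b'E p : bul' p = bul (swap_next s p).
  rewrite /swap_next; case: eqP => [->//|?]; case: eqP => [->//|?]; exact: bulE.
have mono p q : bul p -> bul q -> (p < q)%N -> (swap_next s p < swap_next s q)%N.
  move=> bp bq pq; have ne : ~ (p = s /\ q = s.+1).
    by case=> E1 E2; move: bq; rewrite E2 bs -E1 bp.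
  exact: swap_next_mono.
have sK := swap_nextK s.
split=> [p|p|p q].
- by rewrite /shift_end sK fK sK.
- by rewrite b'E /shift_end => h; apply: fbul => E; apply: h; rewrite E sK.
- rewrite b'E /shift_end => pq qp bq.
  have nfp : f (swap_next s p) <> swap_next s p.
    by move=> E; move: qp; rewrite E sK; lia.
  have bp := fbul _ nfp.
  have bfp : bul (f (swap_next s p)) by apply: fbul; rewrite fK => /esym.
  have b'p : bul' p by rewrite b'E.
  have mono' x y : bul' x -> bul' y -> (x < y)%N -> (swap_next s x < swap_next s y)%N.
    move=> bx b_y xy; have ne : ~ (x = s /\ y = s.+1).
      by case=> E1 E2; move: b_y bx; rewrite E1 E2 b's b's1 bs => ->.
    exact: swap_next_mono.
  have [] := nc (swap_next s p) (swap_next s q) _ _ bq.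
  + by apply: mono'; rewrite ?b'E.
  + by rewrite -[ltnRHS]sK; apply: mono'; rewrite ?b'E ?sK.
  move=> h1 h2 h3; have bfq := fbul _ h1.
  have bffq : bul (f (swap_next s q)) by apply: fbul; rewrite fK => /esym.
  split.
  + by move=> E; apply: h1; rewrite -[LHS]sK E.
  + by rewrite -{1}[p]sK; apply: mono.
  + exact: mono.
Qed.

End Pairings.

(** * Levels of a stretched cap diagram *)


(* Multiplicities (0, 1, 2 for circ, bullet, times) of the two active vertices
   above and below a level. *)
Variant level_spec (a b a' b' : int) : Prop :=
  | LevelCup of a = 1 & b = 1 & a' = 0 & b' = 2
  | LevelCap of a = 2 & b = 0 & a' = 1 & b' = 1
  | LevelRight of a = 1 & b = 0 & a' = 0 & b' = 1
  | LevelLeft of a = 2 & b = 1 & a' = 1 & b' = 2.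

Definition pair_step (s : nat) (a b : int) (f : nat -> nat) : nat -> nat :=
  if (a == 1) && (b == 1) then join_ends s f
  else if (a == 2) && (b == 0) then insert_pair s f else shift_end s f.

Section Levels.
Variables (N d : nat) (s : nat -> nat) (g : nat -> nat -> int).
Local Notation vert := (vertex N d).

(* [pairing k] exchanges the ends of the caps which the first k levels form
   on line k. *)
Fixpoint pairing (k : nat) : nat -> nat :=
  if k is k'.+1 then
    pair_step (s k') (g k' (s k')) (g k' (s k').+1) (pairing k')
  else id.

(** [half_matching] in terms of natural numbers: level [k] has top line [k] and bottom line [k.+1],
    its active vertices are at positions [s k] and [(s k).+1], and [g k p] is the multiplicity at
    position [p] of line [k]. *)
Definition half_arc (k : nat) (u v : vert) : bool :=
  [|| [&& u.1 == k :> nat, v.1 == k.+1 :> nat, u.2 == v.2 :> nat,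
          u.2 != s k :> nat, u.2 != (s k).+1 :> nat & g k u.2 == 1],
      [&& u.1 == k :> nat, v.1 == k :> nat, u.2 == s k :> nat,
          v.2 == (s k).+1 :> nat, g k (s k) == 1 & g k (s k).+1 == 1],
      [&& u.1 == k.+1 :> nat, v.1 == k.+1 :> nat, u.2 == s k :> nat,
          v.2 == (s k).+1 :> nat, g k (s k) == 2 & g k (s k).+1 == 0],
      [&& u.1 == k :> nat, v.1 == k.+1 :> nat, u.2 == s k :> nat,
          v.2 == (s k).+1 :> nat, g k (s k) == 1 & g k (s k).+1 == 0]
    | [&& u.1 == k :> nat, v.1 == k.+1 :> nat, u.2 == (s k).+1 :> nat,
          v.2 == s k :> nat, g k (s k) == 2 & g k (s k).+1 == 1]].

Definition level_arc k (u v : vert) : bool := half_arc k u v || half_arc k v u.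

Definition arcs (K : nat) : rel vert :=
  fun u v => [exists k : 'I_d, (k < K)%N && level_arc k u v].

Lemma arcsP K u v :
  reflect (exists k, [/\ (k < d)%N, (k < K)%N & level_arc k u v]) (arcs K u v).
Proof.
apply: (iffP existsP) => [[k /andP[h1 h2]]|[k [h0 h1 h2]]]; first by exists k.
by exists (Ordinal h0); rewrite h1.
Qed.

Lemma level_arc_sym k u v : level_arc k u v = level_arc k v u.
Proof. exact: orbC. Qed.

Lemma arcs_sym K : symmetric (arcs K).
Proof. by move=> u v; apply: eq_existsb => k; rewrite level_arc_sym. Qed.

Lemma arcs_mono K K' u v : (K <= K')%N -> arcs K u v -> arcs K' u v.
Proof.
move=> le /arcsP[k [h1 h2 h3]]; apply/arcsP; exists k; split=> //.
exact: leq_trans le.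
Qed.

Lemma connect_mono K K' u v :
  (K <= K')%N -> connect (arcs K) u v -> connect (arcs K') u v.
Proof. by move=> le; apply: connect_sub => x y /(arcs_mono le)/connect1. Qed.

Lemma connect_arcs_sym K : connect_sym (arcs K).
Proof. exact/sym_connect_sym/arcs_sym. Qed.

Hypothesis levels : forall k, (k < d)%N ->
  [/\ ((s k).+1 < N)%N,
      forall p, p <> s k -> p <> (s k).+1 -> g k.+1 p = g k p
    & level_spec (g k (s k)) (g k (s k).+1) (g k.+1 (s k)) (g k.+1 (s k).+1)].

Lemma pairing_noncrossing k : (k <= d)%N ->
  noncrossing (fun p => g k p == 1) (pairing k).
Proof.
elim: k => [_|k IH kd]; first by split=> //= p q pq; lia.
have [_ gE spec] := levels kd; have {IH} nc := IH (ltnW kd).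
have bE p : p <> s k -> p <> (s k).+1 -> (g k.+1 p == 1) = (g k p == 1).
  by move=> n1 n2; rewrite gE.
rewrite /= /pair_step; case: spec => E1 E2 E3 E4; rewrite E1 E2 /=.
- by apply: (join_ends_noncrossing bE nc); rewrite ?E1 ?E2 ?E3 ?E4.
- by apply: (insert_pair_noncrossing bE nc); rewrite ?E1 ?E2 ?E3 ?E4.
- by apply: (shift_end_noncrossing bE nc); rewrite ?E1 ?E2 ?E3 ?E4.
- by apply: (shift_end_noncrossing bE nc); rewrite ?E1 ?E2 ?E3 ?E4.
Qed.

Variant half_arc_spec (k : nat) (u v : vert) : Prop :=
  | VertArc of u.1 = k :> nat & v.1 = k.+1 :> nat & u.2 = v.2 :> nat
      & u.2 <> s k :> nat & u.2 <> (s k).+1 :> nat & g k u.2 = 1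
  | CupArc of g k (s k) = 1 & g k (s k).+1 = 1 & u.1 = k :> nat
      & v.1 = k :> nat & u.2 = s k :> nat & v.2 = (s k).+1 :> nat
  | CapArc of g k (s k) = 2 & g k (s k).+1 = 0 & u.1 = k.+1 :> nat
      & v.1 = k.+1 :> nat & u.2 = s k :> nat & v.2 = (s k).+1 :> nat
  | RightArc of g k (s k) = 1 & g k (s k).+1 = 0 & u.1 = k :> nat
      & v.1 = k.+1 :> nat & u.2 = s k :> nat & v.2 = (s k).+1 :> nat
  | LeftArc of g k (s k) = 2 & g k (s k).+1 = 1 & u.1 = k :> nat
      & v.1 = k.+1 :> nat & u.2 = (s k).+1 :> nat & v.2 = s k :> nat.

Lemma half_arcP k u v : reflect (half_arc_spec k u v) (half_arc k u v).
Proof.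
rewrite /half_arc; apply: (iffP idP) => [|[] h1 h2 h3 h4 h5 h6]; last first.
- by rewrite h1 h2 h3 h4 h5 h6 !eqxx !orbT.
- by rewrite h1 h2 h3 h4 h5 h6 !eqxx !orbT.
- by rewrite h1 h2 h3 h4 h5 h6 !eqxx !orbT.
- by rewrite h1 h2 h3 h4 h5 h6 !eqxx !orbT.
- by move/eqP: h4 => h4; move/eqP: h5 => h5; rewrite h1 h2 -h3 h4 h5 h6 !eqxx.
case/or4P=> [|||/orP[]] /andP[/eqP h1 /and5P[/eqP h2 /eqP h3 /eqP h4 /eqP h5 /eqP h6]].
- exact: VertArc.
- exact: CupArc.
- exact: CapArc.
- exact: RightArc.
- exact: LeftArc.
Qed.

Lemma half_arc_bullet k u v : (k < d)%N -> half_arc k u v ->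
  [/\ (k <= u.1)%N && (u.1 <= k.+1)%N, (k <= v.1)%N && (v.1 <= k.+1)%N,
      g u.1 u.2 = 1 & g v.1 v.2 = 1].
Proof.
move=> kd; have [_ gE spec] := levels kd.
case/half_arcP=> [-> -> h3 h4 h5 h6|e1 e2 -> -> -> ->|e1 e2 -> -> -> ->|e1 e2 -> -> -> ->|e1 e2 -> -> -> ->].
all: split; try lia.
  by rewrite -h3 gE.
all: by case: spec => *; lia.
Qed.

Lemma level_arc_bullet k u v : (k < d)%N -> level_arc k u v ->
  [/\ (k <= u.1)%N, (u.1 <= k.+1)%N & g u.1 u.2 = 1].
Proof. by move=> kd /orP[] /(half_arc_bullet kd)[/andP[? ?] /andP[? ?] ? ?]. Qed.

Lemma level_arc_fun k u v w : (k < d)%N ->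
  level_arc k u v -> level_arc k u w -> v = w.
Proof.
move=> kd h1 h2.
suff [E1 E2] : (v.1 = w.1 :> nat) /\ (v.2 = w.2 :> nat).
  by rewrite [v]surjective_pairing [w]surjective_pairing; congr (_, _); apply: val_inj.
case/orP: h1 => /half_arcP[] => h11 h12 h13 h14 h15 h16.
all: case/orP: h2 => /half_arcP[] => h21 h22 h23 h24 h25 h26.
all: lia.
Qed.

Lemma arcs_bullet K u v : arcs K u v ->
  [/\ (u.1 <= K)%N, (u.1 <= d)%N & g u.1 u.2 = 1].
Proof.
case/arcsP=> k [kd kK /(level_arc_bullet kd)[h1 h2 ->]].
by split=> //; lia.
Qed.

Lemma connect_bullet K u v : connect (arcs K) u v -> u != v ->
  [/\ (u.1 <= K)%N, (u.1 <= d)%N & g u.1 u.2 = 1].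
Proof.
case/connectP=> [[|w p]] /=; first by move=> _ ->; rewrite eqxx.
by case/andP=> /arcs_bullet.
Qed.

(** Only the level above and the level below the line of [u] have arcs at [u], at most one each. *)
Lemma arcs_deg2 K u v1 v2 v3 : arcs K u v1 -> arcs K u v2 -> arcs K u v3 ->
  [|| v1 == v2, v1 == v3 | v2 == v3].
Proof.
move=> /arcsP[k1 [d1 _ a1]] /arcsP[k2 [d2 _ a2]] /arcsP[k3 [d3 _ a3]].
have [h1 h2 _] := level_arc_bullet d1 a1; have [h3 h4 _] := level_arc_bullet d2 a2.
have [h5 h6 _] := level_arc_bullet d3 a3.
have [E|[E|E]] : k1 = k2 \/ k1 = k3 \/ k2 = k3 by lia.
- by rewrite E in a1; rewrite (level_arc_fun d2 a1 a2) eqxx.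
- by rewrite E in a1; rewrite (level_arc_fun d3 a1 a3) eqxx orbT.
- by rewrite E in a2; rewrite (level_arc_fun d3 a2 a3) eqxx !orbT.
Qed.

Lemma bottom_end K (u : vert) : u.1 = K :> nat -> is_end (arcs K) u.
Proof.
move=> uK v w /arcsP[k1 [d1 l1 a1]] /arcsP[k2 [d2 l2 a2]].
have [h1 h2 _] := level_arc_bullet d1 a1; have [h3 h4 _] := level_arc_bullet d2 a2.
have E : k1 = k2 by lia.
by rewrite E in a1; exact: level_arc_fun d2 a1 a2.
Qed.

Lemma top_end K (u : vert) : u.1 = 0%N :> nat -> is_end (arcs K) u.
Proof.
move=> u0 v w /arcsP[k1 [d1 _ a1]] /arcsP[k2 [d2 _ a2]].
have [h1 h2 _] := level_arc_bullet d1 a1; have [h3 h4 _] := level_arc_bullet d2 a2.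
have E : k1 = k2 by lia.
by rewrite E in a1; exact: level_arc_fun d2 a1 a2.
Qed.

Lemma connect_arcs0 u v : connect (arcs 0) u v -> u = v.
Proof. by case/connectP=> [[|w p]] //= /andP[/arcsP[k []]]. Qed.

Section Labelled.
Variables (L : labelling N d) (l0 : label).
Hypothesis Lg : forall u : vert, (u.1 <= d)%N -> strands (L u) = g u.1 u.2.
Hypothesis Lor : oriented (arcs d) L.
Hypothesis Ltop : forall u : vert, u.1 = 0%N :> nat -> g 0 u.2 = 1 -> L u = l0.

Lemma arcs_opposite (u v : vert) : arcs d u v -> u.1 = v.1 :> nat -> opposite (L u) (L v).
Proof.
move=> a /val_inj E; have /forallP/(_ u)/forallP/(_ v) := Lor.
by rewrite a E eqxx.
Qed.

Lemma arcs_same (u v : vert) : arcs d u v -> u.1 <> v.1 :> nat -> L u = L v.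
Proof.
move=> a n; have /forallP/(_ u)/forallP/(_ v) := Lor; rewrite a.
by case: eqP => [E|_ /eqP //]; rewrite E in n.
Qed.

Lemma level_arcs k u v : (k < d)%N -> half_arc k u v -> arcs k.+1 u v.
Proof. by move=> kd a; apply/arcsP; exists k; rewrite /level_arc a ltnSn. Qed.

Lemma line_vertex (k p : nat) : (k <= d)%N -> (p < N)%N ->
  exists u : vert, u.1 = k :> nat /\ u.2 = p :> nat.
Proof. by move=> kd pN; exists (inord k, Ordinal pN); rewrite inordK //= ltnS ltnW. Qed.

Lemma opposite_trans x y z w :
  opposite x y -> opposite y z -> opposite z w -> opposite x w.
Proof. by case: x; case: y; case: z; case: w. Qed.

Lemma opposite_opposite x y z : opposite x y -> opposite y z -> z = x.
Proof. by case: x; case: y; case: z. Qed.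

Lemma vertex_eq (u v : vert) : u.1 = v.1 :> nat -> u.2 = v.2 :> nat -> u = v.
Proof.
by move=> E1 E2; rewrite [u]surjective_pairing [v]surjective_pairing; congr (_, _); apply: val_inj.
Qed.

Definition pairs_joined k := forall u v : vert, u.1 = k :> nat -> v.1 = k :> nat ->
  v.2 = pairing k u.2 :> nat -> u <> v ->
  connect (arcs k) u v /\ opposite (L u) (L v).

Definition free_to_top k := forall v : vert, v.1 = k :> nat -> g k v.2 = 1 ->
  pairing k v.2 = v.2 -> L v = l0 /\
  exists u : vert, [/\ u.1 = 0%N :> nat, g 0 u.2 = 1 & connect (arcs k) u v].

Lemma vertical_up k (v : vert) : (k < d)%N -> v.1 = k.+1 :> nat -> g k.+1 v.2 = 1 ->
  v.2 <> s k :> nat -> v.2 <> (s k).+1 :> nat ->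
  exists u : vert, [/\ u.1 = k :> nat, u.2 = v.2 :> nat, half_arc k u v, L u = L v
    & g k u.2 = 1].
Proof.
move=> kd v1 gv n1 n2; have [_ gE _] := levels kd.
have [u [u1 u2]] := line_vertex (ltnW kd) (ltn_ord v.2).
have gu : g k u.2 = 1 by rewrite u2 -gE.
have a : half_arc k u v by apply/half_arcP; apply: VertArc => //; rewrite u2.
exists u; split=> //; apply: arcs_same; last by rewrite u1 v1; lia.
exact: arcs_mono kd (level_arcs kd a).
Qed.

Lemma shift_up k (v : vert) : (k < d)%N -> v.1 = k.+1 :> nat -> g k.+1 v.2 = 1 ->
  (g k (s k) = 1) * (g k (s k).+1 = 0) \/ (g k (s k) = 2) * (g k (s k).+1 = 1) ->
  exists u : vert, [/\ u.1 = k :> nat, u.2 = swap_next (s k) v.2 :> nat,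
    half_arc k u v, L u = L v & g k u.2 = 1].
Proof.
move=> kd v1 gv E; have [sN gE spec] := levels kd.
case: (v.2 =P s k :> nat) => [v2|n1]; last case: (v.2 =P (s k).+1 :> nat) => [v2|n2].
- have [u [u1 u2]] := line_vertex (ltnW kd) sN.
  have a : half_arc k u v.
    rewrite v2 in gv; case: E => -[E1 E2]; last by apply/half_arcP; apply: LeftArc.
    by case: spec; rewrite gv E1 E2.
  have gu : g k u.2 = 1 by have [_ _ ] := arcs_bullet (level_arcs kd a); rewrite u1.
  exists u; split=> //; first by rewrite /swap_next v2 eqxx.
  by apply: arcs_same; [exact: arcs_mono kd (level_arcs kd a)|rewrite u1 v1; lia].
- have [u [u1 u2]] := line_vertex (ltnW kd) (ltnW sN).
  have a : half_arc k u v.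
    rewrite v2 in gv; case: E => -[E1 E2]; first by apply/half_arcP; apply: RightArc.
    by case: spec; rewrite gv E1 E2.
  have gu : g k u.2 = 1 by have [_ _ ] := arcs_bullet (level_arcs kd a); rewrite u1.
  exists u; split=> //; first by rewrite /swap_next v2 eqxx; case: eqP => //; lia.
  by apply: arcs_same; [exact: arcs_mono kd (level_arcs kd a)|rewrite u1 v1; lia].
- have [u [h1 h2 h3 h4 h5]] := vertical_up kd v1 gv n1 n2.
  by exists u; split=> //; rewrite /swap_next; do 2!case: eqP => //.
Qed.

(** An arc of [pairing k.+1] is made of arcs of level [k] and at most two arcs of [pairing k]. Each
    cup or cap passed reverses the label; a path between two vertices of line [k] passes an odd
    number of them, a path to the top line an even number. *)
Lemma pairing_joined k : (k <= d)%N -> pairs_joined k /\ free_to_top k.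
Proof.
elim: k => [_|k IH kd].
  split=> [u v u0 v0 /= E|v v0 gv _]; last by split; [exact: Ltop|exists v].
  by case; apply: vertex_eq; lia.
have {IH}[IHp IHf] := IH (ltnW kd); have [sN gE spec] := levels kd.
have up := connect_mono (leqnSn k).
have nc := pairing_noncrossing kd; have nc0 := pairing_noncrossing (ltnW kd).
have [fK fbul _] := nc; have [fK0 fbul0 _] := nc0.
have edge (u v : vert) : half_arc k u v -> connect (arcs k.+1) u v.
  by move=> a; apply/connect1/level_arcs.
have edge' (u v : vert) : half_arc k u v -> connect (arcs k.+1) v u.
  by rewrite connect_arcs_sym; apply: edge.
have Ledge (u v : vert) : half_arc k u v -> u.1 = v.1 :> nat -> opposite (L u) (L v).
  by move=> a; apply: arcs_opposite; exact: arcs_mono kd (level_arcs kd a).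
have bul (u v : vert) : u.1 = k.+1 :> nat -> v.1 = k.+1 :> nat ->
    v.2 = pairing k.+1 u.2 :> nat -> u <> v -> g k.+1 u.2 = 1 /\ g k.+1 v.2 = 1.
  move=> u1 v1 E ne; have n : pairing k.+1 u.2 <> u.2.
    by move=> E'; apply: ne; apply: vertex_eq; lia.
  split; first exact/eqP/fbul.
  by rewrite E; apply/eqP/fbul; rewrite fK => /esym.
have [x [x1 x2]] := line_vertex (ltnW kd) (ltnW sN).
have [y [y1 y2]] := line_vertex (ltnW kd) sN.
move: (bul); rewrite /pairs_joined /free_to_top /= /pair_step.
case: (spec) => E1 E2 E3 E4; rewrite E1 E2 /=.
- move=> bul'.
  have axy : half_arc k x y by apply/half_arcP; apply: CupArc.
  have oxy := Ledge _ _ axy (etrans x1 (esym y1)).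
  split=> [u v u1 v1 E ne|v v1 gv].
    have [gu gv] := bul' _ _ u1 v1 E ne.
    have [||u' [u'1 u'2 au Lu gu']] := vertical_up kd u1 gu.
    + by move=> h; rewrite h E3 in gu.
    + by move=> h; rewrite h E4 in gu.
    have [||v' [v'1 v'2 av Lv gv']] := vertical_up kd v1 gv.
    + by move=> h; rewrite h E3 in gv.
    + by move=> h; rewrite h E4 in gv.
    have uv : u' <> v' by move=> e; apply: ne; apply: vertex_eq; rewrite ?u1 // -u'2 e.
    rewrite -Lu -Lv.
    suff [c op] : connect (arcs k.+1) u' v' /\ opposite (L u') (L v').
      split=> //; apply: connect_trans (edge' _ _ au) _.
      exact: connect_trans c (edge _ _ av).
    have n1 : u'.2 <> s k :> nat by move=> h; rewrite -u'2 h E3 in gu.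
    have n2 : u'.2 <> (s k).+1 :> nat by move=> h; rewrite -u'2 h E4 in gu.
    move: E; rewrite -u'2 -v'2 /join_ends; do 2!case: eqP => // _ /=.
    have uvn : v'.2 <> u'.2 :> nat by move=> h; apply: uv; apply: vertex_eq; lia.
    case: eqP => [e1|_].
      case: eqP => // _ e2.
      have [c1 o1] := IHp u' x u'1 x1 (etrans x2 (esym e1)) ltac:(by move=> h; apply: n1; rewrite h).
      have fv : pairing k v'.2 = (s k).+1 by rewrite e2 fK0.
      have [c2 o2] := IHp y v' y1 v'1 ltac:(by rewrite y2) ltac:(by move=> h; rewrite -h in v'2; rewrite -v'2 y2 E4 in gv).
      split; last exact: opposite_trans o1 oxy o2.
      apply: connect_trans (up _ _ c1) _.
      exact: connect_trans (edge _ _ axy) (up _ _ c2).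
    case: eqP => [e1|_].
      case: eqP => // _ e2.
      have [c1 o1] := IHp u' y u'1 y1 (etrans y2 (esym e1)) ltac:(by move=> h; apply: n2; rewrite h).
      have [c2 o2] := IHp x v' x1 v'1 ltac:(by rewrite x2) ltac:(by move=> h; rewrite -h in v'2; rewrite -v'2 x2 E3 in gv).
      rewrite opposite_sym in oxy.
      split; last exact: opposite_trans o1 oxy o2.
      apply: connect_trans (up _ _ c1) _.
      exact: connect_trans (edge' _ _ axy) (up _ _ c2).
    move=> e; have [c op] := IHp u' v' u'1 v'1 e uv; split=> //; exact: up.
  have n1 : v.2 <> s k :> nat by move=> h; rewrite h E3 in gv.
  have n2 : v.2 <> (s k).+1 :> nat by move=> h; rewrite h E4 in gv.
  have [v' [v'1 v'2 av Lv gv']] := vertical_up kd v1 gv n1 n2.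
  rewrite -v'2 in n1 n2 *; rewrite -Lv.
  suff H : pairing k.+1 v'.2 = v'.2 -> L v' = l0 /\ exists u : vert,
     [/\ u.1 = 0%N :> nat, g 0 u.2 = 1 & connect (arcs k.+1) u v'].
    move=> e; have e' : pairing k.+1 v'.2 = v'.2 by rewrite /= /pair_step E1 E2.
    have [-> [u [h1 h2 h3]]] := H e'.
    by split=> //; exists u; split=> //; apply: connect_trans h3 (edge _ _ av).
  rewrite /= /pair_step E1 E2 /= /join_ends; do 2!case: eqP => // _ /=.
  case: eqP => [e1|_].
    case: eqP => [e2 _|_ e2]; last first.
      by move: (fK0 v'.2); rewrite e1 -{1}e2 => e3; have := fK0 (s k).+1; rewrite e2 e1; lia.
    have [c1 o1] := IHp v' x v'1 x1 (etrans x2 (esym e1)) ltac:(by move=> h; apply: n1; rewrite h).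
    have [Ly [u [h1 h2 h3]]] := IHf y y1 ltac:(by rewrite y2) ltac:(by rewrite y2).
    split; first by rewrite -Ly; rewrite opposite_sym in oxy; rewrite opposite_sym in o1; exact: opposite_opposite oxy o1.
    exists u; split=> //; apply: connect_trans (up _ _ h3) _.
    apply: connect_trans (edge' _ _ axy) _.
    by rewrite connect_arcs_sym; exact: up.
  case: eqP => [e1|_].
    case: eqP => [e2 _|_ e2]; last first.
      by have := fK0 (s k); rewrite e2 e1; lia.
    have [c1 o1] := IHp v' y v'1 y1 (etrans y2 (esym e1)) ltac:(by move=> h; apply: n2; rewrite h).
    have [Lx [u [h1 h2 h3]]] := IHf x x1 ltac:(by rewrite x2) ltac:(by rewrite x2).
    split; first by rewrite -Lx; rewrite opposite_sym in o1; exact: opposite_opposite oxy o1.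
    exists u; split=> //; apply: connect_trans (up _ _ h3) _.
    apply: connect_trans (edge _ _ axy) _.
    by rewrite connect_arcs_sym; exact: up.
  move=> e; have [-> [u [h1 h2 h3]]] := IHf v' v'1 gv' e.
  by split=> //; exists u; split=> //; apply: up.
- move=> bul'; split=> [u v u1 v1 E ne|v v1 gv].
    have [gu gv] := bul' _ _ u1 v1 E ne.
    have acap (w w' : vert) : w.1 = k.+1 :> nat -> w'.1 = k.+1 :> nat -> w.2 = s k :> nat ->
      w'.2 = (s k).+1 :> nat -> half_arc k w w' by move=> *; apply/half_arcP; apply: CapArc.
    move: E; rewrite /insert_pair; case: eqP => [u2 v2|n1].
      have a := acap u v u1 v1 u2 v2.
      by split; [exact: edge|apply: Ledge a _; rewrite u1].
    case: eqP => [u2 v2|n2 E].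
      have a := acap v u v1 u1 v2 u2.
      by split; [exact: edge'|rewrite opposite_sym; apply: Ledge a _; rewrite u1].
    have [u' [u'1 u'2 au Lu gu']] := vertical_up kd u1 gu n1 n2.
    have nf q : g k q <> 1 -> pairing k q = q.
      by move=> h; apply/eqP/negPn/negP=> /eqP/fbul0/eqP.
    have fs := nf (s k) ltac:(by rewrite E1); have fs1 := nf (s k).+1 ltac:(by rewrite E2).
    have fu := fK0 u.2; rewrite -E in fu.
    have [||v' [v'1 v'2 av Lv gv']] := vertical_up kd v1 gv.
    + by move=> h; move: fu; rewrite h fs; lia.
    + by move=> h; move: fu; rewrite h fs1; lia.
    rewrite -Lu -Lv.
    have [||c op] := IHp u' v' u'1 v'1; [by rewrite u'2 v'2|by move=> e; apply: ne; apply: vertex_eq; rewrite ?u1 // -u'2 e|].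
    split=> //; apply: connect_trans (edge' _ _ au) _.
    exact: connect_trans (up _ _ c) (edge _ _ av).
  rewrite /insert_pair; case: eqP => [->|n1]; first by lia.
  case: eqP => [->|n2 E]; first by lia.
  have [v' [v'1 v'2 av Lv gv']] := vertical_up kd v1 gv n1 n2.
  rewrite -Lv; have [-> [u [h1 h2 h3]]] := IHf v' v'1 gv' ltac:(by rewrite v'2).
  by split=> //; exists u; split=> //; apply: connect_trans (up _ _ h3) (edge _ _ av).
all: have sh : (g k (s k) = 1) * (g k (s k).+1 = 0) \/ (g k (s k) = 2) * (g k (s k).+1 = 1) by rewrite E1 E2; auto.
all: move=> bul'; split=> [u v u1 v1 E ne|v v1 gv E].
1,3: have [gu gv] := bul' _ _ u1 v1 E ne;
  have [u' [u'1 u'2 au Lu gu']] := shift_up kd u1 gu sh;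
  have [v' [v'1 v'2 av Lv gv']] := shift_up kd v1 gv sh;
  rewrite -Lu -Lv;
  have [||c op] := IHp u' v' u'1 v'1;
    [by rewrite u'2 v'2 E /shift_end swap_nextK
    |by move=> e; apply: ne; apply: vertex_eq; rewrite ?u1 // -[LHS](swap_nextK (s k)) -u'2 e v'2 swap_nextK
    |];
  by split=> //; apply: connect_trans (edge' _ _ au) _; exact: connect_trans (up _ _ c) (edge _ _ av).
all: have [v' [v'1 v'2 av Lv gv']] := shift_up kd v1 gv sh.
all: rewrite -Lv; have [-> [u [h1 h2 h3]]] := IHf v' v'1 gv' ltac:(by rewrite v'2 -{2}E /shift_end swap_nextK).
all: by split=> //; exists u; split=> //; apply: connect_trans (up _ _ h3) (edge _ _ av).
Qed.

End Labelled.
End Levels.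

(** * Charges *)


(** A sum with at most one term, which makes sense for positions beyond the window too. In use, [C]
    is a union of components. *)
Definition charge_at N d (L : labelling N d) (C : pred (vertex N d)) (r p : nat) : int :=
  \sum_(v : vertex N d | [&& C v, v.1 == r :> nat & v.2 == p :> nat]) charge (L v).

(** The winding number of [C] around a point just to the left of position [p] on line [r]. *)
Definition charge_left N d (L : labelling N d) (C : pred (vertex N d)) (r p : nat) : int :=
  \sum_(v : vertex N d | [&& C v, v.1 == r :> nat & (v.2 < p)%N]) charge (L v).

Section Charges.
Variables (N d : nat) (L : labelling N d) (C : pred (vertex N d)).
Implicit Types u v : vertex N d.

Lemma charge_at_vertex v :
  charge_at L C v.1 v.2 = if C v then charge (L v) else 0.
Proof.
rewrite /charge_at; case: ifP => Cv.
  rewrite (big_pred1 v) // => u /=; apply/and3P/eqP => [[_ /eqP E1 /eqP E2]|->].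
    exact: vertex_eq.
  by rewrite Cv !eqxx.
rewrite big1 // => u /and3P[Cu /eqP E1 /eqP E2].
by rewrite (vertex_eq E1 E2) Cv in Cu.
Qed.

Lemma charge_at_out r p : (N <= p)%N -> charge_at L C r p = 0.
Proof.
move=> Np; rewrite /charge_at big_pred0 // => v; apply/negbTE/negP=> /and3P[_ _ /eqP E].
by have := ltn_ord v.2; lia.
Qed.

Lemma charge_leftS r p : charge_left L C r p.+1 = charge_left L C r p + charge_at L C r p.
Proof.
rewrite /charge_left /charge_at (bigID (fun v => (v.2 < p)%N)) /=; congr (_ + _).
  by apply: eq_bigl => v; case: (C v) => //=; lia.
by apply: eq_bigl => v; case: (C v) => //=; lia.
Qed.

Lemma charge_left0 r : charge_left L C r 0 = 0.
Proof. by rewrite /charge_left big_pred0 // => v; rewrite ltn0 !andbF. Qed.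

End Charges.

Section Levels.
Variables (N d : nat) (s : nat -> nat) (g : nat -> nat -> int).
Local Notation vert := (vertex N d).
Hypothesis levels : forall k, (k < d)%N ->
  [/\ ((s k).+1 < N)%N,
      forall p, p <> s k -> p <> (s k).+1 -> g k.+1 p = g k p
    & level_spec (g k (s k)) (g k (s k).+1) (g k.+1 (s k)) (g k.+1 (s k).+1)].
Local Notation arcs := (@arcs N d s g).
Local Notation pairing := (pairing s g).

Variables (L : labelling N d) (l0 : label).
Hypothesis Lg : forall u : vert, (u.1 <= d)%N -> strands (L u) = g u.1 u.2.
Hypothesis Lor : oriented (arcs d) L.
Hypothesis Ltop : forall u : vert, u.1 = 0%N :> nat -> g 0 u.2 = 1 -> L u = l0.

Let deg2 K := @arcs_deg2 _ _ _ _ levels K.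

Lemma pairing_ltn k p : (k <= d)%N -> (p < N)%N -> (pairing k p < N)%N.
Proof.
elim: k p => //= k IH p kd pN; have [sN _ _] := levels kd.
have {}IH q : (q < N)%N -> (pairing k q < N)%N by apply: IH; exact: ltnW.
have sN' := ltnW sN; have sw q : (q < N)%N -> (swap_next (s k) q < N)%N.
  by rewrite /swap_next; case: eqP => // _; case: eqP.
rewrite /pair_step; case: ifP => _; last case: ifP => _.
- by rewrite /join_ends; do !case: ifP => // _; exact: IH.
- by rewrite /insert_pair; do !case: ifP => // _; exact: IH.
- exact/sw/IH/sw.
Qed.

(** [u], [v] and the vertex joined to [u] by [pairing_joined], whether on line [K] or on the top
    line, are three ends of one component, so two of them coincide. *)
Lemma connected_bottom K (u v : vert) : (K <= d)%N -> u.1 = K :> nat ->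
  v.1 = K :> nat -> connect (arcs K) u v -> u <> v -> v.2 = pairing K u.2 :> nat.
Proof.
move=> Kd uK vK c ne; have [IHp IHf] := pairing_joined levels Lor Ltop Kd.
have uv : u != v by apply/eqP.
have [_ _ gu] := connect_bullet levels c uv; rewrite uK in gu.
have eu := bottom_end levels uK; have ev := bottom_end levels vK.
have K0 : K <> 0%N by move=> E; rewrite E in c; exact: ne (connect_arcs0 c).
case: (pairing K u.2 =P u.2) => [E|nE].
  have [_ [w [w0 gw cw]]] := IHf u uK gu E.
  rewrite connect_arcs_sym in cw.
  have := three_ends (@deg2 K) (@arcs_sym N d s g K) eu ev (top_end levels w0) c cw.
  rewrite (negPf uv) /= => /orP[] /eqP E'; first by rewrite E' w0 in uK; lia.
  by rewrite E' w0 in vK; lia.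
have uN : (pairing K u.2 < N)%N.
  exact: pairing_ltn.
have [w [w1 w2]] := line_vertex Kd uN.
have [|cw _] := IHp u w uK w1 w2; first by move=> E; apply: nE; rewrite -w2 E.
have := three_ends (@deg2 K) (@arcs_sym N d s g K) eu ev (bottom_end levels w1) c cw.
rewrite (negPf uv) /= => /orP[] /eqP E'; first by case: nE; rewrite -w2 -E'.
by rewrite E'.
Qed.

Lemma paired_vertex K (u : vert) : (K <= d)%N -> u.1 = K :> nat ->
  pairing K u.2 <> u.2 -> exists w : vert,
    [/\ w.1 = K :> nat, w.2 = pairing K u.2 :> nat, u <> w,
        connect (arcs K) u w & opposite (L u) (L w)].
Proof.
move=> Kd uK np; have [IHp _] := pairing_joined levels Lor Ltop Kd.
have [w [w1 w2]] := line_vertex Kd (pairing_ltn Kd (ltn_ord u.2)).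
have ne : u <> w by move=> E; apply: np; rewrite -w2 E.
by have [c o] := IHp u w uK w1 w2 ne; exists w.
Qed.

Lemma paired_not_top K (u w : vert) : (K <= d)%N -> u.1 = K :> nat ->
  pairing K u.2 <> u.2 -> connect (arcs K) u w -> w.1 <> 0%N :> nat.
Proof.
move=> Kd uK np c w0; have [v [v1 v2 uv cv _]] := paired_vertex Kd uK np.
have K0 : K <> 0%N by move=> E; rewrite E in cv; exact: uv (connect_arcs0 cv).
have := three_ends (@deg2 K) (@arcs_sym N d s g K) (bottom_end levels uK)
  (bottom_end levels v1) (top_end levels w0) cv c.
case/or3P=> /eqP E; first exact: uv.
  by rewrite E w0 in uK; lia.
by rewrite E w0 in v1; lia.
Qed.

Section Closed.
Variable C : pred vert.
Hypothesis Cclosed : forall u v, arcs d u v -> C u = C v.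
Local Notation at_ := (charge_at L C).
Local Notation left_ := (charge_left L C).

Lemma charge_nonbullet r p : (r <= d)%N -> g r p <> 1 -> at_ r p = 0.
Proof.
move=> rd gn; rewrite /charge_at big1 // => v /and3P[_ /eqP E1 /eqP E2].
by apply: strands1_charge; rewrite Lg E1 ?E2 //; apply/eqP.
Qed.

Lemma charge_segment (u v : vert) : arcs d u v -> u.1 <> v.1 :> nat ->
  at_ u.1 u.2 = at_ v.1 v.2.
Proof. by move=> a n; rewrite !charge_at_vertex (Cclosed a) (arcs_same Lor a n). Qed.

Lemma charge_cup (u v : vert) : arcs d u v -> u.1 = v.1 :> nat ->
  at_ u.1 u.2 + at_ v.1 v.2 = 0.
Proof.
move=> a n; rewrite !charge_at_vertex (Cclosed a) (opposite_flip (arcs_opposite Lor a n)).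
by case: (C v) => //; case: (L u).
Qed.

Lemma charge_vertical k p : (k < d)%N -> p <> s k -> p <> (s k).+1 ->
  at_ k.+1 p = at_ k p.
Proof.
move=> kd n1 n2; have [_ gE _] := levels kd.
case: (ltnP p N) => [pN|Np]; last by rewrite !charge_at_out.
case: (g k p =P 1) => [gp|gp]; last by rewrite !charge_nonbullet ?gE // ltnW.
have [u [u1 u2]] := line_vertex (ltnW kd) pN.
have [v [v1 v2]] := line_vertex kd pN.
rewrite -{1}v1 -u1 -{1}v2 -u2; symmetry; apply: charge_segment; last by rewrite u1 v1; lia.
apply: (arcs_mono kd); apply: (level_arcs kd).
by apply/half_arcP; apply: VertArc => //; rewrite u2 ?v2.
Qed.

(** The two ends of a cup or cap have total charge 0, a segment transports its charge, and a vertex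
    which is no bullet has charge 0. The last two clauses single out the chargeless vertices next to
    a slanted segment. *)
Lemma charge_active k : (k < d)%N ->
  [/\ at_ k.+1 (s k) + at_ k.+1 (s k).+1 = at_ k (s k) + at_ k (s k).+1,
      g k (s k) = 1 -> g k (s k).+1 = 0 ->
        at_ k.+1 (s k) = 0 /\ at_ k (s k).+1 = 0
    & g k (s k) = 2 -> at_ k (s k) = 0
        /\ (g k (s k).+1 = 1 -> at_ k.+1 (s k).+1 = 0)].
Proof.
move=> kd; have [sN _ spec] := levels kd.
have [u [u1 u2]] := line_vertex (ltnW kd) (ltnW sN).
have [v [v1 v2]] := line_vertex (ltnW kd) sN.
have [u' [u'1 u'2]] := line_vertex kd (ltnW sN).
have [v' [v'1 v'2]] := line_vertex kd sN.
have up x y : half_arc s g k x y -> arcs d x y.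
  by move=> a; apply: (arcs_mono kd); apply: (level_arcs kd).
have nb r p := @charge_nonbullet r p.
case: spec => E1 E2 E3 E4.
- have a := up u v ltac:(by apply/half_arcP; apply: CupArc).
  have := charge_cup a; rewrite u1 v1 => /(_ erefl); rewrite u2 v2 => ->.
  by rewrite (nb k.+1 (s k)) ?E3 // (nb k.+1 (s k).+1) ?E4 //; split; rewrite ?E1 ?E2.
- have a := up u' v' ltac:(by apply/half_arcP; apply: CapArc).
  have := charge_cup a; rewrite u'1 v'1 => /(_ erefl); rewrite u'2 v'2 => ->.
  rewrite (nb k (s k)) ?E1 //; try exact: ltnW.
  by rewrite (nb k (s k).+1) ?E2 //; try exact: ltnW; split.
- have a := up u v' ltac:(by apply/half_arcP; apply: RightArc).
  have := charge_segment a; rewrite u1 v'1 u2 v'2 => ->; last by lia.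
  rewrite (nb k (s k).+1) ?E2 //; try exact: ltnW.
  by rewrite (nb k.+1 (s k)) ?E3 // addrC; split; rewrite ?E1.
- have a := up v u' ltac:(by apply/half_arcP; apply: LeftArc).
  have := charge_segment a; rewrite v1 u'1 v2 u'2 => ->; last by lia.
  rewrite (nb k (s k)) ?E1 //; try exact: ltnW.
  by rewrite (nb k.+1 (s k).+1) ?E4 // addrC; split; rewrite ?E1.
Qed.

(** Position [(s k).+1] is the only one that separates the two active vertices; at any other, both
    are counted or neither. *)
Lemma charge_left_level k p : (k < d)%N -> p <> (s k).+1 ->
  left_ k.+1 p = left_ k p.
Proof.
move=> kd; elim/ltn_ind: p => -[|p] IH n; first by rewrite !charge_left0.
rewrite !charge_leftS; case: (p =P (s k).+1) => [E|n1].
  rewrite E !charge_leftS -!addrA; have [-> _ _] := charge_active kd.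
  by rewrite IH //; lia.
by rewrite IH // charge_vertical //; lia.
Qed.

(** At the right-hand end of a slanted segment one more vertex lies to the left, and it has charge
    0. *)
Lemma arcs_left_segment (u v : vert) : arcs d u v -> u.1 <> v.1 :> nat ->
  left_ u.1 u.2 = left_ v.1 v.2.
Proof.
move=> /arcsP[k [kd _]]; have [sN _ spec] := levels kd.
have [_ A1 A2] := charge_active kd.
have H x y : half_arc s g k x y -> x.1 <> y.1 :> nat -> left_ x.1 x.2 = left_ y.1 y.2.
  case/half_arcP=> [-> -> -> h4 h5 h6|e1 e2 -> ->|e1 e2 -> ->|e1 e2 -> -> -> ->|e1 e2 -> -> -> ->] // _.
  - by rewrite charge_left_level.
  - have [A3 _] := A1 e1 e2; rewrite charge_leftS A3 addr0 charge_left_level //; lia.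
  - have [A3 _] := A2 e1; rewrite charge_leftS A3 addr0 charge_left_level //; lia.
by case/orP=> /H h n; [exact: h|symmetry; apply: h; exact: nesym].
Qed.

Lemma arcs_left_cup (u v : vert) : arcs d u v -> u.1 = v.1 :> nat -> (u.2 < v.2)%N ->
  left_ v.1 v.2 = left_ u.1 u.2 + at_ u.1 u.2.
Proof.
move=> /arcsP[k [kd _]] /orP[] /half_arcP[] h1 h2 h3 h4 h5 h6 e lt; try lia.
all: by rewrite -e h5 h6 charge_leftS.
Qed.

Lemma charge_line r : (r <= d)%N -> left_ r N = left_ 0 N.
Proof.
elim: r => // r IH rd; have [sN _ _] := levels rd.
by rewrite charge_left_level //; [exact: IH (ltnW rd)|lia].
Qed.

End Closed.
End Levels.

(** * The degree formula *)


Lemma sum_nat_support (N : nat) (X : seq nat) (f : nat -> int) :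
  uniq X -> all (fun x => x < N)%N X ->
  (forall p, (p < N)%N -> p \notin X -> f p = 0) ->
  \sum_(0 <= p < N) f p = \sum_(p <- X) f p.
Proof.
move=> Xu /allP XN f0.
rewrite (bigID [in X]) /= [X in _ + X]big_nat_cond [X in _ + X]big1 ?addr0; last first.
  by move=> p /andP[/andP[_ pN] pX]; apply: f0.
rewrite -big_filter; apply: perm_big; apply: uniq_perm => //.
  exact/filter_uniq/iota_uniq.
move=> x; rewrite mem_filter mem_iota /= add0n subn0.
by case xX: (x \in X) => //=; rewrite XN.
Qed.

Lemma sum_nat_change (N : nat) (X : seq nat) (f f' : nat -> bool) :
  uniq X -> all (fun x => x < N)%N X ->
  (forall p, (p < N)%N -> p \notin X -> f p = f' p) ->
  \sum_(0 <= p < N) (f' p)%:Z =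
    \sum_(0 <= p < N) (f p)%:Z + \sum_(p <- X) ((f' p)%:Z - (f p)%:Z).
Proof.
move=> Xu XN ff; rewrite -(sum_nat_support Xu XN).
  by rewrite -big_split /=; apply: eq_bigr => p _; rewrite addrC subrK.
by move=> p pN pX; rewrite ff // subrr.
Qed.

Section Levels.
Variables (N d : nat) (s : nat -> nat) (g : nat -> nat -> int).
Local Notation vert := (vertex N d).
Hypothesis levels : forall k, (k < d)%N ->
  [/\ ((s k).+1 < N)%N,
      forall p, p <> s k -> p <> (s k).+1 -> g k.+1 p = g k p
    & level_spec (g k (s k)) (g k (s k).+1) (g k.+1 (s k)) (g k.+1 (s k).+1)].
Local Notation arcs := (@arcs N d s g).
Local Notation pairing := (pairing s g).

Definition label_of (L : labelling N d) (r p : nat) : label :=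
  if [pick v : vert | (v.1 == r :> nat) && (v.2 == p :> nat)] is Some v
  then L v else LCirc.

Lemma label_of_vertex L (v : vert) : label_of L v.1 v.2 = L v.
Proof.
rewrite /label_of; case: pickP => [u /andP[/eqP E1 /eqP E2]|/(_ v)].
  by rewrite (vertex_eq E1 E2).
by rewrite !eqxx.
Qed.

Definition level_cup k := (g k (s k) == 1) && (g k (s k).+1 == 1).
Definition level_cap k := (g k (s k) == 2) && (g k (s k).+1 == 0).
(** The cup of level [k] meets both ends of one cap formed above it and so completes a closed
    circle. *)
Definition closing k := level_cup k && (pairing k (s k) == (s k).+1).

Definition cw_pairs (L : labelling N d) (k : nat) : int :=
  \sum_(0 <= p < N) ((p < pairing k p)%N && (label_of L k p == LWedge))%:Z.

Definition level_degree (L : labelling N d) (k : nat) : int :=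
  (level_cap k && (label_of L k.+1 (s k) == LWedge))%:Z
    - (level_cup k && (label_of L k (s k) == LVee))%:Z.

Definition circle_degree (L : labelling N d) (k : nat) : int :=
  if closing k then - charge (label_of L k (s k)) else 0.

Section Labelled.
Variables (L : labelling N d) (l0 : label).
Hypothesis Lg : forall u : vert, (u.1 <= d)%N -> strands (L u) = g u.1 u.2.
Hypothesis Lor : oriented (arcs d) L.
Hypothesis Ltop : forall u : vert, u.1 = 0%N :> nat -> g 0 u.2 = 1 -> L u = l0.

Lemma label_vertical k p : (k < d)%N -> g k p = 1 -> p <> s k -> p <> (s k).+1 ->
  (p < N)%N -> label_of L k.+1 p = label_of L k p.
Proof.
move=> kd gp n1 n2 pN; have [_ gE _] := levels kd.
have [v [v1 v2]] := line_vertex kd pN.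
have := vertical_up levels Lor kd v1; rewrite v2 gE // => /(_ gp n1 n2).
case=> u [u1 u2 _ Lu _].
have := label_of_vertex L v; have := label_of_vertex L u.
by rewrite u1 u2 v1 v2 Lu => -> ->.
Qed.

(** A new cap adds to the degree what it adds to the clockwise caps, and a slanted segment changes
    neither. A cup whose left end is a vee lowers the degree by 1 and, unless it closes a circle,
    also the number of clockwise caps; with a wedge it changes neither. Where a circle closes,
    [circle_degree] makes up the difference. *)
Lemma cw_pairs_step k : (k < d)%N ->
  cw_pairs L k.+1 + circle_degree L k = cw_pairs L k + level_degree L k.
Proof.
move=> kd; have [sN gE spec] := levels kd.
have [fK fbul nc] := pairing_noncrossing levels (ltnW kd).
have fN p := @pairing_ltn _ _ _ _ levels k p (ltnW kd).
have bl p : pairing k p <> p -> g k p = 1 by move=> /fbul/eqP.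
have nb p : g k p <> 1 -> pairing k p = p.
  by move=> h; apply/eqP/negPn/negP=> /eqP/bl.
have inj x y : pairing k x = pairing k y -> x = y by move/(congr1 (pairing k)); rewrite !fK.
have lab_pair p : (p < N)%N -> pairing k p <> p ->
    label_of L k (pairing k p) = flip (label_of L k p).
  move=> pN np; have [u [u1 u2]] := line_vertex (ltnW kd) pN.
  have [|w [w1 w2 _ _ /opposite_flip o]] := paired_vertex levels Lor Ltop (ltnW kd) u1.
    by rewrite u2.
  have := label_of_vertex L w; have := label_of_vertex L u.
  by rewrite u1 u2 w1 w2 u2 o => -> ->.
rewrite /circle_degree /level_degree /closing /level_cup /level_cap /cw_pairs.
have pnr p : p <> s k -> p <> (s k).+1 -> (p < N)%N -> pairing k p <> p ->
   label_of L k.+1 p = label_of L k p.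
  by move=> *; apply: label_vertical => //; exact: bl.
have [x [x1 x2]] := line_vertex (ltnW kd) (ltnW sN).
have [y [y1 y2]] := line_vertex (ltnW kd) sN.
have Lx := label_of_vertex L x; have Ly := label_of_vertex L y.
rewrite x1 x2 in Lx; rewrite y1 y2 in Ly.
have up u v : half_arc s g k u v -> arcs d u v.
  by move=> a; apply: (arcs_mono kd); apply: (level_arcs kd).
have bx : g k (s k) = 1 -> (label_of L k (s k) == LVee) || (label_of L k (s k) == LWedge).
  by move=> gx; rewrite Lx -strands1P Lg x1 ?x2 ?gx // ltnW.
case: (spec) => E1 E2 E3 E4; rewrite E1 E2 /= ?subr0 ?sub0r /pair_step E1 E2 /=.
- have axy : arcs d x y by apply: up; apply/half_arcP; apply: CupArc.
  have := arcs_opposite Lor axy (etrans x1 (esym y1)); rewrite -Lx -Ly => /opposite_flip Lyx.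
  have {bx}bx := bx E1; set a := label_of L k (s k) in bx Lyx *.
  have fs := fK (s k); have fs1 := fK (s k).+1.
  set P := pairing k (s k) in fs *; set Q := pairing k (s k).+1 in fs1 *.
  have PN : (P < N)%N by apply: fN; exact: ltnW.
  have QN : (Q < N)%N by exact: fN.
  have PQ : P <> Q by move=> /inj; lia.
  have frp p : p <> s k -> p <> (s k).+1 -> p <> P -> p <> Q ->
      join_ends (s k) (pairing k) p = pairing k p.
    move=> n1 n2 n3 n4; rewrite /join_ends; do 2!case: eqP => //= _.
    by case: eqP => [e|_]; [case: n3; rewrite /P -e fK|case: eqP => // e; case: n4; rewrite /Q -e fK].
  (* Only the positions [s k], [(s k).+1], [P] and [Q] can contribute differently. They may
     coincide, so the repetition-free list [X] depends on the case. *)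
  have same (X : seq nat) : uniq X -> all (fun p => p < N)%N X -> s k \in X -> (s k).+1 \in X ->
      (P \in X) && (Q \in X) ->
      \sum_(0 <= p < N) ((p < join_ends (s k) (pairing k) p)%N && (label_of L k.+1 p == LWedge))%:Z =
      \sum_(0 <= p < N) ((p < pairing k p)%N && (label_of L k p == LWedge))%:Z
      + \sum_(p <- X) (((p < join_ends (s k) (pairing k) p)%N && (label_of L k.+1 p == LWedge))%:Z -
          ((p < pairing k p)%N && (label_of L k p == LWedge))%:Z).
    move=> Xu XN Xs Xs1 /andP[XP XQ]; apply: sum_nat_change => // p pN pX.
    have n1 : p <> s k by move=> e; rewrite e Xs in pX.
    have n2 : p <> (s k).+1 by move=> e; rewrite e Xs1 in pX.
    have n3 : p <> P by move=> e; rewrite e XP in pX.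
    have n4 : p <> Q by move=> e; rewrite e XQ in pX.
    rewrite frp //; case: (pairing k p =P p) => [->|np]; first by rewrite ltnn.
    by rewrite pnr.
  have js : join_ends (s k) (pairing k) (s k) = s k by rewrite /join_ends eqxx.
  have js1 : join_ends (s k) (pairing k) (s k).+1 = (s k).+1 by rewrite /join_ends eqxx orbT.
  have nss : (s k == (s k).+1) = false by apply/eqP; lia.
  have ncQ := nc Q (s k).
  case: (P =P (s k).+1) => [Ps1|nPs1].
    have Qs : Q = s k by rewrite /Q -Ps1.
    rewrite (same [:: s k; (s k).+1]) /= ?inE ?nss ?(ltnW sN) ?sN ?Ps1 ?Qs ?eqxx ?orbT //.
    rewrite !big_cons big_nil js js1 !ltnn /= -/P -/Q Ps1 Qs -/a ltnSn.
    rewrite (_ : ((s k).+1 < s k)%N = false); last by lia.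
    by case/orP: bx => /eqP-> /=; lia.
  have nQs : Q <> s k by move=> e; apply: nPs1; rewrite -fs1 e.
  have fP : pairing k P = s k by [].
  have fQ : pairing k Q = (s k).+1 by [].
  have labP : P <> s k -> label_of L k P = flip a by move=> n; apply: lab_pair => //; exact: ltnW.
  have labQ : Q <> (s k).+1 -> label_of L k Q = a.
    by move=> n; rewrite lab_pair // Lyx flipK.
  have labP' : P <> s k -> label_of L k.+1 P = flip a.
    by move=> n; rewrite pnr ?labP // fP; exact: nesym.
  have labQ' : Q <> (s k).+1 -> label_of L k.+1 Q = a.
    by move=> n; rewrite pnr ?labQ // fQ; exact: nesym.
  case: (P =P s k) => [Ps|nPs]; case: (Q =P (s k).+1) => [Qs1|nQs1].
  (* The two ends of the cup cannot both run to the top line: both would be labelled [l0], yet they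
     are opposite. *)
  + have := (pairing_joined levels Lor Ltop (ltnW kd)).2.
    move=> /[dup] /(_ x x1) + /(_ y y1); rewrite x2 y2 => /(_ E1 Ps)[Lx0 _] /(_ E2 Qs1)[Ly0 _].
    by move: Lyx bx; rewrite Ly Ly0 -Lx0 -Lx -/a; case: (a).
  + have jQ : join_ends (s k) (pairing k) Q = Q.
      rewrite /join_ends; do 2!case: eqP => //= _; rewrite fQ eqxx -/P Ps eqxx.
      by case: eqP => //; lia.
    have Qgt : ((s k).+1 < Q)%N.
      have := ncQ; rewrite fQ -/P Ps => H.
      by case: (ltngtP (s k).+1 Q) => [//|lt|]; [case: H => //; lia|move=> e; case: nQs1].
    rewrite (same [:: s k; (s k).+1; Q]) /= ?inE ?nss ?(ltnW sN) ?sN ?QN ?Ps ?eqxx ?orbT //; last first.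
      by rewrite andbT; apply/andP; split; [|apply/eqP; lia]; apply/norP; split; apply/eqP; lia.
    rewrite !big_cons big_nil js js1 jQ !ltnn /= -/P -/Q Ps fQ -/a Qgt Lyx labQ //.
    rewrite ltnn (_ : (Q < (s k).+1)%N = false); last by lia.
    by case/orP: bx => /eqP-> /=; lia.
  + have jP : join_ends (s k) (pairing k) P = P.
      by rewrite /join_ends; do 2!case: eqP => //= _; rewrite fP eqxx -/Q Qs1 eqxx.
    have Plt : (P < s k)%N.
      have := nc (s k) (s k).+1; rewrite -/P -/Q Qs1 => H.
      by case: (ltngtP P (s k)) => [//|lt|//]; case: H => //; lia.
    rewrite (same [:: s k; (s k).+1; P]) /= ?inE ?nss ?(ltnW sN) ?sN ?PN ?Qs1 ?eqxx ?orbT //; last first.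
      by rewrite andbT; apply/andP; split; [|apply/eqP; lia]; apply/norP; split; apply/eqP; lia.
    rewrite !big_cons big_nil js js1 jP !ltnn /= -/P -/Q Qs1 fP -/a Plt Lyx labP //.
    rewrite ltnn (_ : (s k < P)%N = false); last by lia.
    by case/orP: bx => /eqP-> /=; lia.
  + have jP : join_ends (s k) (pairing k) P = Q.
      by rewrite /join_ends; do 2!case: eqP => //= _; rewrite fP eqxx -/Q; case: eqP.
    have jQ : join_ends (s k) (pairing k) Q = P.
      rewrite /join_ends; do 2!case: eqP => //= _; rewrite fQ eqxx -/P; case: eqP; first by lia.
      by case: eqP.
    rewrite (same [:: s k; (s k).+1; P; Q]) /= ?inE ?nss ?(ltnW sN) ?sN ?PN ?QN ?eqxx ?orbT //; last first.
      rewrite andbT; apply/and3P; split; last by apply/eqP.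
        by apply/norP; split; [apply/eqP; lia|apply/norP; split; apply/eqP; lia].
      by apply/norP; split; apply/eqP; lia.
    rewrite !big_cons big_nil js js1 jP jQ !ltnn /= -/P -/Q fP fQ -/a Lyx labP // labQ //.
    rewrite labP' // labQ' //.
    (* Noncrossing leaves three positions of the two caps: side by side, or nested on the right or
       on the left of the cup. *)
    have C1 : (s k < P)%N -> (s k < Q)%N && (Q < P)%N.
      move=> lt; have := nc (s k) (s k).+1 (ltnSn _); rewrite -/P -/Q E2.
      by case/(_ ltac:(lia) isT) => _ -> ->.
    have C2 : (Q < (s k).+1)%N -> (Q < P)%N && (P < s k)%N.
      move=> lt; have := nc Q (s k) ltac:(lia); rewrite fQ -/P E1.
      by case/(_ (ltnSn _) isT) => _ h1 h2; lia.
    case: (ltngtP P (s k)) => [lP|gP|//]; case: (ltngtP (s k).+1 Q) => [gQ|lQ|e]; try by case: nQs1.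
    - have lPQ : (P < Q)%N by lia.
      by rewrite lPQ (ltnNge Q P) (ltnW lPQ) /=; case/orP: bx => /eqP-> /=; lia.
    - have /andP[lQP _] := C2 lQ.
      by rewrite lQP (ltnNge P Q) (ltnW lQP) /=; case/orP: bx => /eqP-> /=; lia.
    - have /andP[_ lQP] := C1 gP.
      by rewrite lQP (ltnNge P Q) (ltnW lQP) /=; case/orP: bx => /eqP-> /=; lia.
    - by have := C1 gP; have := C2 lQ; lia.
- have fs := nb (s k) ltac:(lia).
  have fs1 := nb (s k).+1 ltac:(lia).
  rewrite (sum_nat_change (X := [:: s k; (s k).+1])
      (f := fun p => (p < pairing k p)%N && (label_of L k p == LWedge))).
  + rewrite !big_cons big_nil /insert_pair !eqxx /= fs fs1 !ltnn ltnSn /=.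
    rewrite ifF; last by apply/eqP; lia.
    rewrite (_ : ((s k).+1 < s k)%N = false); last by lia.
    by rewrite /= subr0 !addr0.
  + by rewrite /= inE andbT; apply/eqP; lia.
  + by rewrite /= (ltnW sN) sN.
  + move=> p pN; rewrite !inE => /norP[n1 n2].
    rewrite /insert_pair (negPf n1) (negPf n2).
    case: (pairing k p =P p) => [->|np]; first by rewrite ltnn.
    by rewrite pnr //; apply/eqP.
all: have sh : (g k (s k) = 1) * (g k (s k).+1 = 0) \/ (g k (s k) = 2) * (g k (s k).+1 = 1) by rewrite E1 E2; auto.
all: rewrite ?addr0.
all: have ne : (s k == (s k).+1) = false by apply/eqP; lia.
all: have ne1 : ((s k).+1 == s k) = false by apply/eqP; lia.
all: rewrite (sum_nat_change (X := [:: s k; (s k).+1])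
      (f := fun p => (p < pairing k p)%N && (label_of L k p == LWedge)));
  [|by rewrite /= inE andbT ne|by rewrite /= (ltnW sN) sN
   |move=> p pN; rewrite !inE => /norP[n1 n2];
    rewrite /shift_end {2}/swap_next (negPf n1) (negPf n2);
    case: (pairing k p =P p) => [->|np];
      [by rewrite /swap_next (negPf n1) (negPf n2) !ltnn
      |rewrite pnr //; try exact/eqP; congr (_ && _); rewrite /swap_next;
       move/eqP: n1; move/eqP: n2; clear; case: eqP; [|case: eqP]; lia]].
all: rewrite !big_cons big_nil /shift_end.
- have fs1 := nb (s k).+1 ltac:(lia).
  have L1 : label_of L k.+1 (s k).+1 = label_of L k (s k).
    have [v [v1 v2]] := line_vertex kd sN.
    have := shift_up levels Lor kd v1; rewrite v2 => /(_ E4 sh).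
    case=> u [u1 u2 _ Lu _]; have := label_of_vertex L v; have := label_of_vertex L u.
    by rewrite u1 u2 v1 v2 Lu /swap_next ne1 eqxx => -> ->.
  have w1 : swap_next (s k) (s k) = (s k).+1 by rewrite /swap_next eqxx.
  have w2 : swap_next (s k) (s k).+1 = s k by rewrite /swap_next ne1 eqxx.
  have lt : ((s k).+1 < swap_next (s k) (pairing k (s k)))%N = (s k < pairing k (s k))%N.
    have := fK (s k); set P := pairing k (s k) => fP.
    have : P <> (s k).+1 by move=> e; rewrite e fs1 in fP; lia.
    by rewrite /swap_next; clear; case: eqP; [|case: eqP]; lia.
  by rewrite w1 w2 fs1 w2 L1 lt !ltnn /=; lia.
- have fs := nb (s k) ltac:(lia).
  have L1 : label_of L k.+1 (s k) = label_of L k (s k).+1.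
    have [v [v1 v2]] := line_vertex kd (ltnW sN).
    have := shift_up levels Lor kd v1; rewrite v2 => /(_ E3 sh).
    case=> u [u1 u2 _ Lu _]; have := label_of_vertex L v; have := label_of_vertex L u.
    by rewrite u1 u2 v1 v2 Lu /swap_next eqxx => -> ->.
  have w1 : swap_next (s k) (s k) = (s k).+1 by rewrite /swap_next eqxx.
  have w2 : swap_next (s k) (s k).+1 = s k by rewrite /swap_next ne1 eqxx.
  have lt : (s k < swap_next (s k) (pairing k (s k).+1))%N = ((s k).+1 < pairing k (s k).+1)%N.
    have := fK (s k).+1; set P := pairing k (s k).+1 => fP.
    have : P <> s k by move=> e; rewrite e fs in fP; lia.
    by rewrite /swap_next; clear; case: eqP; [|case: eqP]; lia.
  by rewrite w1 w2 fs w1 L1 lt !ltnn /=; lia.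
Qed.

(** [cw_pairs_step] telescopes. At [k = d] this writes the degree as the number of clockwise
    boundary caps plus a signed count of closed circles. *)
Lemma degree_formula k : (k <= d)%N ->
  \sum_(0 <= j < k) level_degree L j =
    cw_pairs L k + \sum_(0 <= j < k) circle_degree L j.
Proof.
elim: k => [_|k IH kd].
  rewrite !big_geq // addr0 /cw_pairs big1 // => p _; rewrite /= ltnn //.
rewrite !big_nat_recr //= IH ?(ltnW kd) // addrAC -cw_pairs_step //.
by rewrite -addrA (addrC (circle_degree L k)).
Qed.

End Labelled.
End Levels.


(** * Reversal of closed circles *)

Definition flip_on N d (C : pred (vertex N d)) (L : labelling N d) : labelling N d :=
  [ffun u => if C u then flip (L u) else L u].

Lemma flip_on_oriented N d (E : rel (vertex N d)) C L :
  (forall u v, E u v -> C u = C v) -> oriented E L -> oriented E (flip_on C L).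
Proof.
move=> Cc /forallP Lor; apply/forallP=> u; apply/forallP=> v; apply/implyP=> e.
have /forallP/(_ v) := Lor u; rewrite e /= !ffunE (Cc _ _ e).
case: ifP => _; case: ifP => _ //; first by rewrite flip_opposite.
by move=> /eqP->.
Qed.

Section Levels.
Variables (N d : nat) (s : nat -> nat) (g : nat -> nat -> int).
Local Notation vert := (vertex N d).
Hypothesis levels : forall k, (k < d)%N ->
  [/\ ((s k).+1 < N)%N,
      forall p, p <> s k -> p <> (s k).+1 -> g k.+1 p = g k p
    & level_spec (g k (s k)) (g k (s k).+1) (g k.+1 (s k)) (g k.+1 (s k).+1)].
Local Notation arcs := (@arcs N d s g).
Local Notation pairing := (pairing s g).

Variables (L : labelling N d) (l0 : label).
Hypothesis Lg : forall u : vert, (u.1 <= d)%N -> strands (L u) = g u.1 u.2.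
Hypothesis Lor : oriented (arcs d) L.
Hypothesis Ltop : forall u : vert, u.1 = 0%N :> nat -> g 0 u.2 = 1 -> L u = l0.

(** The total charge of [C] is the same on every line and 0 on the top one. This is why reversing
    [C] preserves the numbers of vees and wedges. *)
Lemma balanced_line (C : pred vert) r : (forall u v, arcs d u v -> C u = C v) ->
  (forall u : vert, u.1 = 0%N :> nat -> g 0 u.2 = 1 -> ~~ C u) -> (r <= d)%N ->
  \sum_(v : vert | C v && (v.1 == r :> nat)) charge (L v) = 0.
Proof.
move=> Cc C0 rd; have := charge_line levels Lg Lor Cc rd.
rewrite /charge_left => E.
transitivity (\sum_(v : vert | [&& C v, v.1 == r :> nat & (v.2 < N)%N]) charge (L v)).
  by apply: eq_bigl => v; rewrite ltn_ord andbT.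
rewrite E big1 // => v /and3P[Cv /eqP v0 _].
apply: strands1_charge; apply/negP=> /eqP; rewrite Lg v0 // => gv.
by have := C0 v v0 gv; rewrite Cv.
Qed.

(** Within the first [k] levels the component of [x] meets line [k] only at the two ends of the
    closing cup, so no other arc leads out of it. *)
Lemma closing_inside k (x v : vert) : (k < d)%N -> closing s g k ->
  x.1 = k :> nat -> x.2 = s k :> nat -> connect (arcs d) x v ->
  (v.1 < d)%N /\ v.1 <> 0%N :> nat.
Proof.
move=> kd /andP[/andP[/eqP g1 /eqP g2] /eqP pk] x1 x2.
have px : pairing k x.2 <> x.2 by rewrite x2 pk; lia.
have nc := pairing_noncrossing levels (ltnW kd).
have inner (v' : vert) : connect (arcs k) x v' -> (v'.1 <= k)%N /\ v'.1 <> 0%N :> nat.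
  move=> c; split; last exact: (paired_not_top levels Lor Ltop (ltnW kd) x1 px c).
  case: (eqVneq v' x) => [->|ne]; first by rewrite x1.
  have c' : connect (arcs k) v' x by rewrite connect_arcs_sym.
  by have [] := connect_bullet levels c' ne.
suff H : forall p u, connect (arcs k) x u -> path (arcs d) u p -> connect (arcs k) x (last u p).
  case/connectP=> p pp ->; have [h1 h2] := inner _ (H p x (connect0 _ _) pp).
  by split=> //; exact: leq_ltn_trans h1 kd.
elim=> //= w p IH u cu /andP[a pp]; apply: IH pp.
have [uk _] := inner _ cu.
case/arcsP: a => j [jd _ a]; have [j1 j2 _] := level_arc_bullet levels jd a.
case: (ltnP j k) => jk.
  by apply: connect_trans cu (connect1 _); apply/arcsP; exists j.
have Ej : j = k by lia.
have u1 : u.1 = k :> nat by lia.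
rewrite {j jd j1 j2 jk}Ej in a.
have onk (v' : vert) : v'.1 = k :> nat -> v'.2 = (s k).+1 :> nat -> connect (arcs k) x v'.
  move=> v1 v2; have [h _] := pairing_joined levels Lor Ltop (ltnW kd).
  by case: (h x v' x1 v1) => //; [rewrite x2 pk|move=> e; rewrite e v2 in x2; lia].
have onk' (v' : vert) : v'.1 = k :> nat -> v'.2 = s k :> nat -> v' = x.
  by move=> v1 v2; apply: vertex_eq; rewrite ?v1 ?v2.
have u2 : u.2 = s k :> nat \/ u.2 = (s k).+1 :> nat.
  case: (u =P x) => [->|/nesym ne]; [by left|right].
  by rewrite (connected_bottom levels Lor Ltop (ltnW kd) x1 u1 cu ne) x2 pk.
case/orP: a => /half_arcP[] h1 h2 h3 h4 h5 h6; try lia.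
all: by [rewrite (onk' w) ?connect0|apply: onk].
Qed.

(** On the lines up to [d] these are the vertices of closed circles and, harmlessly, vertices which
    are no bullets, whose labels [flip] fixes. *)
Definition reversed : pred vert := fun u =>
  ~~ [exists w : vert, [&& (w.1 == 0%N :> nat) || (w.1 == d :> nat),
        g w.1 w.2 == 1 & connect (arcs d) u w]].

Lemma reversed_closed u v : arcs d u v -> reversed u = reversed v.
Proof.
move=> a; congr (~~ _); apply: eq_existsb => w; congr [&& _, _ & _].
exact: (same_connect (@connect_arcs_sym N d s g d) (connect1 a)).
Qed.

Lemma reversed_end (u : vert) : (u.1 = 0%N :> nat) \/ (u.1 = d :> nat) ->
  g u.1 u.2 = 1 -> ~~ reversed u.
Proof.
move=> h gu; rewrite /reversed negbK; apply/existsP; exists u.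
by rewrite gu eqxx connect0 /= andbT; case: h => ->; rewrite eqxx ?orbT.
Qed.

(** Without clockwise boundary caps only the closed circles contribute in [degree_formula], and
    reversal changes the label at each closing cup. *)
Lemma reversed_degree : cw_pairs s g L d = 0 ->
  \sum_(0 <= j < d) level_degree s g (flip_on reversed L) j =
  - \sum_(0 <= j < d) level_degree s g L j.
Proof.
move=> cw0; set L' := flip_on reversed L.
have Lg' (u : vert) : (u.1 <= d)%N -> strands (L' u) = g u.1 u.2.
  by move=> ud; rewrite ffunE -Lg //; case: ifP => // _; exact: strands_flip.
have Lor' : oriented (arcs d) L' by apply: flip_on_oriented Lor; exact: reversed_closed.
have Ltop' (u : vert) : u.1 = 0%N :> nat -> g 0 u.2 = 1 -> L' u = l0.
  move=> u0 gu; rewrite ffunE (negPf (reversed_end (or_introl u0) _)) ?u0 //; exact: Ltop.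
rewrite (degree_formula levels Lg' Lor' Ltop') // (degree_formula levels Lg Lor Ltop) //.
have lab p : g d p = 1 -> label_of L' d p = label_of L d p.
  move=> gp; rewrite /label_of; case: pickP => // u /andP[/eqP u1 /eqP u2].
  rewrite ffunE (negPf (reversed_end (or_intror u1) _)) //.
  by rewrite u1 u2.
have -> : cw_pairs s g L' d = 0.
  rewrite -cw0; apply: eq_big_nat => p _.
  case: (g d p =P 1) => [gp|gp]; first by rewrite lab.
  have [_ fbul _] := pairing_noncrossing levels (leqnn d).
  have E : pairing d p = p by apply/eqP/negPn/negP=> /eqP/fbul/eqP.
  by rewrite E ltnn.
rewrite cw0 !add0r -sumrN; apply: eq_big_nat => k /andP[_ kd].
rewrite /circle_degree; case: ifP => [ck|_]; last by rewrite oppr0.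
have [sN _ _] := levels kd.
have [x [x1 x2]] := line_vertex (ltnW kd) (ltnW sN).
have := label_of_vertex L' x; have := label_of_vertex L x; rewrite x1 x2 => -> ->.
rewrite ffunE; case: ifP => [_|/negbFE/existsP[w /and3P[h _ c]]]; first by case: (L x).
have [h1 h2] := closing_inside kd ck x1 x2 c.
by case/orP: h => /eqP h; lia.
Qed.

End Levels.

(** * Oriented stretched cap diagrams *)


Lemma existsb_bool (P : pred bool) : [exists b : bool, P b] = P true || P false.
Proof.
apply/existsP/orP => [[[] ->]|[]]; [by left|by right|by exists true|by exists false].
Qed.

Section Stretched.
Variables (I : pred int) (o : int) (m n : nat) (alpha : lattice) (d : nat).
Local Notation N := (width m n d).
Local Notation vert := (vertex N d).
Local Notation stretched := (stretched I o m n alpha d).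

(** The entries of the sequence of a stretched cap diagram are at least [o + 1], so the absolute
    value is only a conversion to [nat]. *)
Definition pos (ii : seq int) (k : nat) : nat := `|(nth 0 ii k - (o + 1))%R|%N.
Definition mult (ii : seq int) (k p : nat) : int :=
  coeff (o + 1 + p%:Z) (Gamma_ o m n ii k).

Lemma label_at_vtx (la : weight N) p : label_at o la (vtx o p) = la p.
Proof.
rewrite /label_at; case: pickP => [q /eqP/vtx_inj-> //|/(_ p)].
by rewrite eqxx.
Qed.

Variable t : stretched.
Local Notation ii := (seq_of t).
Local Notation s := (pos ii).
Local Notation g := (mult ii).
Local Notation L := (Defs.double (val t).2).

Lemma wt_in_block k : (k <= d)%N -> in_block o I m n (Gamma_ o m n ii k) (wt_of t k).
Proof.
move=> kd; have /and3P[_ /forallP/(_ (inord k)) + _] := valP t.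
by rewrite inordK.
Qed.

Lemma seq_size : size ii = d.
Proof. by rewrite size_map size_tuple. Qed.

Lemma seq_pos k : (k < d)%N -> nth 0 ii k = o + 1 + (s k)%:Z /\ (s k < N)%N.
Proof.
move=> kd; rewrite /pos /seq_of (nth_map (tnth (val t).1 (Ordinal kd))) ?size_tuple //.
set p := nth _ _ _; rewrite /vtx.
have E : `|(o + 1 + p%:Z - (o + 1))%R|%N = p by lia.
by rewrite E ltn_ord.
Qed.

Lemma mult_strands k (p : 'I_N) : (k <= d)%N -> g k p = strands (wt_of t k p).
Proof.
by move=> kd; have /andP[_ /eqP E] := wt_in_block kd; rewrite -(coeff_block o) E.
Qed.

Lemma mult_out k p : (k <= d)%N -> (N <= p)%N -> g k p = 0.
Proof.
move=> kd Np; have /andP[_ /eqP E] := wt_in_block kd; rewrite /mult -E.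
apply: coeff_block_out => q; apply/eqP => /addrI [] H.
by have := ltn_ord q; lia.
Qed.

Lemma strands_bound l : 0 <= strands l <= 2. Proof. by case: l. Qed.

Lemma mult_bound k p : (k <= d)%N -> 0 <= g k p <= 2.
Proof.
move=> kd; case: (ltnP p N) => [pN|Np]; last by rewrite mult_out.
by rewrite (mult_strands (Ordinal pN)) // strands_bound.
Qed.

Lemma multS k p : (k < d)%N ->
  g k.+1 p = g k p - (p == s k)%:Z + (p == (s k).+1)%:Z.
Proof.
move=> kd; have [E _] := seq_pos kd; rewrite /mult /Gamma_.
rewrite (take_nth 0) ?seq_size // -cats1 big_cat big_seq1 /= opprD addrA coeffB.
rewrite coeff_sroot E.
have -> : (o + 1 + p%:Z == o + 1 + (s k)%:Z) = (p == s k) by apply/eqP/eqP; lia.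
have -> : (o + 1 + p%:Z == o + 1 + (s k)%:Z + 1) = (p == (s k).+1) by apply/eqP/eqP; lia.
by rewrite opprB addrA addrAC.
Qed.

(** Subtracting a simple root lowers the multiplicity at [s k] by 1 and raises that at [(s k).+1] by
    1. As multiplicities stay between 0 and 2, four cases remain. *)
Lemma stretched_levels k : (k < d)%N ->
  [/\ ((s k).+1 < N)%N,
      forall p, p <> s k -> p <> (s k).+1 -> g k.+1 p = g k p
    & level_spec (g k (s k)) (g k (s k).+1) (g k.+1 (s k)) (g k.+1 (s k).+1)].
Proof.
move=> kd; have E p := multS p kd.
have B1 p := mult_bound p (ltnW kd); have B2 p := mult_bound p kd.
have Es := E (s k); have Es1 := E (s k).+1.
have b1 := B1 (s k); have b2 := B1 (s k).+1; have b3 := B2 (s k); have b4 := B2 (s k).+1.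
split.
(* Beyond the window all multiplicities vanish, whereas the one at [(s k).+1] has just been
   raised. *)
- rewrite ltnNge; apply/negP=> Np.
  by have := mult_out kd Np; have := mult_out (ltnW kd) Np; lia.
- by move=> p n1 n2; rewrite E; lia.
- have [Ea|Ea] : g k (s k) = 1 \/ g k (s k) = 2 by lia.
    have [Eb|Eb] : g k (s k).+1 = 0 \/ g k (s k).+1 = 1 by lia.
      by apply: LevelRight; lia.
    by apply: LevelCup; lia.
  have [Eb|Eb] : g k (s k).+1 = 0 \/ g k (s k).+1 = 1 by lia.
    by apply: LevelCap; lia.
  by apply: LevelLeft; lia.
Qed.

Lemma half_matchingE (k : 'I_d) (u v : vert) :
  [exists b : bool, exists b' : bool,
    [&& u.1 == line_of k b :> nat, v.1 == line_of k b' :> nat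
      & half_matching (nth 0 ii k) (Gamma_ o m n ii k) (b, vtx o u.2) (b', vtx o v.2)]]
  = half_arc s g k u v.
Proof.
have [E _] := seq_pos (ltn_ord k).
have E0 (p : 'I_N) : (vtx o p == nth 0 ii k) = (p == s k :> nat).
  by rewrite E /vtx; apply/eqP/eqP; lia.
have E1 (p : 'I_N) : (vtx o p == nth 0 ii k + 1) = (p == (s k).+1 :> nat).
  by rewrite E /vtx; apply/eqP/eqP; lia.
have E2 (p q : 'I_N) : (vtx o p == vtx o q) = (p == q :> nat).
  by rewrite /vtx; apply/eqP/eqP; lia.
have E3 : coeff (nth 0 ii k) (Gamma_ o m n ii k) = g k (s k) by rewrite /mult E.
have E4 : coeff (nth 0 ii k + 1) (Gamma_ o m n ii k) = g k (s k).+1.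
  by rewrite /mult E; congr (coeff _ _); lia.
have E5 (p : 'I_N) : coeff (vtx o p) (Gamma_ o m n ii k) = g k p by [].
rewrite !existsb_bool /half_matching /half_arc /has_cup /has_cap /= !E0 !E1 !E2 !E3 !E4 !E5.
case: (u.1 == k :> nat); case: (u.1 == k.+1 :> nat); case: (v.1 == k :> nat);
  case: (v.1 == k.+1 :> nat); rewrite /= ?andbF ?andbT ?orbF //=.
all: try by do ![case: (_ == _) => //=].
Qed.

Lemma t_arcsE : t_arcs o ii =2 @arcs N d s g d.
Proof.
move=> u v; apply: eq_existsb => k; rewrite ltn_ord /= /level_arc -!half_matchingE.
apply/existsP/orP => [[b /existsP[b' /and3P[h1 h2 /orP[h3|h3]]]]|].
- by left; apply/existsP; exists b; apply/existsP; exists b'; apply/and3P.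
- by right; apply/existsP; exists b'; apply/existsP; exists b; apply/and3P.
case=> /existsP[b /existsP[b' /and3P[h1 h2 h3]]].
- by exists b; apply/existsP; exists b'; rewrite h1 h2 /matching h3.
- by exists b'; apply/existsP; exists b; rewrite h1 h2 /matching h3 orbT.
Qed.

Lemma double_wt (u : vert) : (u.1 <= d)%N -> L u = wt_of t u.1 u.2.
Proof. by move=> ud; rewrite ffunE ud. Qed.

Lemma stretched_strands (u : vert) : (u.1 <= d)%N -> strands (L u) = g u.1 u.2.
Proof. by move=> ud; rewrite double_wt // mult_strands. Qed.

Lemma stretched_oriented : oriented (@arcs N d s g d) L.
Proof.
have /and3P[_ _ /forallP H] := valP t.
apply/forallP=> u; apply/forallP=> v; have /forallP/(_ v) := H u.
by rewrite t_arcsE.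
Qed.

Definition top_label : label := if (n <= m)%N then LVee else LWedge.

Lemma coeff_LambdaW p : coeff (o + 1 + p%:Z) (LambdaW o m n) =
  (p < m)%N%:Z + (p < n)%N%:Z.
Proof.
have H k : coeff (o + 1 + p%:Z) (\sum_(1 <= i < k.+1) delta (o + i%:Z)) = (p < k)%N%:Z.
  elim: k => [|k IH]; first by rewrite big_geq // coeff0.
  rewrite big_nat_recr //= coeffD IH coeff_delta.
  have -> : (o + 1 + p%:Z == o + k.+1%:Z) = (p == k) by apply/eqP/eqP; lia.
  lia.
by rewrite /LambdaW coeffD !H.
Qed.

(** If [n <= m], the first [n] vertices are crosses; they account for all [n] wedges, so the bullets
    are vees. The other case is symmetric. For [m = n] there are no bullets. *)
Lemma top_bullet (p : 'I_N) : g 0 p = 1 -> wt_of t 0 p = top_label.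
Proof.
have /andP[/and3P[_ /eqP Hm /eqP Hn] _] := wt_in_block (leq0n d).
have gE (q : 'I_N) : strands (wt_of t 0 q) = (q < m)%N%:Z + (q < n)%N%:Z.
  by rewrite -mult_strands // /mult /Gamma_ take0 big_nil subr0 coeff_LambdaW.
set la := wt_of t 0 in Hm Hn gE *; move=> gp; have {gp} : strands (la p) == 1.
  by rewrite -mult_strands // gp.
have card_lt k : (k <= N)%N -> #|[set q : 'I_N | (q < k)%N]| = k.
  by move=> kN; rewrite -sum1dep_card -(big_ord_widen _ (fun=> 1%N) kN) sum1_card card_ord.
have mnN : (maxn m n <= N)%N by rewrite /width leq_addr.
rewrite /top_label strands1P; case: leqP => nm.
  have sub : [set q : 'I_N | (q < n)%N] \subset [set q : 'I_N | has_wedge (la q)].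
    apply/subsetP=> q; rewrite !inE => qn; have := gE q; rewrite qn (leq_trans qn nm).
    by case: (la q).
  have /eqP/setP/(_ p) : [set q : 'I_N | (q < n)%N] == [set q | has_wedge (la q)].
    by rewrite eqEcard sub Hn card_lt ?leqnn //; lia.
  rewrite !inE => E /orP[/eqP-> //|/eqP lp]; move: E; rewrite lp => pn.
  by have := gE p; rewrite lp pn (leq_trans pn nm).
have sub : [set q : 'I_N | (q < m)%N] \subset [set q : 'I_N | has_vee (la q)].
  apply/subsetP=> q; rewrite !inE => qm; have := gE q; rewrite qm (ltn_trans qm nm).
  by case: (la q).
have /eqP/setP/(_ p) : [set q : 'I_N | (q < m)%N] == [set q | has_vee (la q)].
  by rewrite eqEcard sub Hm card_lt ?leqnn //; lia.
rewrite !inE => E /orP[/eqP lp|/eqP-> //]; move: E; rewrite lp => pm.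
by have := gE p; rewrite lp pm (ltn_trans pm nm).
Qed.

Lemma stretched_top (u : vert) : u.1 = 0%N :> nat -> g 0 u.2 = 1 -> L u = top_label.
Proof. by move=> u0 gu; rewrite double_wt u0 ?top_bullet. Qed.

End Stretched.


(** * Lower reduction and reversal of components *)

Lemma card_sum_bool (T : finType) (P : pred T) :
  (#|[set x | P x]|)%:Z = \sum_x (P x)%:Z.
Proof.
rewrite -sum1dep_card (big_morph Posz PoszD (erefl _)) big_mkcond /=.
by apply: eq_bigr => x _; case: (P x).
Qed.

Section Stretched.
Variables (I : pred int) (o : int) (m n : nat) (alpha : lattice) (d : nat).
Local Notation N := (width m n d).
Local Notation vert := (vertex N d).
Local Notation stretched := (stretched I o m n alpha d).
Local Notation pos := (pos o).
Local Notation mult := (mult o m n).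
Implicit Types (t : stretched) (C : pred vert).
Local Notation arcs_of t := (@arcs N d (pos (seq_of t)) (mult (seq_of t)) d).
Local Notation L_ t := (Defs.double (val t).2).

(** The lower reduction of t. The default of [insubd] is never taken, by [pairing_ltn]. *)
Definition lower_cups (ii : seq int) : cups N :=
  [ffun p : 'I_N => insubd p (pairing (pos ii) (mult ii) d p)].

Lemma lower_cupsE t (p : 'I_N) :
  lower_cups (seq_of t) p = pairing (pos (seq_of t)) (mult (seq_of t)) d p :> nat.
Proof.
rewrite ffunE val_insubd ifT //.
exact: (pairing_ltn (@stretched_levels _ _ _ _ _ _ t)).
Qed.

Lemma bottom_wtE t : bottom_wt t = wt_of t d.
Proof. by rewrite /bottom_wt /wt_of; congr (_ _); apply: ord_inj; rewrite /= inordK. Qed.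

Lemma Gamma_bottom t : Gamma_ o m n (seq_of t) d = Defs.Gamma o m n alpha.
Proof.
have /and3P[/andP[_ /eqP E] _ _] := valP t.
by rewrite /Gamma_ take_oversize ?seq_size // /Gamma E.
Qed.

Lemma bottom_in_block t : in_block o I m n (Defs.Gamma o m n alpha) (bottom_wt t).
Proof. by rewrite bottom_wtE -(Gamma_bottom t); apply: wt_in_block. Qed.

Lemma block_of_bottom t : block_of o (bottom_wt t) = Defs.Gamma o m n alpha.
Proof. by have /andP[_ /eqP] := bottom_in_block t. Qed.

Lemma bullet_bottom t (p : 'I_N) : bullet o (Defs.Gamma o m n alpha) p = (mult (seq_of t) d p == 1).
Proof. by rewrite -(Gamma_bottom t). Qed.

Lemma bottom_vertex t (p : 'I_N) (u : vert) : u.1 = d :> nat -> u.2 = p :> nat ->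
  L_ t u = bottom_wt t p.
Proof. by move=> u1 /val_inj u2; rewrite double_wt u1 // u2 bottom_wtE. Qed.

(** The rays are the ends of lines of t, which all carry [top_label]; hence no vee ray stands to the
    left of a wedge ray. *)
Lemma lower_oriented t : oriented_cup o (lower_cups (seq_of t)) (bottom_wt t).
Proof.
have lv := @stretched_levels _ _ _ _ _ _ t.
have [fK fbul nc] := pairing_noncrossing lv (leqnn d).
have [hp hf] := pairing_joined lv (stretched_oriented t) (@stretched_top _ _ _ _ _ _ t) (leqnn d).
have lE := lower_cupsE t; set a := lower_cups _ in lE *.
apply/oriented_cupP; split.
- rewrite block_of_bottom; apply/cup_diagramP; split=> [p|p|p q].
  + by apply: ord_inj; rewrite !lE fK.
  + rewrite (bullet_bottom t) => np; apply: fbul => E; case/eqP: np.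
    by apply: ord_inj; rewrite /= lE.
  + rewrite lE (bullet_bottom t) => h1 h2 h3; have [h4 h5 h6] := nc _ _ h1 h2 h3.
    by split; rewrite ?lE //; apply/eqP => E; apply: h4; rewrite -lE E.
- move=> p np; have [u [u1 u2]] := line_vertex (leqnn d) (ltn_ord p).
  have [w [w1 w2]] := line_vertex (leqnn d) (ltn_ord (a p)).
  have [||_] := hp u w u1 w1; first by rewrite w2 u2 lE.
    by move=> E; case/eqP: np; apply: ord_inj; rewrite /= -u2 E -w2.
  by rewrite (bottom_vertex t u1 u2) (bottom_vertex t w1 w2).
- have ray p : a p = p -> bottom_wt t p = LVee \/ bottom_wt t p = LWedge ->
      bottom_wt t p = top_label m n.
    move=> ap lp; have [u [u1 u2]] := line_vertex (leqnn d) (ltn_ord p).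
    rewrite -(bottom_vertex t u1 u2); apply: (hf u u1 _ _).1; last by rewrite u2 -lE ap.
    by rewrite u2 mult_strands // -bottom_wtE; case: lp => ->.
  move=> p q _ ap aq lp lq; have := ray p ap (or_introl lp).
  by rewrite -(ray q aq (or_intror lq)) lp lq.
Qed.

Lemma bottom_connect t (u v : vert) : u.1 = d :> nat -> v.1 = d :> nat ->
  connect (arcs_of t) u v -> v.2 = u.2 \/ v.2 = lower_cups (seq_of t) u.2.
Proof.
move=> u1 v1 c; case: (u =P v) => [->|ne]; [by left|right].
apply: ord_inj; rewrite /= lower_cupsE.
exact: (connected_bottom (@stretched_levels _ _ _ _ _ _ t) (stretched_oriented t)
  (@stretched_top _ _ _ _ _ _ t) (leqnn d) u1 v1 c ne).
Qed.

Lemma lower_connect t (u v : vert) : u.1 = d :> nat -> v.1 = d :> nat ->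
  v.2 = lower_cups (seq_of t) u.2 -> connect (arcs_of t) u v.
Proof.
move=> u1 v1 E; case: (u =P v) => [->|ne]; first exact: connect0.
have [hp _] := pairing_joined (@stretched_levels _ _ _ _ _ _ t) (stretched_oriented t)
  (@stretched_top _ _ _ _ _ _ t) (leqnn d).
by have [] := hp u v u1 v1 _ ne; rewrite ?E ?lower_cupsE.
Qed.

Lemma lower_not_top t (u w : vert) : u.1 = d :> nat ->
  lower_cups (seq_of t) u.2 != u.2 -> connect (arcs_of t) u w -> w.1 <> 0%N :> nat.
Proof.
move=> u1 np; apply: (paired_not_top (@stretched_levels _ _ _ _ _ _ t) (stretched_oriented t)
  (@stretched_top _ _ _ _ _ _ t) (leqnn d) u1).
by move=> E; case/eqP: np; apply: ord_inj; rewrite /= lower_cupsE.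
Qed.

Lemma lower_free_top t (u : vert) : u.1 = d :> nat -> bullet o (Defs.Gamma o m n alpha) u.2 ->
  lower_cups (seq_of t) u.2 = u.2 -> bottom_wt t u.2 = top_label m n /\
  exists w : vert, [/\ w.1 = 0%N :> nat, mult (seq_of t) 0 w.2 = 1 & connect (arcs_of t) w u].
Proof.
move=> u1; rewrite (bullet_bottom t) => /eqP gu E.
have [_ hf] := pairing_joined (@stretched_levels _ _ _ _ _ _ t) (stretched_oriented t)
  (@stretched_top _ _ _ _ _ _ t) (leqnn d).
by rewrite -(bottom_vertex t u1 (erefl _)); apply: hf => //; rewrite -lower_cupsE E.
Qed.

Lemma boundary_capsP t : reflect
  (forall p : 'I_N, (p < lower_cups (seq_of t) p)%N -> bottom_wt t p = LVee)
  (boundary_caps_anticlockwise t).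
Proof.
apply: (iffP forallP) => [H p lt|H u].
  have [u [u1 /val_inj u2]] := line_vertex (leqnn d) (ltn_ord p).
  have [v [v1 /val_inj v2]] := line_vertex (leqnn d) (ltn_ord (lower_cups (seq_of t) p)).
  have /forallP/(_ v) := H u; rewrite u1 v1 !eqxx u2 v2 lt (eq_connect (t_arcsE t)) /=.
  by rewrite (lower_connect (t := t) u1 v1) ?v2 ?u2 // => /eqP.
apply/forallP=> v; apply/implyP; rewrite (eq_connect (t_arcsE t)).
case/and4P=> /eqP u1 /eqP v1 lt c; apply/eqP/H.
by have [E|<- //] := bottom_connect u1 v1 c; rewrite E ltnn in lt.
Qed.

Lemma lower_acw t : boundary_caps_anticlockwise t ->
  n_cw (lower_cups (seq_of t)) (bottom_wt t) == 0%N.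
Proof. by move=> /boundary_capsP H; apply/n_cw0P => p /H->. Qed.

Lemma acw_lower t : n_cw (lower_cups (seq_of t)) (bottom_wt t) == 0%N ->
  boundary_caps_anticlockwise t.
Proof.
move=> /n_cw0P H; apply/boundary_capsP => p lt.
have /oriented_cupP[_ /(_ p) + _] := lower_oriented t.
have ne : lower_cups (seq_of t) p != p by apply: contraTneq lt => ->; rewrite ltnn.
by move/(_ ne); have := H p lt; case: (bottom_wt t p); case: (bottom_wt t _).
Qed.

Lemma stretched_eq t t' : seq_of t = seq_of t' ->
  (forall u : vert, (u.1 <= d)%N -> L_ t u = L_ t' u) -> t = t'.
Proof.
move=> E H; apply: val_inj; rewrite [LHS]surjective_pairing [RHS]surjective_pairing.
congr (_, _).
  by apply: val_inj; apply: inj_map E; exact: vtx_inj.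
apply/ffunP=> r; apply/ffunP=> p.
have rd : (r <= d)%N by rewrite -ltnS.
have rd2 : (r < d.+2)%N by rewrite ltnS ltnW.
have := H (inord r, p); rewrite /= inordK // => /(_ rd).
by rewrite !double_wt /= inordK // /wt_of inord_val.
Qed.

Definition flip_raw C t : d.-tuple 'I_N * {ffun 'I_d.+1 -> weight N} :=
  ((val t).1, [ffun r : 'I_d.+1 => [ffun p : 'I_N =>
     if C (inord r, p) then flip ((val t).2 r p) else (val t).2 r p]]).

(** The default [t] is not taken if [C] is a union of components avoiding the bullets of the top
    line, by [flip_raw_stretched]. *)
Definition flip_stretched C t : stretched := insubd t (flip_raw C t).

Section Flip.
Variables (t : stretched) (C : pred vert).
Hypothesis Cclosed : forall u v, arcs_of t u v -> C u = C v.
Hypothesis Ctop : forall u : vert, u.1 = 0%N :> nat ->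
  mult (seq_of t) 0 u.2 = 1 -> ~~ C u.

Lemma flip_weight_sum r : (r <= d)%N ->
  \sum_(p : 'I_N | C (inord r, p)) charge (wt_of t r p) = 0.
Proof.
move=> rd; rewrite -[RHS](balanced_line (@stretched_levels _ _ _ _ _ _ t)
  (@stretched_strands _ _ _ _ _ _ t) (stretched_oriented t) Cclosed Ctop rd).
rewrite (reindex_onto (fun p : 'I_N => (inord r, p) : vert) snd) /=; last first.
  by move=> [u1 u2] /andP[_ /eqP E] /=; congr (_, _); apply: val_inj; rewrite /= -E inord_val.
apply: eq_big => [p|p _]; first by rewrite inordK ?eqxx ?andbT // ltnS ltnW.
by rewrite double_wt /= inordK // ltnS ltnW.
Qed.

(** On each line, reversal lowers the number of vees and raises the number of wedges by the total
    charge of [C] there, which is 0. *)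
Lemma flip_raw_stretched : is_stretched I o alpha (flip_raw C t).
Proof.
have /and3P[h1 /forallP h2 _] := valP t; apply/and3P; split=> //.
  apply/forallP=> r; have /andP[/and3P[h3 /eqP h4 /eqP h5] /eqP h6] := h2 r.
  have rd : (r <= d)%N by rewrite -ltnS.
  have S0 := flip_weight_sum rd; rewrite /wt_of inord_val in S0.
  set la := (val t).2 r in h3 h4 h5 h6 S0.
  have S1 : \sum_(p : 'I_N) (if C (inord r, p) then charge (la p) else 0) = 0.
    by rewrite -big_mkcond.
  have st p : strands ((flip_raw C t).2 r p) = strands (la p).
    by rewrite /= !ffunE; case: ifP => // _; exact: strands_flip.
  apply/andP; split; last first.
    by apply/eqP/eqP/freeg_eqP => i; rewrite -h6 /block_of !coeff_sum; apply: eq_bigr => p _;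
       rewrite !coeffMn; congr (_ *+ _); have := st p; rewrite /strands; lia.
  apply/and3P; split.
  - apply/forallP=> p; have /implyP := forallP h3 p.
    by rewrite !ffunE; case: ifP => // _ H; apply/implyP => ne; apply: H; move: ne; case: (la p).
  - apply/eqP; have : (#|[set p : 'I_N | has_vee ((flip_raw C t).2 r p)]|)%:Z = m%:Z; last by case.
    rewrite -[in RHS]h4 !card_sum_bool -[RHS]subr0 -[X in _ = _ - X]S1 -sumrB.
    by apply: eq_bigr => p _; rewrite !ffunE; case: ifP => _; rewrite ?subr0 // -/la; case: (la p).
  - apply/eqP; have : (#|[set p : 'I_N | has_wedge ((flip_raw C t).2 r p)]|)%:Z = n%:Z; last by case.
    rewrite -[in RHS]h5 !card_sum_bool -[RHS]addr0 -[X in _ = _ + X]S1 -big_split /=.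
    by apply: eq_bigr => p _; rewrite !ffunE; case: ifP => _; rewrite ?addr0 // -/la; case: (la p).
have LE (u : vert) : (u.1 <= d)%N -> Defs.double (flip_raw C t).2 u = flip_on C (L_ t) u.
  move=> ud; rewrite !ffunE ud /=.
  have e : (inord u.1 : 'I_d.+1) = u.1 :> nat by rewrite inordK.
  by rewrite ?ffunE e inord_val -surjective_pairing.
apply/forallP=> u; apply/forallP=> v; apply/implyP => a.
have /forallP/(_ u)/forallP/(_ v)/implyP := flip_on_oriented Cclosed (stretched_oriented t).
move: (a); rewrite t_arcsE => a'; move/(_ a').
have [_ ud _] := arcs_bullet (@stretched_levels _ _ _ _ _ _ t) a'.
have [_ vd _] : [/\ (v.1 <= d)%N, (v.1 <= d)%N & mult (seq_of t) v.1 v.2 = 1].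
  by apply: (arcs_bullet (@stretched_levels _ _ _ _ _ _ t) (v := u)); rewrite arcs_sym.
by rewrite !LE.
Qed.

Lemma flip_stretched_seq : seq_of (flip_stretched C t) = seq_of t.
Proof. by rewrite /seq_of /flip_stretched val_insubd flip_raw_stretched. Qed.

Lemma flip_stretched_label (u : vert) : (u.1 <= d)%N ->
  L_ (flip_stretched C t) u = flip_on C (L_ t) u.
Proof.
move=> ud; rewrite /flip_stretched val_insubd flip_raw_stretched !ffunE ud.
have e : (inord u.1 : 'I_d.+1) = u.1 :> nat by rewrite inordK.
by rewrite ?ffunE e inord_val -surjective_pairing.
Qed.

End Flip.
End Stretched.


Lemma flip_onE N d (C : pred (vertex N d)) L u :
  flip_on C L u = if C u then flip (L u) else L u.
Proof. by rewrite ffunE. Qed.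

(** * Degree and the reversal involution *)

Section Stretched.
Variables (I : pred int) (o : int) (m n : nat) (alpha : lattice) (d : nat).
Local Notation N := (width m n d).
Local Notation vert := (vertex N d).
Local Notation stretched := (stretched I o m n alpha d).
Local Notation pos := (pos o).
Local Notation mult := (mult o m n).
Implicit Types (t : stretched) (C : pred vert).
Local Notation arcs_of t := (@arcs N d (pos (seq_of t)) (mult (seq_of t)) d).
Local Notation L_ t := (Defs.double (val t).2).

Lemma label_at_label_of t k p : (k <= d)%N -> (p < N)%N ->
  label_at o (wt_of t k) (o + 1 + p%:Z) = label_of (L_ t) k p.
Proof.
move=> kd pN; have [u [u1 u2]] := line_vertex kd pN.
rewrite -u1 -u2 label_of_vertex double_wt ?u1 //.
exact: label_at_vtx.
Qed.

Lemma stretched_degreeE t : stretched_degree t =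
  \sum_(0 <= j < d) level_degree (pos (seq_of t)) (mult (seq_of t)) (L_ t) j.
Proof.
rewrite /stretched_degree /cw_caps /acw_cups !card_sum_bool -sumrB big_mkord.
apply: eq_bigr => k _; have [E sN] := seq_pos t (ltn_ord k).
have E3 : coeff (nth 0 (seq_of t) k) (Gamma_ o m n (seq_of t) k) = mult (seq_of t) k (pos (seq_of t) k).
  by rewrite /mult E.
have E4 : coeff (nth 0 (seq_of t) k + 1) (Gamma_ o m n (seq_of t) k) =
    mult (seq_of t) k (pos (seq_of t) k).+1.
  by rewrite /mult E; congr (coeff _ _); lia.
rewrite /level_degree /cap_with /cup_with /has_cap /has_cup E3 E4 E.
by rewrite !label_at_label_of // ltnW.
Qed.

Lemma stretched_label_bullet t k p : (k <= d)%N -> mult (seq_of t) k p = 1 ->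
  (label_of (L_ t) k p == LVee) || (label_of (L_ t) k p == LWedge).
Proof.
move=> kd gp; case: (ltnP p N) => [pN|Np]; last by rewrite mult_out in gp.
have [u [u1 u2]] := line_vertex kd pN.
by rewrite -u1 -u2 label_of_vertex -strands1P stretched_strands u1 ?u2 ?gp.
Qed.

Lemma t_cupsE t : (t_cups t)%:Z = (cw_cups t)%:Z + (acw_cups t)%:Z.
Proof.
rewrite /t_cups /cw_cups /acw_cups !card_sum_bool -big_split /=.
apply: eq_bigr => k _; have [E sN] := seq_pos t (ltn_ord k).
rewrite /cup_with; case hc: (has_cup _ _) => //=; have /andP[/eqP h1 _] := hc.
have gk : mult (seq_of t) k (pos (seq_of t) k) = 1 by rewrite /mult -E.
have := stretched_label_bullet (ltnW (ltn_ord k)) gk.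
rewrite E label_at_label_of // ?(ltnW (ltn_ord k)) //.
by case: (label_of _ _ _).
Qed.

(** The clockwise cups of t are counted once with each sign. *)
Lemma T_degree_acw (x : T_basis I o m n alpha d) :
  n_cw (val x).1 (bottom_wt (val x).2) == 0%N ->
  T_degree x = stretched_degree (val x).2.
Proof.
rewrite /T_degree; case: (val x) => a t /= /eqP->.
by rewrite /stretched_degree; have := t_cupsE t; lia.
Qed.

Definition reverse t : stretched :=
  flip_stretched (@reversed N d (pos (seq_of t)) (mult (seq_of t))) t.

Lemma reversed_flippable t (R := @reversed N d (pos (seq_of t)) (mult (seq_of t))) :
  (forall u v, arcs_of t u v -> R u = R v) /\
  (forall u : vert, u.1 = 0%N :> nat -> mult (seq_of t) 0 u.2 = 1 -> ~~ R u).
Proof.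
split=> [u v|u u0 gu]; first exact: reversed_closed.
by apply: reversed_end; rewrite ?u0; auto.
Qed.

Lemma reverse_seq t : seq_of (reverse t) = seq_of t.
Proof. by have [h1 h2] := reversed_flippable t; apply: flip_stretched_seq. Qed.

Lemma reverse_label t (u : vert) : (u.1 <= d)%N ->
  L_ (reverse t) u = flip_on (@reversed N d (pos (seq_of t)) (mult (seq_of t))) (L_ t) u.
Proof. by move=> ud; have [h1 h2] := reversed_flippable t; apply: flip_stretched_label. Qed.

Lemma reverseK : involutive reverse.
Proof.
move=> t; apply: stretched_eq => [|u ud]; first by rewrite !reverse_seq.
rewrite reverse_label // reverse_seq flip_onE reverse_label // flip_onE.
by case: (reversed _ _ u); rewrite ?flipK.
Qed.

(** The vertices reversed on the bottom line are no bullets, so [flip] fixes their labels. *)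
Lemma reverse_bottom t : bottom_wt (reverse t) = bottom_wt t.
Proof.
apply/ffunP=> p; have [u [u1 u2]] := line_vertex (leqnn d) (ltn_ord p).
rewrite -!(bottom_vertex _ u1 u2) reverse_label ?u1 // flip_onE; case: ifP => // Ru.
have ng : mult (seq_of t) u.1 u.2 <> 1 by move=> gu; move: Ru; apply/negP; apply: reversed_end => //; right.
move: ng; rewrite -stretched_strands ?u1 // => /eqP.
by case: (L_ t u).
Qed.

Lemma reverse_acw t :
  boundary_caps_anticlockwise (reverse t) = boundary_caps_anticlockwise t.
Proof.
by apply/boundary_capsP/boundary_capsP; rewrite reverse_seq reverse_bottom.
Qed.

Lemma acw_cw_pairs t : boundary_caps_anticlockwise t ->
  cw_pairs (pos (seq_of t)) (mult (seq_of t)) (L_ t) d = 0.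
Proof.
move=> /boundary_capsP H; rewrite /cw_pairs big_nat big1 // => p /andP[_ pN].
case: ltnP => //= lt; have := H (Ordinal pN); rewrite lower_cupsE => /(_ lt) E.
have [u [u1 u2]] := line_vertex (leqnn d) pN.
have := label_of_vertex (L_ t) u; rewrite (bottom_vertex (p := Ordinal pN) t u1 u2) u1 u2 E.
by move=> ->.
Qed.

Lemma reverse_degree t : boundary_caps_anticlockwise t ->
  stretched_degree (reverse t) = - stretched_degree t.
Proof.
move=> acw; rewrite !stretched_degreeE reverse_seq.
rewrite -(reversed_degree (@stretched_levels _ _ _ _ _ _ t) (@stretched_strands _ _ _ _ _ _ t)
  (stretched_oriented t) (@stretched_top _ _ _ _ _ _ t) (acw_cw_pairs acw)).
apply: eq_big_nat => k /andP[_ kd].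
have lab r p : (r <= d)%N -> label_of (L_ (reverse t)) r p =
    label_of (flip_on (@reversed N d (pos (seq_of t)) (mult (seq_of t))) (L_ t)) r p.
  move=> rd; rewrite /label_of; case: pickP => // u /andP[/eqP u1 _].
  by rewrite reverse_label // u1.
by rewrite /level_degree !lab // ltnW.
Qed.

Lemma reverse_count ii (la : weight N) (j : int) :
  #|[set t : stretched | [&& seq_of t == ii, stretched_degree t == j,
       bottom_wt t == la & boundary_caps_anticlockwise t]]| =
  #|[set t : stretched | [&& seq_of t == ii, stretched_degree t == - j,
       bottom_wt t == la & boundary_caps_anticlockwise t]]|.
Proof.
rewrite -(card_imset _ (inv_inj reverseK)); apply: eq_card => t.
rewrite inE; apply/imsetP/idP => [[t' + ->]|/and4P[h1 /eqP h2 h3 h4]].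
  rewrite inE => /and4P[h1 /eqP h2 h3 h4].
  by rewrite reverse_seq reverse_bottom reverse_acw reverse_degree // h1 h2 h3 h4 eqxx.
exists (reverse t); last by rewrite reverseK.
by rewrite inE reverse_seq reverse_bottom reverse_acw reverse_degree // h1 h2 h3 h4 opprK eqxx.
Qed.

End Stretched.

(** * The product diagram *)


Lemma charge_left_sum N d (L : labelling N d) C r p :
  charge_left L C r p = \sum_(q : 'I_N | (q < p)%N) charge_at L C r q.
Proof.
rewrite /charge_left (partition_big (fun v : vertex N d => v.2) (fun q : 'I_N => (q < p)%N)) /=; last first.
  by move=> v /and3P[].
apply: eq_bigr => q qp; apply: eq_bigl => v; rewrite -andbA; congr (_ && _).
rewrite -andbA; congr (_ && _); apply/andP/eqP => [[_ /eqP->] //|E].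
by rewrite E qp; split=> //; apply/eqP/ord_inj.
Qed.

Lemma sum_antisym (T : finType) (P : pred T) (c : T -> T) (f : T -> int) :
  involutive c -> (forall x, P x -> P (c x)) ->
  (forall x, P x -> f (c x) = - f x) -> \sum_(x | P x) f x = 0.
Proof.
move=> cK Pc fc; set S := \sum_(x | P x) f x.
suff : S = - S by lia.
rewrite {1}/S (reindex_inj (inv_inj cK)) /= -sumrN; apply: eq_big => x.
  by apply/idP/idP => /Pc; rewrite ?cK.
by move=> Px; apply: fc; have := Pc _ Px; rewrite cK.
Qed.

Section Product.
Variables (I : pred int) (o : int) (m n : nat) (alpha : lattice) (d : nat).
Local Notation N := (width m n d).
Local Notation vert := (vertex N d).
Local Notation stretched := (stretched I o m n alpha d).
Variable t : stretched.
Local Notation ii := (seq_of t).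
Local Notation s := (pos o ii).
Local Notation g := (mult o m n ii).
Local Notation G := (Defs.Gamma o m n alpha).
Variables a c : cups N.
Hypothesis acup : is_cup_diagram o G a.
Hypothesis ccup : is_cup_diagram o G c.
Local Notation E := (product_arcs o alpha ii a c).
Local Notation T := (@arcs N d s g d).

Let aK p : a (a p) = p. Proof. by have /cup_diagramP[] := acup. Qed.
Let cK p : c (c p) = p. Proof. by have /cup_diagramP[] := ccup. Qed.

Variant product_arc_spec (u v : vert) : Prop :=
  | StretchedArc of T u v
  | LowerCup of u.1 = d.+1 :> nat & v.1 = d.+1 :> nat & u.2 <> v.2 & a u.2 = v.2
  | MiddleArc of (u.1 = d :> nat \/ u.1 = d.+1 :> nat) & u.1 = v.1 & u.2 <> v.2 & c u.2 = v.2
  | MiddleSegment of u.1 = d :> nat & v.1 = d.+1 :> nat & u.2 = v.2 & c u.2 = u.2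
      & g d u.2 = 1
  | MiddleSegment' of u.1 = d.+1 :> nat & v.1 = d :> nat & u.2 = v.2 & c u.2 = u.2
      & g d u.2 = 1.

Lemma product_arcP u v : reflect (product_arc_spec u v) (E u v).
Proof.
rewrite /product_arcs t_arcsE (bullet_bottom t).
apply: (iffP idP) => [/or4P[h|/and4P[/eqP h1 /eqP h2 /eqP h3 /eqP h4]|/and4P[h1 /eqP h2 /eqP h3 /eqP h4]|]|].
- exact: StretchedArc.
- exact: LowerCup.
- by apply: MiddleArc => //; case/orP: h1 => /eqP; auto.
- case/and5P=> h1 h2 /eqP h3 /eqP h4 /andP[/eqP h5 /eqP h6].
  case/orP: h1 => /eqP h1; case/orP: h2 => /eqP h2.
  + by case: h3; apply: ord_inj; rewrite h1 h2.
  + exact: MiddleSegment.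
  + exact: MiddleSegment'.
  + by case: h3; apply: ord_inj; rewrite h1 h2.
- case=> [->//|h1 h2 /eqP h3 h4|h1 h2 /eqP h3 h4|h1 h2 h3 h4 h5|h1 h2 h3 h4 h5].
  + by apply/or4P/Or42; rewrite h1 h2 h3 h4 !eqxx.
  + by apply/or4P/Or43; rewrite -h2 h3 h4 !eqxx !andbT; case: h1 => ->; rewrite eqxx ?orbT.
  + apply/or4P/Or44; rewrite h1 h2 !eqxx ?orbT /= -h3 h4 h5 !eqxx !andbT.
    by apply/eqP => e; rewrite e h2 in h1; lia.
  + apply/or4P/Or44; rewrite h1 h2 !eqxx ?orbT /= -h3 h4 h5 !eqxx !andbT.
    by apply/eqP => e; rewrite e h2 in h1; lia.
Qed.

Lemma product_arcs_sym : symmetric E.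
Proof.
suff H u v : E u v -> E v u by move=> u v; apply/idP/idP; apply: H.
case/product_arcP=> [h|h1 h2 h3 h4|h1 h2 h3 h4|h1 h2 h3 h4 h5|h1 h2 h3 h4 h5]; apply/product_arcP.
- by apply: StretchedArc; rewrite arcs_sym.
- by apply: LowerCup => //; [exact: nesym|rewrite -h4 aK].
- by apply: MiddleArc; [rewrite -h2| |exact: nesym|rewrite -h4 cK].
- by apply: MiddleSegment' => //; rewrite -h3.
- by apply: MiddleSegment => //; rewrite -h3.
Qed.

Lemma product_connect_sym : connect_sym E.
Proof. exact/sym_connect_sym/product_arcs_sym. Qed.

Lemma stretched_sub u v : connect T u v -> connect E u v.
Proof.
apply: connect_sub => x y h; apply: connect1; apply/product_arcP; exact: StretchedArc.
Qed.

(** Lines [d] and [d.+1] have the same block, hence the minimum. *)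
Definition line_mult (u : vert) : int := g (minn u.1 d) u.2.

Lemma product_arc_bullet u v : E u v -> line_mult u = 1.
Proof.
have lv := @stretched_levels _ _ _ _ _ _ t.
have bul (x : cups N) p : is_cup_diagram o G x -> x p <> p -> g d p = 1.
  by move=> /cup_diagramP[_ H _] /eqP/H; rewrite (bullet_bottom t) => /eqP.
rewrite /line_mult.
case/product_arcP=> [h|h1 h2 h3 h4|h1 h2 h3 h4|h1 h2 h3 h4 h5|h1 h2 h3 h4 h5].
- by have [_ ud gu] := arcs_bullet lv h; rewrite (minn_idPl ud).
- by rewrite h1 (minn_idPr (leqnSn d)); apply: bul acup _; rewrite h4; exact: nesym.
- have -> : minn u.1 d = d by case: h1 => ->; rewrite ?minnn // (minn_idPr (leqnSn d)).
  by apply: bul ccup _; rewrite h4; exact: nesym.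
- by rewrite h1 minnn.
- by rewrite h1 (minn_idPr (leqnSn d)).
Qed.

Lemma product_connect_bullet u v : connect E u v -> line_mult u = 1 -> line_mult v = 1.
Proof.
move=> cn gu; case: (u =P v) => [<- //|ne].
move: cn; rewrite product_connect_sym => /connectP[[|w p]] /=; first by move=> _ /ne.
by case/andP=> /product_arc_bullet.
Qed.

Variable L : labelling N d.
Hypothesis Lg : forall u : vert, strands (L u) = line_mult u.
Hypothesis Lor : oriented E L.

Let Lg' (u : vert) : (u.1 <= d)%N -> strands (L u) = g u.1 u.2.
Proof. by move=> ud; rewrite Lg /line_mult (minn_idPl ud). Qed.

Lemma product_opposite (u v : vert) : E u v -> u.1 = v.1 -> opposite (L u) (L v).
Proof. by move=> e h; have /forallP/(_ u)/forallP/(_ v) := Lor; rewrite e h eqxx. Qed.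

Lemma product_same (u v : vert) : E u v -> u.1 <> v.1 -> L u = L v.
Proof.
by move=> e /eqP h; have /forallP/(_ u)/forallP/(_ v) := Lor; rewrite e (negPf h) => /eqP.
Qed.

Lemma stretched_part_oriented : oriented T L.
Proof.
apply/forallP=> u; apply/forallP=> v; apply/implyP=> h.
have /forallP/(_ u)/forallP/(_ v)/implyP := Lor; apply.
exact/product_arcP/StretchedArc.
Qed.

Section Closed.
Variable C : pred vert.
Hypothesis Cclosed : forall u v, E u v -> C u = C v.
Local Notation at_ := (charge_at L C).
Local Notation left_ := (charge_left L C).

Let CclosedT u v : T u v -> C u = C v.
Proof. by move=> h; apply: Cclosed; apply/product_arcP; exact: StretchedArc. Qed.

Lemma product_charge_nonbullet (u : vert) : line_mult u <> 1 -> at_ u.1 u.2 = 0.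
Proof.
move=> h; rewrite charge_at_vertex; case: ifP => // _; apply: strands1_charge.
by rewrite Lg; apply/eqP.
Qed.

Lemma product_charge_segment (u v : vert) : E u v -> u.1 <> v.1 ->
  at_ u.1 u.2 = at_ v.1 v.2.
Proof. by move=> e h; rewrite !charge_at_vertex (Cclosed e) (product_same e h). Qed.

Lemma product_charge_cup (u v : vert) : E u v -> u.1 = v.1 ->
  at_ v.1 v.2 = - at_ u.1 u.2.
Proof.
move=> e h; rewrite !charge_at_vertex (Cclosed e) (opposite_flip (product_opposite e h)).
by case: (C v) => //; case: (L u).
Qed.

(* The charges under a cup cancel in pairs. *)
Lemma cup_charge_left (x : cups N) (r : 'I_d.+2) (p : 'I_N) :
  is_cup_diagram o G x -> (d <= r)%N ->
  (forall q : 'I_N, x q <> q -> E (r, q) (r, x q)) -> (p < x p)%N ->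
  left_ r (x p) = left_ r p + at_ r p.
Proof.
move=> /cup_diagramP[xK xb xnc] dr xE lt; rewrite -charge_leftS !charge_left_sum.
rewrite (bigID (fun q : 'I_N => (q < p.+1)%N)) /= [X in _ + X](_ : _ = 0) ?addr0.
  by apply: eq_bigl => q; lia.
apply: (sum_antisym xK) => [q /andP[h1 h2]|q /andP[h1 h2]].
  case: (x q =P q) => [->|/eqP nq]; first by rewrite h1 h2.
  have pq : (p < q)%N by lia.
  have [_ h3 h4] := xnc p q pq h1 (xb _ nq).
  by rewrite h4; lia.
case: (x q =P q) => [E1|nq]; last exact: product_charge_cup (xE q nq) _.
have h : at_ r q = 0.
  apply: (@product_charge_nonbullet (r, q)); rewrite /line_mult /= (minn_idPr dr) => gq.
  have bq : bullet o G q by rewrite (bullet_bottom t) gq.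
  have pq : (p < q)%N by lia.
  by have [/eqP] := xnc p q pq h1 bq.
by rewrite E1 h oppr0.
Qed.

(* Below and above the middle segment at [p], the charges to its left agree:
   the cups of [c] to its left cancel, the other vertices are joined by
   segments. *)
Lemma middle_charge_left (r r' : 'I_d.+2) (p : 'I_N) :
  r = d :> nat -> r' = d.+1 :> nat -> c p = p -> g d p = 1 ->
  left_ r p = left_ r' p.
Proof.
move=> rd rd' cp gp; have /cup_diagramP[_ cb cnc] := ccup.
apply/eqP; rewrite -subr_eq0 !charge_left_sum -sumrB; apply/eqP.
have mid (x : 'I_d.+2) q : (x = d :> nat \/ x = d.+1 :> nat) -> c q <> q -> E (x, q) (x, c q).
  by move=> hx nq; apply/product_arcP; apply: MiddleArc => //; exact: nesym.
apply: (sum_antisym cK) => [q h1|q h1].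
  case: (c q =P q) => [-> //|/eqP nq]; rewrite ltnNge leq_eqVlt; apply/negP.
  case/orP=> [/eqP/ord_inj e|lt]; first by move: h1; rewrite -(cK q) -e cp ltnn.
  have bp : bullet o G p by rewrite (bullet_bottom t) gp.
  by have [/eqP] := cnc q p h1 lt bp.
case: (c q =P q) => [E1|nq]; last first.
  rewrite (product_charge_cup (mid r q (or_introl rd) nq) erefl).
  by rewrite (product_charge_cup (mid r' q (or_intror rd') nq) erefl) opprB addrC opprK.
rewrite E1; suff -> : at_ r q = at_ r' q by rewrite subrr oppr0.
case: (g d q =P 1) => [gq|gq].
  apply: (@product_charge_segment (r, q) (r', q)); last by move=> /= e; rewrite e rd' in rd; lia.
  by apply/product_arcP; exact: MiddleSegment.
have nb (x : 'I_d.+2) : (d <= x)%N -> at_ x q = 0.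
  by move=> dx; apply: (@product_charge_nonbullet (x, q)); rewrite /line_mult /= (minn_idPr dx).
by rewrite !nb ?rd ?rd'.
Qed.

Lemma product_left_segment (u v : vert) : E u v -> u.1 <> v.1 ->
  left_ u.1 u.2 = left_ v.1 v.2.
Proof.
case/product_arcP=> [h ne|h1 h2 _ _|h1 h2|h1 h2 h3 h4 h5 _|h1 h2 h3 h4 h5 _].
- apply: (arcs_left_segment (@stretched_levels _ _ _ _ _ _ t) Lg' stretched_part_oriented CclosedT h).
  by move=> e; apply: ne; exact: ord_inj.
- by case; apply: ord_inj; rewrite h1 h2.
- by [].
- by rewrite -h3; apply: middle_charge_left.
- by rewrite h3; symmetry; apply: middle_charge_left; rewrite -?h3.
Qed.

Lemma product_left_cup (u v : vert) : E u v -> u.1 = v.1 -> (u.2 < v.2)%N ->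
  left_ v.1 v.2 = left_ u.1 u.2 + at_ u.1 u.2.
Proof.
case/product_arcP=> [h e lt|h1 h2 _ h4 e lt|h1 e _ h4 _ lt|h1 h2 h3|h1 h2 h3].
- by apply: (arcs_left_cup stretched_part_oriented C h); rewrite ?e.
- rewrite -e -h4; apply: (cup_charge_left acup); rewrite ?h1 ?h4 //.
  move=> q nq; apply/product_arcP; apply: LowerCup => //; exact: nesym.
- rewrite -e -h4; apply: (cup_charge_left ccup); rewrite ?h4 //.
    by case: h1 => ->.
  by move=> q nq; apply/product_arcP; apply: MiddleArc => //; exact: nesym.
- by rewrite h3 ltnn.
- by rewrite h3 ltnn.
Qed.

(* The winding number of [C] on the right-hand side of an oriented strand
   (downwards for a vee, upwards for a wedge) does not change along it. *)
Definition right_winding (u : vert) : int :=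
  left_ u.1 u.2 - (C u && (L u == LWedge))%:Z.

Lemma right_winding_arc u v : E u v -> right_winding u = right_winding v.
Proof.
rewrite /right_winding => e; have eC := Cclosed e.
have cup (x y : vert) : E x y -> x.1 = y.1 -> (x.2 < y.2)%N ->
    left_ x.1 x.2 - (C x && (L x == LWedge))%:Z = left_ y.1 y.2 - (C y && (L y == LWedge))%:Z.
  move=> exy h lt; rewrite (product_left_cup exy h lt) charge_at_vertex (Cclosed exy).
  have := product_opposite exy h; case: (C y) => /=; last by rewrite !subr0 ?addr0.
  by case: (L x); case: (L y) => //= _; lia.
case: (u.1 =P v.1) => [h|h].
  case: (ltngtP u.2 v.2) => [lt|lt|/ord_inj E2]; first exact: cup.
    by symmetry; apply: cup => //; rewrite product_arcs_sym.
  by rewrite [u]surjective_pairing [v]surjective_pairing h E2.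
by rewrite (product_left_segment e h) eC (product_same e h).
Qed.

Lemma right_winding_connect u v : connect E u v -> right_winding u = right_winding v.
Proof.
case/connectP=> p + ->; elim: p u => //= w p IH u /andP[/right_winding_arc-> ].
exact: IH.
Qed.

End Closed.

(** Leftmost in its component among the vertices of its own line. This is weaker than [leftmost] and
    can be checked on line [d] or [d.+1] alone. *)
Definition line_leftmost (u : vert) : Prop :=
  forall v : vert, connect E u v -> v.1 = u.1 -> (u.2 <= v.2)%N.

(** Take for [C] the component of [u]. No charge lies to the left of [u] or [v] on their lines, so
    [right_winding] is -1 there for a wedge and 0 otherwise; it is constant along the component. *)
Lemma leftmost_label u v : connect E u v -> line_leftmost u -> line_leftmost v ->
  (L u == LWedge) = (L v == LWedge).
Proof.
move=> cuv lu lv; pose C := connect E u.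
have Cc x y : E x y -> C x = C y.
  by move=> e; apply: (same_connect_r product_connect_sym); exact: connect1.
have := right_winding_connect Cc cuv; rewrite /right_winding.
have left0 w : C w -> line_leftmost w -> charge_left L C w.1 w.2 = 0.
  move=> Cw lw; rewrite /charge_left big_pred0 // => x; apply/negbTE/negP=> /and3P[Cx /eqP xw lt].
  have cwx : connect E w x by apply: connect_trans Cx; rewrite product_connect_sym.
  by have := lw x cwx (ord_inj xw); rewrite leqNgt lt.
rewrite !left0 // /C ?connect0 // cuv /=.
by case: (L u == _); case: (L v == _).
Qed.

End Product.


(** * Comparison of two orientations of a component *)

Section Orientations.
Variables (N d : nat) (E : rel (vertex N d)).
Implicit Types (L K : labelling N d) (u v : vertex N d).

Lemma oriented_edge L u v : oriented E L -> E u v ->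
  if u.1 == v.1 then L v = flip (L u) else L v = L u.
Proof.
move=> /forallP/(_ u)/forallP/(_ v) + e; rewrite e /=.
by case: ifP => _; [exact: opposite_flip|move/eqP].
Qed.

Lemma connect_ind (P : vertex N d -> Prop) u v :
  (forall x y, P x -> E x y -> P y) -> P u -> connect E u v -> P v.
Proof.
move=> Pe + /connectP[p + ->]; elim: p u => //= w p IH u Pu /andP[e pp].
exact: IH (Pe _ _ Pu e) pp.
Qed.

Lemma orientations_agree L K u v : oriented E L -> oriented E K ->
  connect E u v -> K u = L u -> K v = L v.
Proof.
move=> oL oK cuv h; apply: (connect_ind (P := fun x => K x = L x)) cuv => // x y hx e.
by have := oriented_edge oL e; have := oriented_edge oK e; case: ifP => _ -> ->; rewrite hx.
Qed.

Lemma orientations_opposite L K u v : oriented E L -> oriented E K ->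
  connect E u v -> K u = flip (L u) -> K v = flip (L v).
Proof.
move=> oL oK cuv h; apply: (connect_ind (P := fun x => K x = flip (L x))) cuv => // x y hx e.
by have := oriented_edge oL e; have := oriented_edge oK e; case: ifP => _ -> ->; rewrite hx.
Qed.

(* If [L] takes opposite values on a component, the path between them contains
   a cup or a cap, where any orientation has labels vee and wedge. *)
Lemma oriented_strands L K u v : oriented E L -> oriented E K ->
  connect E u v -> opposite (L u) (L v) -> strands (K u) = 1.
Proof.
move=> oL oK cuv op; apply/eqP/negPn/negP => nK.
suff [_ e] : K v = K u /\ L v = L u by rewrite e in op; case: (L u) op.
apply: (connect_ind (P := fun x => K x = K u /\ L x = L u)) cuv => // x y [h1 h2] e.
have /forallP/(_ x)/forallP/(_ y) := oK; rewrite e /=.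
have := oriented_edge oL e; case: ifP => _; last by move=> -> /eqP <-.
by rewrite h1; move: nK; case: (K u) => //; case: (K y).
Qed.

Lemma strands1_eq (k l : label) : strands k = 1 -> strands l = 1 -> k = l \/ k = flip l.
Proof. by case: k => //; case: l => //; auto. Qed.

End Orientations.

Section Product.
Variables (I : pred int) (o : int) (m n : nat) (alpha : lattice) (d : nat).
Local Notation N := (width m n d).
Local Notation vert := (vertex N d).
Local Notation stretched := (stretched I o m n alpha d).
Variable t : stretched.
Local Notation ii := (seq_of t).
Local Notation s := (pos o ii).
Local Notation g := (mult o m n ii).
Local Notation G := (Defs.Gamma o m n alpha).
Variables a c : cups N.
Hypothesis acup : is_cup_diagram o G a.
Hypothesis ccup : is_cup_diagram o G c.
Local Notation E := (product_arcs o alpha ii a c).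
Variable L : labelling N d.
Hypothesis Lg : forall u : vert, strands (L u) = line_mult t u.
Hypothesis Lor : oriented E L.
Variables (ray : pred vert) (x : vert).
Hypothesis xb : line_mult t x = 1.

Let csym : connect_sym E. Proof. exact: (product_connect_sym t acup ccup). Qed.

Lemma leftmost_exists : exists2 w, connect E x w & leftmost E w.
Proof.
have [w cw min] := arg_minnP (fun w : vert => (w.2 : nat)) (connect0 E x).
exists w => //; apply/forallP=> v; apply/implyP=> cv; apply: min.
exact: connect_trans cw cv.
Qed.

Lemma leftmost_line w : leftmost E w -> line_leftmost t a c w.
Proof. by move=> /forallP lw v cv _; apply: (implyP (lw v)). Qed.

(** [L] serves as a reference orientation. The parameter [flipped] also covers the opposite
    orientation, so that an orientation can be recognised by the type of its circle. *)
Lemma circle_type (w : vert) (K : labelling N d) (flipped : bool) :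
  connect E x w -> line_leftmost t a c w ->
  (forall v, connect E x v -> ~~ ray v) ->
  (forall v, connect E x v -> K v = if flipped then flip (L v) else L v) ->
  component_type E ray K x =
    if (L w == LWedge) (+) flipped then CwCircle else AntiCircle.
Proof.
move=> cw lw nray KE; rewrite /component_type ifF; last first.
  by apply/negbTE/negP=> /existsP[v /andP[cv]]; rewrite (negPf (nray v cv)).
have same v : connect E x v -> leftmost E v -> (L v == LWedge) = (L w == LWedge).
  move=> cv lv; apply: (leftmost_label acup ccup Lg Lor) => //; last exact: leftmost_line.
  by apply: connect_trans cw; rewrite csym.
have bul v : connect E x v -> (L v == LVee) || (L v == LWedge).
  by move=> cv; rewrite -strands1P Lg (product_connect_bullet acup ccup cv).
have KV v : connect E x v -> leftmost E v ->
    (K v == LVee) = ~~ ((L w == LWedge) (+) flipped).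
  move=> cv lv; rewrite -(same v cv lv) KE //.
  by have := bul v cv; case: (L v) => //; case: (flipped).
case: ifP => h.
  have [v cv lv] := leftmost_exists.
  by have /forallP/(_ v) := h; rewrite cv lv /= KV // => /negbTE->.
case: ifP => // /negbT h'; case/negP: (negbT h); apply/forallP=> v.
by apply/implyP=> /andP[cv lv]; rewrite KV.
Qed.

End Product.

(** * Surgery *)


Section Surgery.
Variables (I : pred int) (o : int) (m n : nat) (alpha : lattice) (d : nat).
Local Notation N := (width m n d).
Local Notation vert := (vertex N d).
Local Notation stretched := (stretched I o m n alpha d).
Variable t : stretched.
Local Notation ii := (seq_of t).
Local Notation s := (pos o ii).
Local Notation g := (mult o m n ii).
Local Notation G := (Defs.Gamma o m n alpha).
Local Notation T := (@arcs N d s g d).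
Local Notation b := (@lower_cups o m n d ii).
Local Notation nu := (bottom_wt t).
Local Notation L := (Defs.double (val t).2).

Definition upper_pt (p : 'I_N) : vert := (inord d, p).
Definition lower_pt (p : 'I_N) : vert := (inord d.+1, p).

Lemma upper_pt1 p : (upper_pt p).1 = d :> nat. Proof. by rewrite /= inordK. Qed.
Lemma lower_pt1 p : (lower_pt p).1 = d.+1 :> nat. Proof. by rewrite /= inordK. Qed.

Lemma upper_ptP (u : vert) : u.1 = d :> nat -> u = upper_pt u.2.
Proof. by move=> h; apply: vertex_eq; rewrite ?upper_pt1. Qed.
Lemma lower_ptP (u : vert) : u.1 = d.+1 :> nat -> u = lower_pt u.2.
Proof. by move=> h; apply: vertex_eq; rewrite ?lower_pt1. Qed.

Definition subdiagram (c c' : cups N) : bool := [forall q : 'I_N, (c q != q) ==> (c q == c' q)].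

Lemma subdiagramP (c c' : cups N) : reflect (forall q : 'I_N, c q != q -> c q = c' q) (subdiagram c c').
Proof. by apply: (iffP forallP) => h q; [move=> nq; apply/eqP/(implyP (h q))|apply/implyP=> /h->]. Qed.

Let bK : forall p : 'I_N, b (b p) = p.
Proof. by have /oriented_cupP[/cup_diagramP[]] := lower_oriented t. Qed.

(** The clockwise boundary components of t whose cap is still in [c]. *)
Definition cw_part (c : cups N) : pred vert := fun u =>
  [exists q : 'I_N, [&& (q < c q)%N, nu q == LWedge & connect T (upper_pt q) u]].

(** The labelling reached when the caps of [c] remain to be cut: boundary components of t at these
    caps are anti-clockwise, all others are oriented as in t. *)
Definition intermediate (c : cups N) : labelling N d :=
  stack (val (flip_stretched (cw_part c) t)).2 nu.

Lemma bottom_strands (p : 'I_N) : strands (nu p) = g d p.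
Proof. by rewrite bottom_wtE mult_strands. Qed.

Lemma line_le (u : vert) : (u.1 <= d)%N \/ u.1 = d.+1 :> nat.
Proof. by have := ltn_ord u.1; lia. Qed.

Section Intermediate.
Variable c : cups N.
Hypothesis ccup : is_cup_diagram o G c.
Hypothesis csub : subdiagram c b.

Let cK (p : 'I_N) : c (c p) = p. Proof. by have /cup_diagramP[] := ccup. Qed.

Let left_b (q : 'I_N) : (q < c q)%N -> c q = b q /\ b q != q.
Proof.
move=> lt; have nq : c q != q by apply: contraTneq lt => ->; rewrite ltnn.
by have := subdiagramP _ _ csub q nq => <-.
Qed.

Lemma cw_part_closed u v : T u v -> cw_part c u = cw_part c v.
Proof.
move=> h; apply: eq_existsb => q; congr [&& _, _ & _].
by apply: (same_connect_r (@connect_arcs_sym N d s g d)); exact: connect1.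
Qed.

Lemma cw_part_top (u : vert) : u.1 = 0%N :> nat -> g 0 u.2 = 1 -> ~~ cw_part c u.
Proof.
move=> u0 _; apply/negP=> /existsP[q /and3P[lt _ cq]].
have [_ nb] := left_b lt.
exact: (lower_not_top (u := upper_pt q) (upper_pt1 q) nb cq u0).
Qed.

Lemma intermediate_upper (u : vert) : (u.1 <= d)%N ->
  intermediate c u = flip_on (cw_part c) L u.
Proof.
move=> ud; rewrite -(flip_stretched_label cw_part_closed cw_part_top ud).
by rewrite /intermediate /Defs.double !ffunE ud.
Qed.

Lemma intermediate_lower (u : vert) : u.1 = d.+1 :> nat -> intermediate c u = nu u.2.
Proof. by move=> u1; rewrite /intermediate ffunE u1 ltnn. Qed.

Lemma intermediate_strands (u : vert) : strands (intermediate c u) = line_mult t u.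
Proof.
rewrite /line_mult; case: (line_le u) => ud.
  rewrite intermediate_upper // flip_onE (minn_idPl ud) -stretched_strands //.
  by case: ifP => // _; exact: strands_flip.
by rewrite intermediate_lower // ud (minn_idPr (leqnSn d)) bottom_strands.
Qed.

Lemma cw_part_fixed (p : 'I_N) : c p = p -> ~~ cw_part c (upper_pt p).
Proof.
move=> cp; apply/negP=> /existsP[q /and3P[lt _ cq]].
have [cb _] := left_b lt.
case: (bottom_connect (upper_pt1 q) (upper_pt1 p) cq) => /= e; subst p.
  by rewrite cp ltnn in lt.
by move: cp; rewrite -cb cK => e; rewrite -e ltnn in lt.
Qed.

Lemma cw_part_left (p : 'I_N) : (p < c p)%N -> cw_part c (upper_pt p) = (nu p == LWedge).
Proof.
move=> lt; apply/existsP/idP => [[q /and3P[ltq nq cq]]|np]; last first.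
  by exists p; rewrite lt np connect0.
have [cb _] := left_b ltq.
case: (bottom_connect (upper_pt1 q) (upper_pt1 p) cq) => /= e; first by rewrite e.
by rewrite e -cb cK in lt; rewrite -cb in e; lia.
Qed.

Lemma intermediate_bottom (p : 'I_N) :
  intermediate c (upper_pt p) = if cw_part c (upper_pt p) then flip (nu p) else nu p.
Proof.
by rewrite intermediate_upper ?upper_pt1 // flip_onE (bottom_vertex t (upper_pt1 p) erefl).
Qed.

Lemma intermediate_left (p : 'I_N) : (p < c p)%N -> intermediate c (upper_pt p) = LVee.
Proof.
move=> lt; rewrite intermediate_bottom cw_part_left //.
have [cb nb] := left_b lt; have /oriented_cupP[_ /(_ p nb) + _] := lower_oriented t.
by case: (nu p).
Qed.

Lemma intermediate_oriented a : oriented_cup o a nu ->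
  oriented (product_arcs o alpha ii a c) (intermediate c).
Proof.
case/oriented_cupP; rewrite block_of_bottom => acup aop _.
have /oriented_cupP[_ bop _] := lower_oriented t.
have oT := flip_on_oriented cw_part_closed (stretched_oriented t).
apply/forallP=> u; apply/forallP=> v; apply/implyP=> /(product_arcP t acup ccup).
case=> [h|h1 h2 h3 h4|h1 h2 h3 h4|h1 h2 h3 h4 h5|h1 h2 h3 h4 h5].
- have lv := @stretched_levels _ _ _ _ _ _ t.
  have [_ ud _] := arcs_bullet lv h.
  have h' : T v u by rewrite arcs_sym.
  have [_ vd _] := arcs_bullet lv h'.
  rewrite !intermediate_upper //.
  by have /forallP/(_ u)/forallP/(_ v)/implyP := oT; apply.
- rewrite ifT; last by apply/eqP/ord_inj; rewrite h1 h2.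
  by rewrite !intermediate_lower // -h4; apply: aop; rewrite h4; apply/eqP/nesym.
- rewrite h2 eqxx; have nb : c u.2 != u.2 by rewrite h4; apply/eqP/nesym.
  have cb := subdiagramP _ _ csub _ nb.
  have op : opposite (nu u.2) (nu v.2) by rewrite -h4 cb; apply: bop; rewrite -cb.
  case: h1 => h1; last by rewrite !intermediate_lower // -h2.
  have v1 : v.1 = d :> nat by rewrite -h2.
  rewrite (upper_ptP h1) (upper_ptP v1) !intermediate_bottom.
  have -> : cw_part c (upper_pt v.2) = cw_part c (upper_pt u.2).
    apply: eq_existsb => q; congr [&& _, _ & _].
    apply: (same_connect_r (@connect_arcs_sym N d s g d)).
    apply: (lower_connect (upper_pt1 v.2) (upper_pt1 u.2)) => /=.
    by rewrite -h4 cb bK.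
  by case: ifP => // _; rewrite flip_opposite.
- rewrite ifF; last by apply/eqP => e; rewrite e h2 in h1; lia.
  rewrite (upper_ptP h1) intermediate_bottom (negPf (cw_part_fixed h4)).
  by rewrite intermediate_lower // h3.
- rewrite ifF; last by apply/eqP => e; rewrite e h2 in h1; lia.
  rewrite (upper_ptP h2) intermediate_bottom -h3 (negPf (cw_part_fixed h4)).
  by rewrite intermediate_lower.
Qed.

End Intermediate.

Lemma intermediate_acw c : boundary_caps_anticlockwise t -> is_cup_diagram o G c ->
  subdiagram c b -> intermediate c = L.
Proof.
move=> /boundary_capsP acw ccup csub.
have nC u : cw_part c u = false.
  apply/negbTE/negP=> /existsP[q /and3P[lt + _]].
  have nq : c q != q by apply: contraTneq lt => ->; rewrite ltnn.
  by rewrite acw // -(subdiagramP _ _ csub q nq).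
apply/ffunP=> u; case: (line_le u) => ud.
  by rewrite (intermediate_upper csub) // flip_onE nC.
by rewrite (intermediate_lower c ud) ffunE ud ltnn.
Qed.

End Surgery.


(** * A single surgery *)

Section Step.
Variables (I : pred int) (o : int) (m n : nat) (alpha : lattice) (d : nat).
Local Notation N := (width m n d).
Local Notation vert := (vertex N d).
Local Notation stretched := (stretched I o m n alpha d).
Variable t : stretched.
Local Notation ii := (seq_of t).
Local Notation s := (pos o ii).
Local Notation g := (mult o m n ii).
Local Notation G := (Defs.Gamma o m n alpha).
Local Notation T := (@arcs N d s g d).
Local Notation b := (@lower_cups o m n d ii).
Local Notation nu := (bottom_wt t).
Local Notation up := (@upper_pt m n d).
Local Notation low := (@lower_pt m n d).

Variables (a c : cups N) (p : 'I_N).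
Hypothesis aor : oriented_cup o a nu.
Hypothesis ccup : is_cup_diagram o G c.
Hypothesis pc : (p < c p)%N.
Hypothesis pmin : forall q : 'I_N, (q < c q)%N -> (p <= q)%N.
Local Notation c' := (cut_cap c p).
Local Notation E := (product_arcs o alpha ii a c).
Local Notation E' := (product_arcs o alpha ii a c').
Local Notation ray := (product_rays o alpha a).

Let cK (q : 'I_N) : c (c q) = q. Proof. by have /cup_diagramP[] := ccup. Qed.
Let acup : is_cup_diagram o G a.
Proof. by have /oriented_cupP[] := aor; rewrite block_of_bottom. Qed.
Let npc : c p != p. Proof. by apply: contraTneq pc => ->; rewrite ltnn. Qed.

Lemma cut_capE (q : 'I_N) : c' q = if (q == p) || (q == c p) then q else c q.
Proof. by rewrite ffunE. Qed.

Lemma cut_cap_fixed (q : 'I_N) : q = p \/ q = c p -> c' q = q.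
Proof. by rewrite cut_capE; case=> ->; rewrite eqxx ?orbT. Qed.

Lemma cut_cap_other (q : 'I_N) : c' q <> q -> [/\ q <> p, q <> c p & c' q = c q].
Proof.
rewrite cut_capE; case: eqP => //= n1; case: eqP => //= n2.
Qed.

(** Since [p] is the leftmost left end, no remaining cap passes over [p] or [c p], which now carry
    vertical segments. *)
Lemma cut_cap_diagram : is_cup_diagram o G c'.
Proof.
have /cup_diagramP[_ cb cnc] := ccup.
have out (q : 'I_N) : q <> p -> q <> c p -> c q <> p /\ c q <> c p.
  by move=> n1 n2; split=> e; [apply: n2; rewrite -e cK|apply: n1; rewrite -(cK q) e cK].
have oth (q : 'I_N) : q <> p -> q <> c p -> c' q = c q.
  by rewrite cut_capE; do 2!case: eqP.
apply/cup_diagramP; split=> [q|q /eqP nq|q r qr rq br].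
- case: (c' q =P q) => [e|/cut_cap_other[n1 n2 e]]; first by rewrite !e.
  by have [m1 m2] := out q n1 n2; rewrite e oth // cK.
- by have [_ _ e] := cut_cap_other nq; apply: cb; rewrite -e; apply/eqP.
- have nq : c' q <> q by move=> e; rewrite e in rq; lia.
  have [n1 n2 e] := cut_cap_other nq; rewrite e in rq *.
  have [h1 h2 h3] := cnc q r qr rq br.
  have lpq : (p <= q)%N by apply: pmin; lia.
  have np : r <> p by move=> e'; subst r; lia.
  have ncp : r <> c p by move=> e'; subst r; rewrite cK in h2; lia.
  by rewrite oth.
Qed.

Let ccup' := cut_cap_diagram.

Lemma cut_cap_arc u v : E u v -> E' u v \/
  u.1 = v.1 /\ (u = up p /\ v = up (c p) \/ u = up (c p) /\ v = up p \/
                u = low p /\ v = low (c p) \/ u = low (c p) /\ v = low p).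
Proof.
have oth (q : 'I_N) : q <> p -> q <> c p -> c' q = c q.
  by rewrite cut_capE; do 2!case: eqP.
case/(product_arcP t acup ccup)=> [h|h1 h2 h3 h4|h1 h2 h3 h4|h1 h2 h3 h4 h5|h1 h2 h3 h4 h5].
- by left; apply/(product_arcP t acup ccup'); exact: StretchedArc.
- by left; apply/(product_arcP t acup ccup'); exact: LowerCup.
- case: (u.2 =P p) => [up_|n1]; last case: (u.2 =P c p) => [ucp|n2].
  + right; split=> //; rewrite up_ in h4.
    case: h1 => h1; move: (h1); rewrite h2 => v1.
      by left; rewrite (upper_ptP h1) (upper_ptP v1) up_ h4.
    by right; right; left; rewrite (lower_ptP h1) (lower_ptP v1) up_ h4.
  + right; split=> //; rewrite ucp cK in h4.
    case: h1 => h1; move: (h1); rewrite h2 => v1.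
      by right; left; rewrite (upper_ptP h1) (upper_ptP v1) ucp h4.
    by right; right; right; rewrite (lower_ptP h1) (lower_ptP v1) ucp h4.
  + by left; apply/(product_arcP t acup ccup'); apply: MiddleArc; rewrite ?oth.
- left; apply/(product_arcP t acup ccup'); apply: MiddleSegment => //.
  by rewrite cut_capE h4; case: ifP.
- left; apply/(product_arcP t acup ccup'); apply: MiddleSegment' => //.
  by rewrite cut_capE h4; case: ifP.
Qed.

Lemma cut_cap_arc' u v : E' u v -> E u v \/
  (u = up p /\ v = low p \/ u = low p /\ v = up p \/
   u = up (c p) /\ v = low (c p) \/ u = low (c p) /\ v = up (c p)).
Proof.
have oth (q : 'I_N) : q <> p -> q <> c p -> c' q = c q.
  by rewrite cut_capE; do 2!case: eqP.
case/(product_arcP t acup ccup')=> [h|h1 h2 h3 h4|h1 h2 h3 h4|h1 h2 h3 h4 h5|h1 h2 h3 h4 h5].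
- by left; apply/(product_arcP t acup ccup); exact: StretchedArc.
- by left; apply/(product_arcP t acup ccup); exact: LowerCup.
- have nc : c' u.2 <> u.2 by rewrite h4; exact: nesym.
  have [_ _ e] := cut_cap_other nc.
  by left; apply/(product_arcP t acup ccup); apply: MiddleArc; rewrite -?e.
- rewrite (upper_ptP h1) (lower_ptP h2) -h3.
  case: (u.2 =P p) => [->|n1]; first by right; left.
  case: (u.2 =P c p) => [->|n2]; first by right; right; right; left.
  left; apply/(product_arcP t acup ccup); apply: MiddleSegment; rewrite ?upper_pt1 ?lower_pt1 //=.
  by rewrite -oth.
- rewrite (lower_ptP h1) (upper_ptP h2) -h3.
  case: (u.2 =P p) => [->|n1]; first by right; right; left.
  case: (u.2 =P c p) => [->|n2]; first by right; right; right; right.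
  left; apply/(product_arcP t acup ccup); apply: MiddleSegment'; rewrite ?upper_pt1 ?lower_pt1 //=.
  by rewrite -oth.
Qed.

Let gp : g d p = 1.
Proof.
by have /cup_diagramP[_ /(_ p npc) + _] := ccup; rewrite (bullet_bottom t) => /eqP.
Qed.
Let gcp : g d (c p) = 1.
Proof.
have ne : c (c p) != c p by rewrite cK eq_sym.
by have /cup_diagramP[_ /(_ _ ne) + _] := ccup; rewrite (bullet_bottom t) => /eqP.
Qed.

Lemma cut_segment (q : 'I_N) : q = p \/ q = c p -> E' (low q) (up q).
Proof.
move=> hq; apply/(product_arcP t acup ccup'); apply: MiddleSegment'.
- exact: lower_pt1. - exact: upper_pt1. - by []. - exact: cut_cap_fixed.
by case: hq => ->.
Qed.

Let Esym : connect_sym E := product_connect_sym t acup ccup.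
Let E'sym : connect_sym E' := product_connect_sym t acup ccup'.

Lemma cap_arc : E (low p) (low (c p)).
Proof.
apply/(product_arcP t acup ccup); apply: MiddleArc => //=.
- by right; rewrite inordK.
- by apply/nesym/eqP.
Qed.

Lemma cup_arc : E (up p) (up (c p)).
Proof.
apply/(product_arcP t acup ccup); apply: MiddleArc => //=.
- by left; rewrite inordK.
- by apply/nesym/eqP.
Qed.

(** The removed cap and cup can be bypassed through the new segments, so connected vertices stay
    connected. The segments link only the components of [low p] and [up p]. *)
Lemma merged_component u : connect E' (up p) (up (c p)) ->
  connect E' (up p) u = connect E (low p) u || connect E (up p) u.
Proof.
move=> cc.
have seg (q : 'I_N) : q = p \/ q = c p -> connect E' (low q) (up q).
  by move=> hq; apply/connect1/cut_segment.
have cl : connect E' (low p) (low (c p)).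
  apply: connect_trans (seg _ (or_introl erefl)) _; apply: connect_trans cc _.
  by rewrite E'sym; apply: seg; right.
have sub : subrel (connect E) (connect E').
  apply: connect_sub => x y /cut_cap_arc[/connect1 //|[_ H]].
  by case: H => [[-> ->]|[[-> ->]|[[-> ->]|[-> ->]]]] //; rewrite E'sym.
apply/idP/orP => [h|[h|h]]; last 1 first.
- exact: sub.
- apply: (connect_ind (P := fun x => connect E (low p) x \/ connect E (up p) x)) h; last by right.
  move=> x y h /cut_cap_arc'[e|H].
    by case: h => h; [left|right]; apply: connect_trans h (connect1 e).
  case: H => [[_ ->]|[[_ ->]|[[_ ->]|[_ ->]]]].
  + by left. + by right.
  + by left; apply/connect1/cap_arc.
  + by right; apply/connect1/cup_arc.
- by apply: connect_trans (sub _ _ h); rewrite E'sym; apply: seg; left.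
Qed.

Lemma upper_circle_line (q : 'I_N) (v : vert) : connect T (up q) v -> (v.1 <= d)%N.
Proof.
move=> h; case: (eqVneq v (up q)) => [->|ne]; first by rewrite upper_pt1.
rewrite connect_arcs_sym in h.
by have [] := connect_bullet (@stretched_levels _ _ _ _ _ _ t) h ne.
Qed.

Section Forward.
Hypothesis csub : subdiagram c b.
Variables K K' : labelling N d.
Hypotheses (KE : K = intermediate t c) (K'E : K' = intermediate t c').

Lemma cut_subdiagram : subdiagram c' b.
Proof.
apply/subdiagramP=> q /eqP nq; have [n1 n2 e] := cut_cap_other nq; rewrite e.
apply: (subdiagramP _ _ csub).
by rewrite -e; apply/eqP.
Qed.

Let csub' := cut_subdiagram.

Let bp : b p = c p. Proof. by rewrite (subdiagramP _ _ csub p npc). Qed.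

(** Since [c p = b p], the cup at [p] closes the boundary component of t above it, without reaching
    line [d.+1]. *)
Lemma upper_circle u : connect E (up p) u = connect T (up p) u.
Proof.
apply/idP/idP; last exact: stretched_sub.
move=> h; apply: (connect_ind (P := fun x => connect T (up p) x)) h => // x y hx.
have xd : (x.1 <= d)%N.
  case: (eqVneq x (up p)) => [->|ne]; first by rewrite upper_pt1.
  rewrite connect_arcs_sym in hx.
  by have [] := connect_bullet (@stretched_levels _ _ _ _ _ _ t) hx ne.
have x2 : x.1 = d :> nat -> x.2 = p \/ x.2 = c p.
  by move=> x1; rewrite -bp; apply: (bottom_connect (upper_pt1 p) x1 hx).
case/(product_arcP t acup ccup)=> [h|h1|h1 h2 h3 h4|h1 h2 h3 h4 h5|h1].
- exact: connect_trans hx (connect1 h).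
- by rewrite h1 ltnn in xd.
- case: h1 => h1; last by rewrite h1 ltnn in xd.
  have v1 : y.1 = d :> nat by rewrite -h2.
  by case: (x2 h1) => e; rewrite e ?cK in h4; [apply: (lower_connect (upper_pt1 p) v1); rewrite -h4 bp|rewrite (upper_ptP v1) -h4; exact: connect0].
- by case: (x2 h1) => e; rewrite e ?cK in h4; [case/eqP: (npc)|case/eqP: (npc); rewrite -h4].
- by rewrite h1 ltnn in xd.
Qed.

Lemma upper_circle_rays v : connect E (up p) v -> ~~ ray v.
Proof.
rewrite upper_circle => h; have vd := upper_circle_line h.
apply/negP=> /orP[/andP[/eqP v0 _]|/andP[/eqP v1 _]]; last by rewrite v1 ltnn in vd.
have nb : b (up p).2 != (up p).2 by rewrite /= bp.
exact: (lower_not_top (upper_pt1 p) nb h v0).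
Qed.

Lemma upper_lower_apart : ~~ connect E (low p) (up p).
Proof.
rewrite Esym upper_circle; apply/negP=> /upper_circle_line.
by rewrite lower_pt1 ltnn.
Qed.

Lemma ends_rejoined : connect E' (up p) (up (c p)).
Proof.
apply: (stretched_sub acup ccup'); apply: (lower_connect (upper_pt1 p) (upper_pt1 (c p))).
by rewrite /= bp.
Qed.

Let oK : oriented E K. Proof. by rewrite KE; apply: intermediate_oriented. Qed.
Let oK' : oriented E' K'. Proof. by rewrite K'E; apply: intermediate_oriented. Qed.
Let gK u : strands (K u) = line_mult t u.
Proof. by rewrite KE; apply: intermediate_strands. Qed.
Let gK' u : strands (K' u) = line_mult t u.
Proof. by rewrite K'E; apply: intermediate_strands. Qed.
Let Kp : K (up p) = LVee. Proof. by rewrite KE; apply: intermediate_left. Qed.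

Let bul_up (q : 'I_N) : g d q = 1 -> line_mult t (up q) = 1.
Proof. by rewrite /line_mult upper_pt1 minnn. Qed.
Let bul_low (q : 'I_N) : g d q = 1 -> line_mult t (low q) = 1.
Proof. by rewrite /line_mult lower_pt1 (minn_idPr (leqnSn d)). Qed.

Lemma upper_leftmost : line_leftmost t a c (up p).
Proof.
move=> v; rewrite upper_circle => h v1.
have v1' : v.1 = d :> nat by rewrite v1 upper_pt1.
case: (bottom_connect (upper_pt1 p) v1' h) => -> //=.
by rewrite bp ltnW.
Qed.

Lemma upper_type : component_type E ray K (up p) = AntiCircle.
Proof.
rewrite (circle_type acup ccup gK oK (bul_up gp) (w := up p) (flipped := false)) ?connect0 //.
- by rewrite Kp.
- exact: upper_leftmost.
- exact: upper_circle_rays.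
Qed.

(** Cutting the cap at [p] releases only the boundary component of t through [up p]. *)
Lemma intermediate_step v : ~~ connect T (up p) v -> K' v = K v.
Proof.
rewrite KE K'E => nU; case: (line_le v) => vd; last first.
  exact: etrans (intermediate_lower t c' vd) (esym (intermediate_lower t c vd)).
apply: etrans (intermediate_upper csub' vd) (etrans _ (esym (intermediate_upper csub vd))).
rewrite !flip_onE; congr (if _ then _ else _).
apply/existsP/existsP => -[q /and3P[lt nq cq]]; exists q.
  have nq' : c' q <> q by move=> e; rewrite e ltnn in lt.
  by have [_ _ e] := cut_cap_other nq'; rewrite -e lt nq cq.
have n1 : q <> p by move=> e; rewrite -e cq in nU.
have n2 : q <> c p by move=> e; move: lt; rewrite e cK ltnNge (ltnW pc).
have -> : c' q = c q by rewrite cut_capE; do 2!case: eqP.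
by rewrite lt nq cq.
Qed.

(** [w] is leftmost among the vertices of the lower component on line [d.+1]. The upper circle does
    not meet that line, so [w] stays leftmost there after the merge and keeps its label. *)
Lemma step_circle_type : (forall v, connect E' (up p) v -> ~~ ray v) ->
  exists2 w, connect E (low p) w &
    [/\ line_leftmost t a c w, connect E' (up p) w, line_leftmost t a c' w & K' w = K w].
Proof.
move=> nr; pose P w := connect E (low p) w && (w.1 == d.+1 :> nat).
have P0 : P (low p) by rewrite /P connect0 lower_pt1 eqxx.
have [w /andP[cw /eqP w1] min] := arg_minnP (fun w : vert => (w.2 : nat)) P0.
have lower v : connect E' (up p) v -> v.1 = d.+1 :> nat -> connect E (low p) v.
  rewrite merged_component ?ends_rejoined // => /orP[//|].
  by rewrite upper_circle => /upper_circle_line + v1; rewrite v1 ltnn.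
have cw' : connect E' (up p) w by rewrite merged_component ?ends_rejoined // cw.
exists w => //; split=> //.
- move=> v cv v1; apply: min; rewrite /P (connect_trans cw cv) /=.
  by rewrite v1 w1.
- move=> v cv v1; apply: min; rewrite /P lower ?v1 ?w1 ?eqxx //.
  exact: connect_trans cw' cv.
- by apply: intermediate_step; apply/negP=> /upper_circle_line; rewrite w1 ltnn.
Qed.

Lemma step_type : component_type E' ray K' (up p) = component_type E ray K (low p).
Proof.
case h: [exists w, connect E (low p) w && ray w].
  have h' : [exists w, connect E' (up p) w && ray w].
    apply/existsP; have /existsP[w /andP[cw rw]] := h; exists w.
    by rewrite merged_component ?ends_rejoined // cw.
  by rewrite /component_type h h'.
have nr v : connect E (low p) v -> ~~ ray v.
  by move=> cv; apply/negP=> rv; move/negbT/existsPn: h => /(_ v); rewrite cv rv.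
have nr' v : connect E' (up p) v -> ~~ ray v.
  by rewrite merged_component ?ends_rejoined // => /orP[/nr|/upper_circle_rays].
have [w cw [lw cw' lw' e]] := step_circle_type nr'.
rewrite (circle_type acup ccup' gK' oK' (bul_up gp) (w := w) (flipped := false)) //.
by rewrite (circle_type acup ccup gK oK (bul_low gp) (w := w) (flipped := false)) // e.
Qed.

Lemma forward_rule_holds : surgery_rule E E' ray (low p) (up p) (up (c p)) K K'.
Proof.
apply/and4P; split=> //.
- apply/forallP=> v; apply/implyP=> /andP[_]; rewrite upper_circle => nU.
  by rewrite intermediate_step.
- apply/forallP=> v; apply/implyP=> rv; rewrite intermediate_step //.
  by rewrite -upper_circle; apply: contraTN rv => /upper_circle_rays.
- rewrite (negPf upper_lower_apart) ends_rejoined upper_type step_type.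
  by case: (component_type _ _ _ _).
Qed.

(** A connected component of bullets has two orientations. On the merged component the rule selects
    one, by its type for a circle and by the labels of its rays for a line; elsewhere labels are
    unchanged. *)
Lemma forward_rule K1 :
  surgery_rule E E' ray (low p) (up p) (up (c p)) K K1 = (K1 == K').
Proof.
apply/idP/eqP => [|->]; last exact: forward_rule_holds.
case/and4P=> oK1 /forallP h1 /forallP h2.
rewrite (negPf upper_lower_apart) ends_rejoined upper_type => h3.
have {h3} ht : component_type E' ray K1 (up p) = component_type E' ray K' (up p).
  by rewrite step_type; case: (component_type _ _ _ _) (component_type _ _ _ _) h3 => [] [].
have /and4P[_ /forallP h1' /forallP h2' _] := forward_rule_holds.
(* A priori [K1] could be constantly circ or cross on the component. Opposite labels of [K'] at two
   connected vertices exclude this by [oriented_strands]. *)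
have op : opposite (K' (up p)) (K' (up (c p))).
  have fx (q : 'I_N) : q = p \/ q = c p -> K' (up q) = nu q.
    by move=> /cut_cap_fixed e; rewrite K'E intermediate_bottom // (negPf (cw_part_fixed ccup' csub' e)).
  rewrite !fx; auto; have /oriented_cupP[_ bop _] := lower_oriented t.
  by rewrite -bp; apply: bop; rewrite bp.
have s1 := oriented_strands oK' oK1 ends_rejoined op.
have s2 : strands (K' (up p)) = 1 by rewrite gK' bul_up.
have agree : K1 (up p) = K' (up p).
  have [//|fl] := strands1_eq s1 s2.
  have flE v : connect E' (up p) v -> K1 v = flip (K' v).
    by move=> cv; apply: (orientations_opposite oK' oK1 cv fl).
  case h: [exists w, connect E' (up p) w && ray w].
    have /existsP[w /andP[cw rw]] := h.
    have := flE w cw; rewrite (eqP (implyP (h2 w) rw)) -(eqP (implyP (h2' w) rw)).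
    have : strands (K' w) == 1 by rewrite gK' (product_connect_bullet acup ccup' cw) ?bul_up.
    by case: (K' w).
  have nr' v : connect E' (up p) v -> ~~ ray v.
    by move=> cv; apply/negP=> rv; move/negbT/existsPn: h => /(_ v); rewrite cv rv.
  have [w cw [lw cw' lw' e]] := step_circle_type nr'.
  move: ht; rewrite (circle_type acup ccup' gK' oK' (bul_up gp) (w := w) (flipped := true)) //.
  rewrite (circle_type acup ccup' gK' oK' (bul_up gp) (w := w) (flipped := false)) //.
  by case: (K' w == LWedge).
apply/ffunP=> v; case cv: (connect E' (up p) v).
  exact: (orientations_agree oK' oK1 cv agree).
move/negbT: cv; rewrite merged_component ?ends_rejoined // negb_or => nc.
by rewrite (eqP (implyP (h1 v) nc)) (eqP (implyP (h1' v) nc)).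
Qed.

End Forward.

Section Backward.
Hypothesis ab : a = b.
Hypothesis acw : boundary_caps_anticlockwise t.
Hypothesis csub' : subdiagram c' b.
Variables K L1 : labelling N d.
Hypothesis KE : K = Defs.double (val t).2.
Hypothesis oL1 : oriented E L1.
Hypothesis rule : surgery_rule E E' ray (low p) (up p) (up (c p)) L1 K.

Let bK (q : 'I_N) : b (b q) = q.
Proof. by have /oriented_cupP[/cup_diagramP[]] := lower_oriented t. Qed.
Let KI : K = intermediate t c'. Proof. by rewrite KE intermediate_acw. Qed.
Let oK : oriented E' K. Proof. by rewrite KI; apply: intermediate_oriented. Qed.
Let gK u : strands (K u) = line_mult t u.
Proof. by rewrite KI; apply: intermediate_strands. Qed.
Let Kup (q : 'I_N) : K (up q) = nu q.
Proof. by rewrite KE (bottom_vertex t (upper_pt1 q) erefl). Qed.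
Let Klow (q : 'I_N) : K (low q) = nu q.
Proof. by rewrite KI; apply: (intermediate_lower t c' (lower_pt1 q)). Qed.

Let fixed_partner (q : 'I_N) : c' q = q -> c' (b q) = b q.
Proof.
move=> cq; case: (c' (b q) =P b q) => // /eqP h.
have := subdiagramP _ _ csub' _ h; rewrite bK => e.
have /cup_diagramP[c'K _ _] := ccup'.
by have := c'K (b q); rewrite e cq => <-.
Qed.

(** Since [a = b], following the segments down from a boundary cap of t leads to its mirror image
    cup of [a] and back; no other part of the diagram is reached. *)
Lemma joined_component (q : 'I_N) u : c' q = q -> connect E' (up q) u ->
  connect T (up q) u \/ u = low q \/ u = low (b q).
Proof.
move=> cq; apply: (connect_ind (P := fun x =>
  connect T (up q) x \/ x = low q \/ x = low (b q))); last by left.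
have cbq := fixed_partner cq.
move=> x y [hx|hx].
  have x2 : x.1 = d :> nat -> x.2 = q \/ x.2 = b q.
    by move=> x1; exact: (bottom_connect (upper_pt1 q) x1 hx).
  have xd := upper_circle_line hx.
  case/(product_arcP t acup ccup')=> [h|h1|h1 h2 h3 h4|h1 h2 h3 h4 h5|h1].
  - by left; exact: connect_trans hx (connect1 h).
  - by rewrite h1 ltnn in xd.
  - case: h1 => h1; last by rewrite h1 ltnn in xd.
    by case: h3; rewrite -h4; case: (x2 h1) => ->.
  - right; rewrite (lower_ptP h2) -h3.
    by case: (x2 h1) => ->; [left|right].
  - by rewrite h1 ltnn in xd.
have x1 : x.1 = d.+1 :> nat by case: hx => ->; exact: lower_pt1.
have x2 : x.2 = q \/ x.2 = b q by case: hx => ->; [left|right].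
case/(product_arcP t acup ccup')=> [h|h1 h2 h3 h4|h1 h2 h3 h4|h1|h1 h2 h3 h4 h5].
- have [_ xd _] := arcs_bullet (@stretched_levels _ _ _ _ _ _ t) h.
  by rewrite x1 ltnn in xd.
- right; rewrite (lower_ptP h2) -h4 ab.
  by case: x2 => ->; [right|left; rewrite bK].
- by case: h3; rewrite -h4; case: x2 => ->.
- by have := ltnn d; rewrite -[X in (_ < X)%N]h1 x1 ltnSn.
- left; rewrite (upper_ptP h2) -h3; case: x2 => ->; first exact: connect0.
  exact: (lower_connect (upper_pt1 q) (upper_pt1 (b q))).
Qed.

Lemma joined_type (q : 'I_N) : c' q = q -> g d q = 1 ->
  component_type E' ray K (up q) = if b q == q then Line else AntiCircle.
Proof.
move=> cq gq; have seg (r : 'I_N) : c' r = r -> g d r = 1 -> E' (up r) (low r).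
  move=> cr gr; apply/(product_arcP t acup ccup'); apply: MiddleSegment => //.
    exact: upper_pt1. exact: lower_pt1.
case: eqP => [bq|/eqP nbq].
  rewrite /component_type ifT //; apply/existsP; exists (low q).
  rewrite connect1 ?seg //= /product_rays lower_pt1 eqxx ab /= bq eqxx /=.
  by rewrite (bullet_bottom t) gq eqxx ?orbT.
have gbq : g d (b q) = 1.
  have /oriented_cupP[/cup_diagramP[_ bb _] _ _] := lower_oriented t.
  have nb : b (b q) != b q by rewrite bK eq_sym.
  by have := bb _ nb; rewrite block_of_bottom (bullet_bottom t) => /eqP.
have cbq := fixed_partner cq.
have nr v : connect E' (up q) v -> ~~ ray v.
  move=> /(joined_component cq) h; apply/negP=> /orP[/andP[/eqP v0 _]|/and3P[/eqP v1 av _]].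
    case: h => [h|[] e]; last 2 first.
    - by rewrite e lower_pt1 in v0. - by rewrite e lower_pt1 in v0.
    exact: (lower_not_top (upper_pt1 q) nbq h v0).
  case: h => [/upper_circle_line|[] e]; first by rewrite v1 ltnn.
    by rewrite e /= ab (negPf nbq) in av.
  by rewrite e /= ab bK eq_sym (negPf nbq) in av.
have cub : connect E' (up q) (up (b q)).
  apply: (stretched_sub acup ccup'); exact: (lower_connect (upper_pt1 q) (upper_pt1 (b q))).
have bul : line_mult t (up q) = 1 by rewrite /line_mult upper_pt1 minnn.
pose r := if (q < b q)%N then q else b q.
have [rq rbq br] : [/\ (r <= q)%N, (r <= b q)%N & (r < b r)%N].
  rewrite /r; case: (ltnP q (b q)) => h; first by split=> //; exact: ltnW.
  rewrite bK leqnn h; split=> //; rewrite ltn_neqAle h andbT.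
  by apply: contraNneq nbq => /ord_inj->.
have cr : connect E' (up q) (up r) by rewrite /r; case: ifP.
rewrite (circle_type acup ccup' gK oK bul (w := up r) (flipped := false)) //.
  by rewrite Kup (boundary_capsP t acw r br).
move=> v cv v1; have v1' : v.1 = d :> nat by rewrite v1 upper_pt1.
have cqv := connect_trans cr cv.
case: (joined_component cq cqv) => [h|[] e].
- by case: (bottom_connect (upper_pt1 q) v1' h) => -> /=.
- by rewrite e lower_pt1 in v1'; case: (n_Sn d (esym v1')).
- by rewrite e lower_pt1 in v1'; case: (n_Sn d (esym v1')).
Qed.

(** After the surgery, the components at the two new segments are lines or anti-clockwise circles by
    [joined_type]. Of the possible surgeries this leaves only a merge, and then [joined_component]
    identifies [c p]. *)
Lemma backward_partner : c p = b p.
Proof.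
have cp : c' p = p by apply: cut_cap_fixed; left.
have ccp : c' (c p) = c p by apply: cut_cap_fixed; right.
have /and4P[_ _ /forallP hr] := rule.
rewrite (joined_type cp gp) (joined_type ccp gcp).
(* Every split produces a clockwise circle. *)
case: ifP => [_|nE]; first by do 2!case: ifP; case: (component_type _ _ _ _).
case: ifP => [h _|nE'].
  case: (joined_component cp h) => [h'|[] e].
  - by case: (bottom_connect (upper_pt1 p) (upper_pt1 (c p)) h') => //= e; move: npc; rewrite e eqxx.
  - by have := congr1 (fun v : vert => v.1 : nat) e; rewrite upper_pt1 lower_pt1 => /n_Sn.
  - by have := congr1 (fun v : vert => v.1 : nat) e; rewrite upper_pt1 lower_pt1 => /n_Sn.
(* Two lines are left to be excluded. If [p] were an end of a cup of [b], then [low p] and [up p]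
   would already be connected before the surgery, through the segment at [b p]. *)
have bp : b p = p.
  apply/eqP; apply/negPn/negP => nb.
  have cb : c (b p) = b p.
    have ne : b p <> c p.
      move=> e; move/negP: nE'; apply.
      apply: (stretched_sub acup ccup').
      exact: (lower_connect (upper_pt1 p) (upper_pt1 (c p)) (esym e)).
    have := fixed_partner cp; rewrite cut_capE (negPf nb).
    by case: eqP.
  have gb : g d (b p) = 1.
    have /oriented_cupP[/cup_diagramP[_ bb _] _ _] := lower_oriented t.
    have nb' : b (b p) != b p by rewrite bK eq_sym.
    by have := bb _ nb'; rewrite block_of_bottom (bullet_bottom t) => /eqP.
  move/negP: nE; apply.
  have e1 : E (low p) (low (b p)).
    apply/(product_arcP t acup ccup); apply: LowerCup; rewrite ?lower_pt1 ?ab //=.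
    by apply/nesym/eqP.
  have e2 : E (low (b p)) (up (b p)).
    by apply/(product_arcP t acup ccup); apply: MiddleSegment'; rewrite ?lower_pt1 ?upper_pt1.
  apply: connect_trans (connect1 e1) (connect_trans (connect1 e2) _).
  apply: (stretched_sub acup ccup).
  by apply: (lower_connect (upper_pt1 (b p)) (upper_pt1 p)); rewrite /= bK.
have bulp : bullet o G p by rewrite (bullet_bottom t) gp.
have [l1 [w [w0 gw cw]]] := lower_free_top (upper_pt1 p) bulp bp.
have rp : ray (low p) by rewrite /product_rays lower_pt1 eqxx /= ab bp eqxx bulp ?orbT.
have rw : ray w.
  rewrite /product_rays w0 eqxx /= /bullet; move: gw.
  by rewrite /mult /Gamma_ take0 big_nil subr0 => /eqP->.
have cxp : connect E (up p) w.
  by rewrite Esym; apply: (stretched_sub acup ccup).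
(* The rays of both lines carry [top_label], while the rule for rejoining two lines asks for
   opposite labels. *)
have Lp : L1 (low p) = top_label m n by rewrite -(eqP (implyP (hr _) rp)) Klow -l1.
have Lw : L1 w = top_label m n.
  rewrite -(eqP (implyP (hr _) rw)) KE; exact: stretched_top.
case/orP=> /andP[/forallP/(_ (low p)) + /forallP/(_ w)];
  rewrite connect0 rp cxp rw /= Lp Lw => /eqP->; by [].
Qed.

(** As [c p = b p], the labelling [K] also orients the diagram before the surgery. The merge yields
    an anti-clockwise circle, so both merged components are anti-clockwise circles in [L1], as they
    are in [K]; this determines [L1] on them. *)
Lemma backward_labelling : L1 = K.
Proof.
have cb := backward_partner.
have csub : subdiagram c b.
  apply/subdiagramP=> q nq; case: (q =P p) => [->|n1]; first exact: cb.
  case: (q =P c p) => [->|n2]; first by rewrite cK cb bK.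
  have e : c' q = c q by rewrite cut_capE; do 2!case: eqP.
  by rewrite -e; apply: (subdiagramP _ _ csub'); rewrite e.
have KI' : K = intermediate t c by rewrite KE intermediate_acw.
have KI2 : K = intermediate t (cut_cap c p) := KI.
have oKE : oriented E K by rewrite KI'; apply: intermediate_oriented.
have forward := forward_rule_holds csub KI' KI2.
have /and4P[_ _ _ hK] := forward; have /and4P[_ /forallP h1 _ hL] := rule.
have napart := upper_lower_apart csub; have rejoin := ends_rejoined csub.
rewrite (negPf napart) rejoin (upper_type csub KI') in hK.
have cp : c' p = p by apply: cut_cap_fixed; left.
have tE' : component_type E' ray K (up p) = AntiCircle.
  by rewrite joined_type // ifF // -cb; apply/negbTE.
rewrite tE' in hK.
have tx : component_type E ray K (low p) = AntiCircle.
  by move: hK; case: (component_type _ _ _ _).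
have ty := upper_type csub KI'.
rewrite (negPf napart) rejoin tE' in hL.
have [lx ly] : component_type E ray L1 (low p) = AntiCircle /\
    component_type E ray L1 (up p) = AntiCircle.
  by move: hL; case: (component_type _ _ L1 (low p)); case: (component_type _ _ L1 (up p)).
have agree (v v' : vert) : opposite (K v) (K v') -> connect E v v' -> line_mult t v = 1 ->
    component_type E ray K v = AntiCircle -> component_type E ray L1 v = AntiCircle ->
    forall u, connect E v u -> L1 u = K u.
  move=> op cvv gv tK tL u cu.
  have s1 := oriented_strands oKE oL1 cvv op.
  have s2 : strands (K v) = 1 by rewrite gK.
  have [e|fl] := strands1_eq s1 s2; first exact: (orientations_agree oKE oL1 cu e).
  have flE w : connect E v w -> L1 w = flip (K w).
    by move=> cw; apply: (orientations_opposite oKE oL1 cw fl).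
  have nr w : connect E v w -> ~~ ray w.
    move=> cw; apply/negP=> rw; move: tK; rewrite /component_type ifT //.
    by apply/existsP; exists w; rewrite cw.
  have [w cw lw] := leftmost_exists t a c v.
  have lw' := leftmost_line lw.
  move: tK tL; rewrite (circle_type acup ccup gK oKE gv (w := w) (flipped := false)) //.
  rewrite (circle_type acup ccup gK oKE gv (w := w) (flipped := true)) //.
  by case: (K w == LWedge).
have opp : opposite (nu p) (nu (c p)).
  by have /oriented_cupP[_ bop _] := lower_oriented t; rewrite cb; apply: bop; rewrite -cb.
have bl : line_mult t (low p) = 1 by rewrite /line_mult lower_pt1 (minn_idPr (leqnSn d)).
have bu : line_mult t (up p) = 1 by rewrite /line_mult upper_pt1 minnn.
have ax := agree (low p) (low (c p)) ltac:(by rewrite !Klow) (connect1 cap_arc) bl tx lx.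
have ay := agree (up p) (up (c p)) ltac:(by rewrite !Kup) (connect1 cup_arc) bu ty ly.
apply/ffunP=> v; case cx: (connect E (low p) v); first exact: ax.
case cy: (connect E (up p) v); first exact: ay.
by symmetry; apply/eqP/(implyP (h1 v)); rewrite cx cy.
Qed.

End Backward.

End Step.


(** * Structure constants *)

Section LeftEnds.
Variables (o : int) (m n d : nat) (G : lattice).
Local Notation N := (width m n d).
Implicit Types c : cups N.

Definition left_ends c := [seq p : 'I_N <- enum 'I_N | (p < c p)%N].

Lemma left_ends_nil c : is_cup_diagram o G c -> left_ends c = [::] ->
  forall q : 'I_N, c q = q.
Proof.
move=> /cup_diagramP[cK _ _] e q.
have nl (r : 'I_N) : (r < c r)%N = false.
  apply/negbTE/negP => lt; have : r \in left_ends c by rewrite mem_filter lt mem_enum.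
  by rewrite e.
apply: ord_inj; case: (ltngtP (c q) q) => // lt; last by rewrite nl in lt.
by have := nl (c q); rewrite cK lt.
Qed.

Lemma left_ends_cons c p ps : is_cup_diagram o G c -> left_ends c = p :: ps ->
  [/\ (p < c p)%N, forall q : 'I_N, (q < c q)%N -> (p <= q)%N
    & left_ends (cut_cap c p) = ps].
Proof.
move=> /cup_diagramP[cK _ _] e.
have pl : (p < c p)%N.
  by have := mem_head p ps; rewrite -e mem_filter => /andP[].
have srt : sorted (fun i j : 'I_N => (i < j)%N) (left_ends c).
  apply: sorted_filter; first by move=> x y z; exact: ltn_trans.
  by have := iota_ltn_sorted 0 N; rewrite -val_enum_ord sorted_map.
split=> // [q lt|].
  have : q \in left_ends c by rewrite mem_filter lt mem_enum.
  rewrite e inE => /orP[/eqP-> //|qs]; apply: ltnW.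
  move: srt; rewrite e /= path_sortedE; last by move=> x y z; exact: ltn_trans.
  by case/andP=> /allP/(_ q qs).
have -> : left_ends (cut_cap c p) = [seq q <- left_ends c | q != p].
  rewrite -filter_predI; apply: eq_filter => q /=; rewrite ffunE.
  case: eqP => [->|/eqP np] /=; first by rewrite ltnn.
  case: (q =P c p) => [->|ncp]; last by [].
  by rewrite cK ltnn ltnNge (ltnW pl) ?andbF.
have /andP[np _] : uniq (p :: ps) by rewrite -e filter_uniq // enum_uniq.
rewrite e /= eqxx; apply/all_filterP/allP => q qs.
by apply: contraNneq np => <-.
Qed.

End LeftEnds.

Section Products.
Variables (I : pred int) (o : int) (m n : nat) (alpha : lattice) (d : nat).
Local Notation N := (width m n d).
Local Notation vert := (vertex N d).
Local Notation stretched := (stretched I o m n alpha d).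
Local Notation G := (Defs.Gamma o m n alpha).

Lemma surgeries_ext ii (a : cups N) ps c f f' : (forall L, f L = f' L) ->
  forall L, surgeries o alpha ii a ps c f L = surgeries o alpha ii a ps c f' L.
Proof.
elim: ps c f f' => //= p ps IH c f f' ff; apply: IH => L.
by apply: eq_bigr => L' _; rewrite ff.
Qed.

Section Fixed.
Variable t : stretched.
Local Notation ii := (seq_of t).
Local Notation b := (@lower_cups o m n d ii).
Local Notation nu := (bottom_wt t).
Local Notation L0 := (Defs.double (val t).2).
Variable a : cups N.
Hypothesis aor : oriented_cup o a nu.

Lemma intermediate_id (c : cups N) : (forall q : 'I_N, c q = q) -> intermediate t c = L0.
Proof.
move=> cE; have csub : subdiagram c b by apply/subdiagramP => q; rewrite cE eqxx.
apply/ffunP=> u; case: (line_le u) => ud.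
  apply: etrans (intermediate_upper csub ud) _; rewrite flip_onE ifF //.
  by apply/negbTE/negP=> /existsP[q /andP[]]; rewrite cE ltnn.
by apply: etrans (intermediate_lower t c ud) _; rewrite ffunE ud ltnn.
Qed.

(** By [forward_rule] the formal sum keeps a single term throughout. *)
Lemma forward_surgeries ps (c : cups N) L : left_ends c = ps -> is_cup_diagram o G c ->
  subdiagram c b ->
  surgeries o alpha ii a ps c (fun L' => (L' == intermediate t c) : nat) L = (L == L0).
Proof.
elim: ps c => [|p ps IH] c e cc csub.
  by rewrite /= (intermediate_id (left_ends_nil cc e)).
have [pc pmin e'] := left_ends_cons cc e.
have cc' := cut_cap_diagram aor cc pc pmin.
have csub' := cut_subdiagram p csub.
rewrite -(IH _ e' cc' csub') /=; apply: surgeries_ext => L'.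
rewrite -(forward_rule aor cc pc pmin csub erefl erefl L').
move: (intermediate t c) => K; case r: (surgery_rule _ _ _ _ _ _ K L').
  rewrite (bigD1 K) //= eqxx big1 // => L1 /andP[_ ne].
  by rewrite (negPf ne).
rewrite big1 // => L1 r1; case: eqP => // eK.
by rewrite eK in r1; rewrite r1 in r.
Qed.

(** Only [L0] itself can lead to [L0], and only if each cap cut is also a cap of [b]. The condition
    on the support of [f] passes to the next step because [surgery_rule] includes orientedness. *)
Lemma backward_surgeries ps (c : cups N) f : a = b -> boundary_caps_anticlockwise t ->
  left_ends c = ps -> is_cup_diagram o G c ->
  (forall L, f L <> 0%N -> oriented (product_arcs o alpha ii a c) L) ->
  surgeries o alpha ii a ps c f L0 = if subdiagram c b then f L0 else 0%N.
Proof.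
move=> ab acw; elim: ps c f => [|p ps IH] c f e cc fo.
  rewrite /= ifT //; apply/subdiagramP=> q; by rewrite (left_ends_nil cc e) eqxx.
have [pc pmin e'] := left_ends_cons cc e.
have cc' := cut_cap_diagram aor cc pc pmin.
rewrite /= IH //; last first.
  move=> L /eqP; rewrite sum_nat_eq0 negb_forall => /existsP[L1].
  by rewrite negb_imply => /andP[/and4P[]].
have npc : c p != p by apply: contraTneq pc => ->; rewrite ltnn.
have cK q : c (c q) = q by have /cup_diagramP[] := cc.
case: ifP => [csub'|ncsub]; last first.
  by rewrite ifF //; apply: contraFF ncsub => csub; exact: cut_subdiagram.
have bK q : b (b q) = q by have /oriented_cupP[/cup_diagramP[]] := lower_oriented t.
(* The remaining caps belong to [b] already, so only the cap at [p] is in question. *)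
have csubE : subdiagram c b = (c p == b p).
  apply/idP/eqP => [csub|cb]; first exact: (subdiagramP _ _ csub).
  apply/subdiagramP=> q nq; case: (q =P p) => [->|n1]; first exact: cb.
  case: (q =P c p) => [->|n2]; first by rewrite cK cb bK.
  have ec : cut_cap c p q = c q by rewrite ffunE; do 2!case: eqP.
  by rewrite -ec; apply: (subdiagramP _ _ csub'); rewrite ec.
case: ifP => csub; last first.
  rewrite big1 // => L1 rule; apply/eqP/negPn/negP => _.
  have := backward_partner aor cc pc pmin ab acw csub' erefl rule.
  by move/eqP; rewrite -csubE csub.
have KE : L0 = intermediate t c by rewrite intermediate_acw.
have K'E : L0 = intermediate t (cut_cap c p) by rewrite intermediate_acw.
have holds := forward_rule_holds aor cc pc pmin csub KE K'E.
rewrite (bigD1 L0) //= big1 ?addn0 // => L1 /andP[rule ne].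
apply/eqP/negPn/negP => /eqP nf; case/eqP: ne.
exact: (backward_labelling aor cc pc pmin ab acw csub' erefl (fo _ nf) rule).
Qed.

End Fixed.

Lemma charge_sum (la : weight N) : in_block o I m n G la ->
  \sum_(q : 'I_N) charge (la q) = m%:Z - n%:Z.
Proof.
case/andP=> /and3P[_ /eqP Hm /eqP Hn] _.
have := congr1 Posz Hm; have := congr1 Posz Hn; rewrite !card_sum_bool => <- <-.
by rewrite -sumrB; apply: eq_bigr => q _; case: (la q).
Qed.

(* Along the rays of [c] both weights read wedges followed by vees, and the
   block determines the number of vees. *)
Lemma ray_labels (c : cups N) (la mu : weight N) :
  in_block o I m n G la -> in_block o I m n G mu ->
  oriented_cup o c la -> oriented_cup o c mu ->
  forall q : 'I_N, c q = q -> la q = LVee -> mu q = LWedge -> False.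
Proof.
move=> bla bmu /oriented_cupP[/cup_diagramP[cK cb _] ola rla].
move=> /oriented_cupP[_ omu rmu] q cq lq mq.
have /andP[_ /eqP Gla] := bla; have /andP[_ /eqP Gmu] := bmu.
have bul r : (strands (la r) == 1) = (strands (mu r) == 1).
  by rewrite -!(bullet_block o) Gla Gmu.
pose f r := charge (la r) - charge (mu r).
have f0 : \sum_(r : 'I_N) f r = 0 by rewrite sumrB !charge_sum // subrr.
have fc : \sum_(r : 'I_N | c r != r) f r = 0.
  apply: (sum_antisym cK) => r nr; first by rewrite cK eq_sym.
  have := ola r nr; have := omu r nr; rewrite /f.
  by case: (la r); case: (la (c r)); case: (mu r); case: (mu (c r)).
have fr : \sum_(r : 'I_N | c r == r) f r = 0.
  by move: f0; rewrite (bigID (fun r => c r == r)) /= fc addr0.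
have ge0 r : c r == r -> 0 <= f r.
  move/eqP=> cr; rewrite /f; have := bul r.
  case: (ltngtP r q) => [lt|gt|/ord_inj->]; last by rewrite lq mq.
    have := rmu r q lt cr cq; rewrite mq; case: (mu r) => h; case: (la r) => // _; by case: h.
  have := rla q r gt cq cr lq; case: (la r) => h; case: (mu r) => // _; by case: h.
by have := psumr_eq0P ge0 fr (introT eqP cq); rewrite /f lq mq.
Qed.

(** On the middle segments, which are the rays of [c], the weights above and below agree by
    [ray_labels]. *)
Lemma product_oriented (t : stretched) (a c : cups N) (mu : weight N) :
  in_block o I m n G mu -> oriented_cup o a mu -> oriented_cup o c mu ->
  oriented_cup o c (bottom_wt t) ->
  oriented (product_arcs o alpha (seq_of t) a c) (stack (val t).2 mu).
Proof.
move=> bmu amu cmu cnu; have /andP[_ /eqP Gmu] := bmu.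
have /oriented_cupP[acup aop _] := amu; rewrite Gmu in acup.
have /oriented_cupP[ccup cop _] := cmu; rewrite Gmu in ccup.
have /oriented_cupP[_ cop' _] := cnu.
have bnu := bottom_in_block t.
have hi (u : vert) : (u.1 <= d)%N -> stack (val t).2 mu u = Defs.double (val t).2 u.
  by move=> ud; rewrite !ffunE ud.
have lo (u : vert) : u.1 = d.+1 :> nat -> stack (val t).2 mu u = mu u.2.
  by move=> u1; rewrite ffunE u1 ltnn.
have mid (u : vert) : u.1 = d :> nat -> stack (val t).2 mu u = bottom_wt t u.2.
  by move=> u1; rewrite hi ?u1 // (bottom_vertex t u1 erefl).
have ray q : c q = q -> mult o m n (seq_of t) d q = 1 -> bottom_wt t q = mu q.
  move=> cq gq; have s1 : strands (bottom_wt t q) = 1 by rewrite bottom_strands.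
  have s2 : strands (mu q) = 1.
    by apply/eqP; rewrite -(bullet_block o) Gmu (bullet_bottom t) gq.
  have := ray_labels bnu bmu cnu cmu cq; have := ray_labels bmu bnu cmu cnu cq.
  move: s1 s2; case: (bottom_wt t q) => // _; case: (mu q) => // _ h1 h2.
    by case: h2. by case: h1.
apply/forallP=> u; apply/forallP=> v; apply/implyP=> /(product_arcP t acup ccup).
case=> [h|h1 h2 h3 h4|h1 h2 h3 h4|h1 h2 h3 h4 h5|h1 h2 h3 h4 h5].
- have lv := @stretched_levels _ _ _ _ _ _ t.
  have [_ ud _] := arcs_bullet lv h.
  have h' := h; rewrite arcs_sym in h'; have [_ vd _] := arcs_bullet lv h'.
  rewrite !hi //.
  by have /forallP/(_ u)/forallP/(_ v)/implyP := stretched_oriented t; apply.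
- rewrite ifT; last by apply/eqP/ord_inj; rewrite h1 h2.
  by rewrite !lo // -h4; apply: aop; rewrite h4; apply/eqP/nesym.
- rewrite h2 eqxx; have nq : c u.2 != u.2 by rewrite h4; apply/eqP/nesym.
  case: h1 => h1; have := h1; rewrite h2 => v1.
    by rewrite !mid // -h4; exact: cop'.
  by rewrite !lo // -h4; exact: cop.
- rewrite ifF; last by apply/eqP => e; rewrite e h2 in h1; case: (n_Sn d (esym h1)).
  by rewrite mid // lo // ray // h3.
- rewrite ifF; last by apply/eqP => e; rewrite e h2 in h1; case: (n_Sn d h1).
  by rewrite lo // mid // -h3 ray.
Qed.

(** A cup of [b] missing in [c] would leave two rays of [c] labelled vee and wedge from left to
    right. *)
Lemma subdiagram_ray_eq (c b : cups N) (la : weight N) :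
  oriented_cup o c la -> oriented_cup o b la -> n_cw b la == 0%N ->
  subdiagram c b -> c = b.
Proof.
move=> /oriented_cupP[/cup_diagramP[cK _ _] _ rc] /oriented_cupP[/cup_diagramP[bK _ _] bop _].
move=> /n_cw0P cw /subdiagramP csub.
have nlt (p : 'I_N) : (p < b p)%N -> c p = b p.
  move=> lt; case: (c p =P p) => [cp|/eqP/csub //].
  have cbp : c (b p) = b p.
    case: (c (b p) =P b p) => // /eqP/csub; rewrite bK => e.
    by have := cK (b p); rewrite e cp => e'; rewrite -e' ltnn in lt.
  have nb : b p != p by apply: contraTneq lt => ->; rewrite ltnn.
  have := rc p (b p) lt cp cbp; have := cw p lt; have := bop p nb.
  by case: (la p); case: (la (b p)) => // _ _ h; case: h.
apply/ffunP=> p; case: (ltngtP p (b p)) => [/nlt //|lt|/ord_inj e].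
  have := nlt (b p); rewrite bK => /(_ lt) e.
  by rewrite -[in LHS]e cK.
case: (c p =P p) => [->//|/eqP/csub //].
Qed.

Lemma subdiagram_refl (c : cups N) : subdiagram c c.
Proof. exact/subdiagramP. Qed.

Lemma T_basis_eq (x y : T_basis I o m n alpha d) : (val x).1 = (val y).1 ->
  (val x).2 = (val y).2 -> x = y.
Proof.
by move=> e1 e2; apply: val_inj; rewrite [LHS]surjective_pairing e1 e2 -surjective_pairing.
Qed.

(** All boundary caps are made anti-clockwise. *)
Definition acw_stretched (t : stretched) : stretched :=
  flip_stretched (cw_part t (@lower_cups o m n d (seq_of t))) t.

Lemma acw_stretched_seq t : seq_of (acw_stretched t) = seq_of t.
Proof.
apply: flip_stretched_seq; first exact: cw_part_closed.
exact: (cw_part_top (subdiagram_refl _)).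
Qed.

Lemma forward_coef (t : stretched) (a : cups N)
    (k : K_basis I o m n alpha d) (x y : T_basis I o m n alpha d) :
  val k = (a, bottom_wt t, @lower_cups o m n d (seq_of t)) ->
  val x = (@lower_cups o m n d (seq_of t), acw_stretched t) ->
  structure_coef k x y = (val y == (a, t)).
Proof.
move=> kE xE; have /and3P[_ + _] := valP k; rewrite kE /= => aor.
rewrite /structure_coef kE xE; case yE: (val y) => [a2 t2].
have -> : (val y == (a, t)) = ((a2, t2) == (a, t)) by rewrite -yE.
rewrite eqxx acw_stretched_seq /= xpair_eqE.
case: (a2 =P a) => // _ /=; case: (seq_of t2 =P seq_of t) => [e|ne]; last first.
  by rewrite (_ : (t2 == t) = false) //; apply/eqP => e; rewrite e in ne.
have /oriented_cupP[bc _ _] := lower_oriented t; rewrite block_of_bottom in bc.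
have := forward_surgeries aor (Defs.double (val t2).2) erefl bc (subdiagram_refl _).
rewrite /intermediate -/(acw_stretched t) => ->.
congr nat_of_bool; apply/eqP/eqP => [h|-> //].
by apply: stretched_eq => // u _; rewrite h.
Qed.

Lemma backward_coef (t : stretched) (k : K_basis I o m n alpha d) (x y : T_basis I o m n alpha d) :
  val y = (@lower_cups o m n d (seq_of t), t) -> boundary_caps_anticlockwise t ->
  structure_coef k x y =
    (val k == (@lower_cups o m n d (seq_of t), bottom_wt t, @lower_cups o m n d (seq_of t)))
    && (x == y).
Proof.
move=> yE acw; set b := lower_cups _ _ _ _ _ in yE *.
have xyE : (x == y) = (val x == val y) by [].
rewrite xyE yE; have := valP k; have := valP x; rewrite /structure_coef yE.
case: (val k) => [[a' mu] b'] /=; case: (val x) => a0 t0 /= ox /and3P[bmu oa ob].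
rewrite !xpair_eqE.
case: (b' =P a0) => [eb|ne] /=; last first.
  case: (a' == b); case: (mu == _); case: (b' =P b) => // e'; case: (a0 =P b) => // e2.
  by case: ne; rewrite e' e2.
case: (b =P a') => [ea|ne] /=; last first.
  by rewrite (_ : (a' == b) = false) //; apply/eqP => e; case: ne.
case: (seq_of t =P seq_of t0) => [es|ne] /=; last first.
  rewrite (_ : (t0 == t) = false) ?andbF //; apply/eqP => e; apply: ne.
  by rewrite e.
have aor : oriented_cup o a' (bottom_wt t) by rewrite -ea; exact: lower_oriented.
have cc : is_cup_diagram o G a0.
  by have /oriented_cupP[+ _ _] := ox; rewrite block_of_bottom.
rewrite -es (backward_surgeries aor (esym ea) acw erefl cc); last first.
  move=> L; case: eqP => // -> _; rewrite es; apply: product_oriented => //.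
  by rewrite -eb.
rewrite -ea eqxx eb /= -/b.
have eqL (t1 : stretched) : Defs.double (val t1).2 = stack (val t1).2 (bottom_wt t1) by [].
case: (a0 =P b) => [e0|ne0] /=.
  rewrite e0 subdiagram_refl andbT; congr nat_of_bool; apply/eqP/andP => [h|[/eqP-> /eqP->]] //.
  (* Line [d.+1] of the stack carries [mu]. *)
  have hb : mu = bottom_wt t.
    apply/ffunP => q; have := congr1 (fun L : labelling N d => L (lower_pt q)) h.
    have l1 := lower_pt1 (m := m) (n := n) (d := d) q.
    by rewrite !ffunE l1 ltnn /= => ->.
  split; apply/eqP => //; symmetry; apply: stretched_eq => // u ud.
  by rewrite h !ffunE ud.
(* The surgeries only force [a0] to be contained in [b]. Both orient the same weight, with all cups
   of [b] anti-clockwise, so they are equal. *)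
rewrite !andbF; case: ifP => // sub; case: eqP => // h.
have hb : mu = bottom_wt t.
  apply/ffunP => q; have := congr1 (fun L : labelling N d => L (lower_pt q)) h.
  have l1 := lower_pt1 (m := m) (n := n) (d := d) q.
  by rewrite !ffunE l1 ltnn /= => ->.
case: ne0; apply: (subdiagram_ray_eq (la := bottom_wt t)) sub.
- by rewrite -hb -eb.
- exact: lower_oriented.
- exact: lower_acw.
Qed.

End Products.

(** * The dual of T *)


Section Dual.
Variables (I : pred int) (o : int) (m n : nat) (alpha : lattice) (d : nat).
Variable F : fieldType.
Local Notation N := (width m n d).
Local Notation stretched := (stretched I o m n alpha d).
Local Notation T_basis := (T_basis I o m n alpha d).
Local Notation K_basis := (K_basis I o m n alpha d).
Local Notation TM := (T_module I o m n alpha d F).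
Local Notation HomT := 'Hom(TM, F^o).
Local Notation G := (Defs.Gamma o m n alpha).
Local Notation e_ x := (T_vec F (x : T_basis)).

Definition coordinate (x : T_basis) (v : TM) : F^o := v x.

Lemma coordinate_linear x : linear (coordinate x).
Proof. by move=> c u v; rewrite /coordinate !ffunE. Qed.
HB.instance Definition _ x :=
  GRing.isLinear.Build F TM F^o _ (coordinate x) (coordinate_linear x).

Lemma T_vec_expansion (v : TM) : v = \sum_x v x *: e_ x.
Proof.
apply/ffunP=> y; rewrite sum_ffunE (bigD1 y) //= big1 => [|x xy].
  by rewrite !ffunE eqxx addr0 /GRing.scale /= mulr1.
by rewrite !ffunE eq_sym (negPf xy) scaler0.
Qed.

Lemma Hom_expansion (f : HomT) v : f v = \sum_x v x * f (e_ x).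
Proof. by rewrite {1}[v]T_vec_expansion linear_sum; apply: eq_bigr => x _; rewrite linearZ. Qed.

Lemma K_act_vec (k : K_basis) x y : K_act k (e_ x) y = (structure_coef k x y)%:R.
Proof.
rewrite ffunE (bigD1 x) //= ffunE eqxx mul1r big1 ?addr0 // => z zx.
by rewrite ffunE (negPf zx) mul0r.
Qed.

Variable la : weight N.

Definition dual_support : pred T_basis := fun x =>
  [&& (val x).1 == underline o la, bottom_wt (val x).2 == la
    & boundary_caps_anticlockwise (val x).2].

Lemma K_basis_exists (a b : cups N) (mu : weight N) : in_block o I m n G mu ->
  oriented_cup o a mu -> oriented_cup o b mu -> exists k : K_basis, val k = (a, mu, b).
Proof.
move=> h1 h2 h3.
have h : [&& in_block o I m n G mu, oriented_cup o a mu & oriented_cup o b mu] by rewrite h1 h2.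
by exists (exist _ (a, mu, b) h).
Qed.

Lemma T_basis_exists (a : cups N) (t : stretched) : oriented_cup o a (bottom_wt t) ->
  exists x : T_basis, val x = (a, t).
Proof. by move=> h; exists (exist (fun x : cups N * stretched => oriented_cup o x.1 (bottom_wt x.2)) (a, t) h). Qed.

Lemma acw_oriented (t : stretched) :
  oriented_cup o (@lower_cups o m n d (seq_of t)) (bottom_wt (acw_stretched t)).
Proof. by rewrite -(acw_stretched_seq t); exact: lower_oriented. Qed.

(* Every [e_ x] is a product [k * e_ x'] with [x'] the generator of the
   indecomposable summand containing it. *)
Lemma dual_vanishes (f : HomT) x : f \in D_module I o alpha F la ->
  ~~ dual_support x -> f (e_ x) = 0.
Proof.
move=> /mem_D_module fD; apply: contraNeq => fx.
case xE: (val x) => [a t]; have := valP x; rewrite xE /= => aor.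
have [k kE] := K_basis_exists (bottom_in_block t) aor (lower_oriented t).
have [x' x'E] := T_basis_exists (acw_oriented t).
have prod : K_act k (e_ x') = e_ x.
  apply/ffunP=> y; rewrite K_act_vec (forward_coef y kE x'E) ffunE -xE.
  by congr _%:R.
have := fD k (e_ x'); rewrite prod /L_char => fE.
have kk : val k == (underline o la, la, underline o la).
  by apply: contraNT fx => ne; rewrite fE (negPf ne) mul0r.
move: kk; rewrite kE !xpair_eqE => /andP[/andP[/eqP ea /eqP el] /eqP eb].
rewrite /dual_support xE /= ea el !eqxx /=; apply: acw_lower.
by rewrite eb el underline_acw.
Qed.

(** With anti-clockwise boundary caps the lower reduction has the property that characterises
    [underline o la]. *)
Lemma support_lower (x : T_basis) : dual_support x ->
  val x = (@lower_cups o m n d (seq_of (val x).2), (val x).2) /\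
  underline o la = @lower_cups o m n d (seq_of (val x).2).
Proof.
case/and3P=> /eqP h1 /eqP h2 h3.
have E : underline o la = @lower_cups o m n d (seq_of (val x).2).
  apply: underline_unique; first by rewrite -h2; exact: lower_oriented.
  by rewrite -h2; exact: lower_acw.
by split=> //; rewrite -E -h1 -surjective_pairing.
Qed.

(** [f (K_act k v)] depends only on the coefficients at supported [y]. By [backward_coef], these are
    multiplied by 1 if [k] is the idempotent of [la] and by 0 otherwise, as [L_char] prescribes. *)
Lemma supported_dual (f : HomT) : (forall x, ~~ dual_support x -> f (e_ x) = 0) ->
  f \in D_module I o alpha F la.
Proof.
move=> f0; apply/mem_D_module => k v; rewrite Hom_expansion [f v]Hom_expansion mulr_sumr.
apply: eq_bigr => y _; case sy: (dual_support y); last by rewrite f0 ?sy // !mulr0.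
rewrite mulrA; congr (_ * _); rewrite ffunE /L_char.
have [yE ulE] := support_lower sy; have /and3P[_ /eqP bl acw] := sy.
rewrite (bigD1 y) //= big1 => [|x xy].
  by rewrite (backward_coef k y yE acw) eqxx andbT -ulE bl addr0 mulrC.
by rewrite (backward_coef k x yE acw) (negPf xy) andbF mulr0.
Qed.

Variables (ii : seq int) (j : int).

(** A map of degree [j] to a module concentrated in degree 0 can be non-zero only on vectors of
    degree [- j]. *)
Definition degree_support : pred T_basis := fun x =>
  [&& dual_support x, seq_of (val x).2 == ii & T_degree x == - j].

Lemma idem_fun_vec x : idem_fun ii (e_ x) = if seq_of (val x).2 == ii then e_ x else 0.
Proof.
apply/ffunP=> y; rewrite ffunE; case: ifP => h; case: ifP => h'; rewrite ?ffunE //.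
- by case: eqP => // e; rewrite e h' in h.
- by case: eqP => // e; rewrite e h' in h.
Qed.

Lemma mem_eD_deg (f : HomT) : reflect (forall x, ~~ degree_support x -> f (e_ x) = 0)
  (f \in eD_deg I o alpha F ii la j).
Proof.
rewrite /eD_deg memv_cap; apply: (iffP andP) => [[/memv_imgP[h hD fE] /mem_Hom_deg fd] x nx|f0].
  have fD : f \in D_module I o alpha F la.
    apply/mem_D_module => k v; rewrite fE lfunE /= !comp_lfunE !lfunE /= idem_fun_K_act.
    by have /mem_D_module -> := hD.
  case sx: (dual_support x); last by apply: dual_vanishes => //; rewrite sx.
  case ex: (seq_of (val x).2 == ii); last first.
    by rewrite fE lfunE /= comp_lfunE lfunE /= idem_fun_vec ex linear0.
  have := fd x; rewrite /L_deg; case: eqP => [e|_]; last by rewrite memv0 => /eqP.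
  by move: nx; rewrite /degree_support sx ex -[T_degree x](addrK j) e sub0r eqxx.
have fD : f \in D_module I o alpha F la.
  by apply: supported_dual => x nx; apply: f0; rewrite /degree_support (negPf nx).
split.
  apply/memv_imgP; exists f => //; apply/lfunP => v.
  rewrite lfunE /= comp_lfunE lfunE /= Hom_expansion [RHS]Hom_expansion.
  apply: eq_bigr => x _; rewrite ffunE; case: ifP => // nx.
  by rewrite mul0r f0 ?mulr0 // /degree_support nx andbF.
apply/mem_Hom_deg => x; rewrite /L_deg; case: eqP => [_|ne]; first exact: memvf.
rewrite memv0 f0 // /degree_support; apply/negP => /and3P[_ _ /eqP e].
by apply: ne; rewrite e addNr.
Qed.

(** The coordinate functionals of the vectors in [degree_support] form a basis. *)
Lemma dim_eD_deg : \dim (eD_deg I o alpha F ii la j) = #|[set x | degree_support x]|.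
Proof.
pose xs := enum [set x | degree_support x].
pose X := [seq linfun (coordinate x) | x <- xs].
have Xf : free X.
  apply/(@freeP _ _ _ (in_tuple X)) => c cX i.
  have sz : size X = size xs by rewrite size_map.
  have ix : (i < size xs)%N by rewrite -sz ltn_ord.
  have x0 : T_basis by case: (xs) ix => // x.
  have := congr1 (fun f : HomT => f (e_ (nth x0 xs i))) cX.
  rewrite sum_lfunE (bigD1 i) //= big1 => [|k ki].
    rewrite addr0 scale_lfunE (nth_map x0) // lfunE /= /coordinate ffunE eqxx.
    by rewrite zero_lfunE /GRing.scale /= mulr1.
  have kx : (k < size xs)%N by rewrite -sz ltn_ord.
  rewrite scale_lfunE (nth_map x0) // lfunE /= /coordinate ffunE nth_uniq ?enum_uniq //.
  by rewrite -[_ == _ :> nat]/(k == i) (negPf ki) scaler0.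
have -> : eD_deg I o alpha F ii la j = <<X>>%VS.
  apply/vspaceP => f; apply/mem_eD_deg/idP => [f0|].
    have -> : f = \sum_(x <- xs) f (e_ x) *: linfun (coordinate x).
      apply/lfunP => v; rewrite Hom_expansion sum_lfunE.
      rewrite (bigID degree_support) /= [X in _ + X]big1 ?addr0; last first.
        by move=> x nx; rewrite f0 ?mulr0.
      rewrite [RHS]big_enum /=; apply: eq_big => [x|x _]; first by rewrite inE.
      by rewrite scale_lfunE lfunE /= mulrC.
    rewrite big_seq; apply: memv_suml => x xX; apply: memvZ; apply: memv_span.
    exact: map_f.
  move=> /(@coord_span _ _ _ (in_tuple X))-> x nx; rewrite sum_lfunE big1 // => i _.
  rewrite scale_lfunE; have : X`_i \in X by apply: mem_nth; exact: ltn_ord.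
  case/mapP=> y; rewrite mem_enum inE => dy ->; rewrite lfunE /= /coordinate ffunE.
  by case: eqP => [e|_]; [move: nx; rewrite -e dy|rewrite scaler0].
by rewrite (eqP Xf) size_map -cardE.
Qed.

(** The cup diagram of a supported basis vector is always [underline o la], so the vector is
    determined by its stretched cap diagram. *)
Lemma card_degree_support : #|[set x | degree_support x]| =
  #|[set t : stretched | [&& seq_of t == ii, stretched_degree t == - j,
       bottom_wt t == la & boundary_caps_anticlockwise t]]|.
Proof.
have inj : {in [set x | degree_support x] &, injective (fun x : T_basis => (val x).2)}.
  move=> x y; rewrite !inE => /andP[/and3P[/eqP hx _ _] _] /andP[/and3P[/eqP hy _ _] _] e.
  by apply: T_basis_eq => //; rewrite hx hy.
have deg x : dual_support x -> T_degree x = stretched_degree (val x).2.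
  case/and3P=> /eqP h1 /eqP h2 _; apply: T_degree_acw.
  by rewrite h1 h2 underline_acw.
rewrite -(card_in_imset inj); apply: eq_card => t; rewrite [RHS]inE.
apply/imsetP/and4P => [[x + ->]|[h1 h2 h3 h4]].
  rewrite inE => /and3P[sx h1 h2]; have /and3P[_ h3 h4] := sx.
  by split=> //; rewrite -deg.
have uE : underline o la = @lower_cups o m n d (seq_of t).
  by apply: underline_unique; rewrite -(eqP h3); [exact: lower_oriented|exact: lower_acw].
have [|x xE] := @T_basis_exists (underline o la) t.
  by rewrite uE; exact: lower_oriented.
have sx : dual_support x by rewrite /dual_support xE /= eqxx h3.
by exists x; rewrite ?xE // inE /degree_support sx deg // xE /= h1.
Qed.

End Dual.

Theorem theorem9p9 (R : realType)
  (I : pred int) (o : int) (hI : index_set I o)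
  (m n : nat) (hm : le_card_succ m I) (hn : le_card_succ n I)
  (alpha : lattice) (d : nat) (halpha : in_Qplus I alpha d)
  (hGamma : is_block o I m n (LambdaW o m n - alpha))
  (ii : d.-tuple int) (his : in_I_alpha I alpha ii)
  (j : int)
  (la : weight (width m n d))
  (hla : in_block_circ o I m n (LambdaW o m n - alpha) la) :
  \dim (eD_deg I o alpha R[i]%C ii la j) =
  #|[set t : stretched I o m n alpha d |
      [&& seq_of t == ii,
          stretched_degree t == j,
          bottom_wt t == la
        & boundary_caps_anticlockwise t]]|.
Proof. by rewrite dim_eD_deg card_degree_support [RHS]reverse_count. Qed.
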